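(* There is a function $h: \mathbb{R}_{\geq 1} \times \mathbb{Z}_{\geq 0} \to \mathbb{R}_{\geq 1}$ such that for every $C \in \mathbb{R}_{\geq 1}$ and $m \in \mathbb{Z}_{\geq 0}$ the following holds: for any prime power $q$, any $\epsilon = \pm$, any $G = \mathrm{GL}^\epsilon_n(q)$ or $G=\mathrm{SL}^\epsilon_n(q)$ with $n \geq h(C,m)$, any $\chi \in \mathrm{Irr}(G)$, and any $g \in G$ with $|\mathbf{C}_{\mathrm{GL}^\epsilon_n(q)}(g)| \leq q^{Cn}$, one has $|\chi(g)| \leq \chi(1)^{1/2^m}$.
   Context: $\mathrm{GL}^+_n(q)=\mathrm{GL}_n(q)$, $\mathrm{GL}^-_n(q)=\mathrm{GU}_n(q)$, and $\mathrm{SL}^\epsilon_n(q)$ is the determinant-one subgroup; $\mathbf{C}_H(g)$ denotes the centralizer of $g$ in $H$. *)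

(* Defs.v *)
From HB Require Import structures.
From Stdlib Require Import Reals.
From mathcomp Require Import all_boot all_order all_algebra all_fingroup all_solvable all_field all_character.
Set Implicit Arguments. Unset Strict Implicit. Unset Printing Implicit Defensive.
Import GRing.Theory Num.Theory.

Local Open Scope ring_scope.
Local Open Scope group_scope.

Definition frobmx (F : finFieldType) (q : nat) m n (A : 'M[F]_(m, n)) :=
  map_mx (fun x : F => (x ^+ q)%R) A.

(* Unitary matrices: (A^(q))^T A = 1, over F = F_{q^2}. *)
Definition GU_set (n : nat) (F : finFieldType) (q : nat) : {set {'GL_n[F]}} :=
  [set A : {'GL_n[F]} | ((frobmx q (GLval A))^T *m GLval A == 1%:M)%R].

Definition detone_set (n : nat) (F : finFieldType) : {set {'GL_n[F]}} :=
  [set A : {'GL_n[F]} | \det (GLval A) == 1%R].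

(* GL^eps_n(q): eps = true means +, i.e. GL_n(q) (with #|F| = q);
   eps = false means -, i.e. GU_n(q) inside GL_n(q^2) (with #|F| = q^2).
   The subgroup generated by a set that is already a subgroup is that set. *)
Definition GLe (eps : bool) (n : nat) (F : finFieldType) (q : nat)
  : {group {'GL_n[F]}} :=
  if eps then [set: {'GL_n[F]}]%G else <<GU_set n F q>>%G.

Definition SLe (eps : bool) (n : nat) (F : finFieldType) (q : nat)
  : {group {'GL_n[F]}} :=
  (GLe eps n F q :&: <<detone_set n F>>)%G.

Definition field_size (eps : bool) (q : nat) : nat := if eps then q else (q ^ 2)%N.

(* Main.v *)
(* If |C(g)| <= q^(c n), column orthogonality gives
   |chi(g)|^(2k) <= |C(g)| <chi^k, chi^k> for every k, so a character of degree
   q^(Rn - O(1)) with R large is settled by k = 1, and it remains to bound the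
   moments of characters of small degree.  GL_n(q) is the unitary group over
   F_q x F_q with the swap involution, so that both families are treated as
   unitary groups over a ring with involution; SL contains all Eichler
   transformations, which is all that is used of the group.
   Fix a module affording chi.  A nondegenerate character of the centre of the
   unipotent radical of rank r occurring in it forces
   chi(1) >= q^(r(n - 2r)) by Stone-von Neumann for the Heisenberg group Q with
   Q/Z = V0^r, V0 being the orthogonal of a hyperbolic space of rank r.  For a
   maximal such r < R, the transvections of V0 act through the enveloping algebra
   of Q, and chi restricted to the group S they generate contains a constituent
   theta with |theta(h)|^2 = |V0^h|^r.  Hence chi is part of Ind_S theta, which
   is at most q^O(1) |V^h|^(5r) in absolute value, and the moments <chi^k, chi^k>
   are bounded by a power of q times the number of orbits on tuples of vectors,
   which is at most a power of q with exponent independent of n. *)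
Require Import Defs.
From Stdlib Require Import Reals ZArith Classical_Prop.
From HB Require Import structures.
From mathcomp Require Import all_boot all_order all_algebra all_fingroup all_solvable all_field all_character.
From mathcomp Require Import ring zify.
Set Implicit Arguments. Unset Strict Implicit. Unset Printing Implicit Defensive.
Import Order.TTheory GRing.Theory Num.Theory.
Local Open Scope ring_scope.

(** Maximality of r enters as follows. If a transvection t along e0 in V0 moved an eigenvector of Z
    fixed by the elements E(e0 a) of Q, a nontrivial character of the root group of e0 would occur
    on such vectors and enlarge the frame by e0. Hence t fixes them all. The conjugates by the E(f0
    b) of the projection onto these vectors sum to a scalar, and inserting this sum next to t writes
    t explicitly as a combination of elements of Q. The exponent 5r is r + 4r. The first r bounds
    theta. For the rest, S contains a conjugate of the group T of transvections along isotropic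
    vectors whose first 4r coordinates vanish; h is conjugate by y into T only if h fixes the images
    under y of 4r basis vectors, and T has index at most |A|^9 in the stabiliser of these basis
    vectors. Rank 0 is separate: all transvections act trivially, and chi is linear because
    unitaries acting on disjoint blocks of three coordinates commute and represent everything modulo
    transvections. An element s with s + s* = 1 takes the place of 1/2, so even q is treated along
    with odd q. *)

Record involRing := InvolRing {
  invol_sort :> finComNzRingType;
  invol : {rmorphism invol_sort -> invol_sort};
  involK : involutive invol }.

(* Both finite fields of order q^2 with the q-Frobenius and products of two
   copies of a field of order q with the swap satisfy these axioms; their
   unitary groups are GU_n(q) and GL_n(q). *)
Record hermitian_ring (q : nat) (A : involRing) : Prop := HermitianRing {
  herm_q_gt1 : (1 < q)%N;
  herm_card : #|A| = (q ^ 2)%N;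
  herm_norm : exists k : A, k * invol A k = -1;
  herm_trace : exists s : A, s + invol A s = 1;
  herm_skew_unit : exists c : A, exists2 d, invol A c = - c & c * d = 1;
  herm_skew_gen : forall y c : A, y != 0 -> invol A c = - c ->
    exists x, c = y * x - invol A (y * x);
  herm_split : (forall x : A, x != 0 -> exists y, x * y = 1) \/
    (exists eps : A, [/\ eps * invol A eps = 0, eps + invol A eps = 1 &
       forall x, eps * x != 0 -> exists y, eps * x * y = eps]) }.

Definition star (A : involRing) m n (M : 'M[A]_(m, n)) : 'M[A]_(n, m) :=
  (map_mx (invol A) M)^T.
Notation "M ^h" := (star M) (at level 2, format "M ^h") : ring_scope.

(** * Unitary groups over a ring with involution, Eichler transformations, transvections *)

Section Hermitian.
Variable A : involRing.
Implicit Types m n p : nat.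

Lemma starE m n (M : 'M[A]_(m, n)) i j : M^h i j = invol A (M j i).
Proof. by rewrite !mxE. Qed.

Lemma starM m n p (M : 'M[A]_(m, n)) (N : 'M[A]_(n, p)) : (M *m N)^h = N^h *m M^h.
Proof. by rewrite /star map_mxM trmx_mul. Qed.

Lemma starD m n (M N : 'M[A]_(m, n)) : (M + N)^h = M^h + N^h.
Proof. by rewrite /star map_mxD linearD. Qed.

Lemma starN m n (M : 'M[A]_(m, n)) : (- M)^h = - M^h.
Proof. by rewrite /star map_mxN linearN. Qed.

Lemma starB m n (M N : 'M[A]_(m, n)) : (M - N)^h = M^h - N^h.
Proof. by rewrite starD starN. Qed.

Lemma star0 m n : (0 : 'M[A]_(m, n))^h = 0.
Proof. by rewrite /star map_mx0 trmx0. Qed.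

Lemma star_scalar n (a : A) : (a%:M : 'M[A]_n)^h = (invol A a)%:M.
Proof. by rewrite /star map_scalar_mx tr_scalar_mx. Qed.

Lemma star1 n : (1%:M : 'M[A]_n)^h = 1%:M.
Proof. by rewrite star_scalar rmorph1. Qed.

Lemma starZ m n a (M : 'M[A]_(m, n)) : (a *: M)^h = invol A a *: M^h.
Proof. by rewrite /star map_mxZ linearZ. Qed.

Lemma starK m n : cancel (@star A m n) (@star A n m).
Proof. by move=> M; apply/matrixP=> i j; rewrite !starE involK. Qed.

Lemma star_row_mx m n p (M : 'M[A]_(m, n)) (N : 'M[A]_(m, p)) :
  (row_mx M N)^h = col_mx M^h N^h.
Proof. by rewrite /star map_row_mx tr_row_mx. Qed.

Lemma star_block m n p r (a : 'M[A]_(m, n)) (b : 'M_(m, r)) (c : 'M_(p, n)) (d : 'M_(p, r)) :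
  (block_mx a b c d)^h = block_mx a^h c^h b^h d^h.
Proof. by rewrite /star map_block_mx tr_block_mx. Qed.

Record unitary n := Unitary { umx :> 'M[A]_n; _ : umx^h *m umx == 1%:M }.
HB.instance Definition _ n := [isSub for @umx n].
HB.instance Definition _ n := [Finite of unitary n by <:].

Section UnitaryGroup.
Variable n : nat.
Implicit Types g h : unitary n.

Lemma umxP g : g^h *m g = 1%:M.
Proof. by case: g => M /= /eqP. Qed.

Lemma umxPr g : g *m g^h = 1%:M.
Proof. exact/mulmx1C/umxP. Qed.

Definition unitary_one : unitary n.
Proof. by exists 1%:M; rewrite star1 mul1mx. Defined.

Definition unitary_mul g h : unitary n.
Proof. by exists (g *m h); rewrite starM -mulmxA (mulmxA g^h) umxP mul1mx umxP. Defined.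

Definition unitary_inv g : unitary n.
Proof. by exists g^h; rewrite starK umxPr. Defined.

Lemma unitary_mulA : associative unitary_mul.
Proof. by move=> g h k; apply/val_inj; rewrite /= mulmxA. Qed.

Lemma unitary_mul1 : left_id unitary_one unitary_mul.
Proof. by move=> g; apply/val_inj; rewrite /= mul1mx. Qed.

Lemma unitary_mulV : left_inverse unitary_one unitary_inv unitary_mul.
Proof. by move=> g; apply/val_inj; rewrite /= umxP. Qed.
End UnitaryGroup.

HB.instance Definition _ n := Finite_isGroup.Build (unitary n)
  (@unitary_mulA n) (@unitary_mul1 n) (@unitary_mulV n).

Variable n : nat.
Local Notation U := (unitary n).
Implicit Types g h : U.

Lemma umxM g h : umx (g * h)%g = g *m h. Proof. by []. Qed.
Lemma umxV g : umx g^-1%g = g^h. Proof. by []. Qed.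

Lemma umx_inj : injective (@umx n). Proof. exact: val_inj. Qed.

Lemma umx_form g m p (x : 'M[A]_(n, m)) (y : 'M[A]_(n, p)) :
  (g *m x)^h *m (g *m y) = x^h *m y.
Proof. by rewrite starM -mulmxA (mulmxA g^h) umxP mul1mx. Qed.

Lemma umxKV g m (x : 'M[A]_(n, m)) : umx g^-1%g *m (g *m x) = x.
Proof. by rewrite mulmxA umxV umxP mul1mx. Qed.

Lemma umxVK g m (x : 'M[A]_(n, m)) : g *m (umx g^-1%g *m x) = x.
Proof. by rewrite mulmxA umxV umxPr mul1mx. Qed.

Section EichlerElt.
Variable m : nat.
Implicit Types (e u v : 'M[A]_(n, m)) (s t : 'M[A]_m).

(** The Eichler transformation x -> x + u<e,x> - e<u,x> + e s<e,x> along the totally isotropic space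
    spanned by the columns of [e]. One column and u = 0 give a transvection. *)
Definition eichler_mx e u s : 'M[A]_n :=
  1%:M + u *m e^h - e *m u^h + e *m s *m e^h.

Definition eichlerP e u s := [/\ e^h *m e = 0, e^h *m u = 0 & s + s^h = - (u^h *m u)].

(** Total in its arguments: the default 1 stands in when the matrix is not unitary. The last clause
    of [eichlerP] is the unitarity condition. *)
Definition eichler e u s : U := insubd (1%g : U) (eichler_mx e u s).

Lemma eichler_mxM e u v s t : e^h *m e = 0 -> e^h *m u = 0 -> e^h *m v = 0 ->
  eichler_mx e u s *m eichler_mx e v t = eichler_mx e (u + v) (s + t - u^h *m v).
Proof.
move=> ee eu ev.
have ue : u^h *m e = 0 by rewrite -[LHS]starK starM starK eu star0.
rewrite /eichler_mx starD !(mulmxDl, mulmxDr, mulmxBl, mulmxBr, mulNmx, mulmxN, mul1mx, mulmx1) !mulmxA.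
rewrite -(mulmxA u e^h v) -(mulmxA _ e^h v) -(mulmxA u e^h e) -(mulmxA _ u^h e) -(mulmxA _ e^h e).
rewrite ee ev ue !(mulmx0, mul0mx, add0r, addr0, subr0, oppr0, sub0r).
rewrite !opprD; set a := e *m u^h; set b := e *m v^h; set c := u *m _; set d := v *m _.
set x := e *m s *m _; set y := e *m t *m _; set z := e *m _ *m _ *m _.
by rewrite !addrA [LHS](ACl (1*5*2*6*3*8*4*7)).
Qed.

Lemma eichler_mx_star e u s : (eichler_mx e u s)^h = eichler_mx e (- u) s^h.
Proof.
rewrite /eichler_mx !(starD, starB, starN, starM, star1, starK) mulNmx mulmxN opprK mulmxA.
by rewrite [1%:M - _ + _](ACl (1*3*2)) /=; congr (_ + _); rewrite addrAC.
Qed.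

Lemma eichler_mx0 e : eichler_mx e 0 0 = 1%:M.
Proof. by rewrite /eichler_mx star0 !(mulmx0, mul0mx) subr0 !addr0. Qed.

Lemma eichlerE e u s : eichlerP e u s -> umx (eichler e u s) = eichler_mx e u s.
Proof.
case=> ee eu su; rewrite /eichler val_insubd eichler_mx_star.
rewrite eichler_mxM ?mulmxN ?eu ?oppr0 // addNr starN mulNmx opprK.
by rewrite [s^h + _]addrC su addNr eichler_mx0 eqxx.
Qed.

Lemma eichlerP_D e u v s t : eichlerP e u s -> eichlerP e v t ->
  eichlerP e (u + v) (s + t - u^h *m v).
Proof.
case=> ee eu su [_ ev tv]; split=> //; first by rewrite mulmxDr eu ev addr0.
rewrite starB !starD starM starK mulmxDl !mulmxDr !opprD.
rewrite (_ : - (u^h *m u) = s + s^h) // (_ : - (v^h *m v) = t + t^h) //.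
by rewrite !addrA [LHS](ACl (1*4*3*6*2*5)) /=.
Qed.

Lemma eichlerM e u v s t : eichlerP e u s -> eichlerP e v t ->
  (eichler e u s * eichler e v t)%g = eichler e (u + v) (s + t - u^h *m v).
Proof.
move=> Pu Pv; apply/umx_inj; rewrite umxM !eichlerE //; last exact: eichlerP_D.
by case: Pu Pv => ee eu su [_ ev tv]; apply: eichler_mxM.
Qed.

Lemma eichlerP_J g e u s : eichlerP e u s -> eichlerP (g *m e) (g *m u) s.
Proof. by case=> ee eu su; split; rewrite ?umx_form. Qed.

Lemma eichlerJ g e u s : eichlerP e u s ->
  (g * eichler e u s * g^-1)%g = eichler (g *m e) (g *m u) s.
Proof.
move=> Pu; apply/umx_inj; rewrite !umxM (eichlerE Pu) (eichlerE (eichlerP_J g Pu)) umxV.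
rewrite /eichler_mx !starM !(mulmxDl, mulmxDr, mulmxBl, mulmxBr) mulmx1 umxPr.
by rewrite mulmxN mulNmx !mulmxA.
Qed.

Lemma eichler0 e : e^h *m e = 0 -> eichler e 0 0 = 1%g.
Proof.
move=> ee; apply/umx_inj; rewrite eichlerE ?eichler_mx0 //.
by split; rewrite ?mulmx0 // star0 addr0 oppr0.
Qed.

Lemma eichlerP0 e s : e^h *m e = 0 -> s^h = - s -> eichlerP e 0 s.
Proof. by move=> ee ss; split; rewrite ?mulmx0 ?ss ?subrr ?oppr0. Qed.

End EichlerElt.

Definition transv (w : 'cV[A]_n) (c : A) : U := eichler w 0 (c%:M : 'M_1).

Lemma transvP w c : w^h *m w = 0 -> invol A c = - c -> eichlerP w 0 (c%:M : 'M_1).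
Proof. by move=> ww cc; apply: eichlerP0; rewrite ?star_scalar ?cc ?rmorphN. Qed.

Lemma transvE w c : w^h *m w = 0 -> invol A c = - c ->
  umx (transv w c) = 1%:M + c *: (w *m w^h).
Proof.
move=> ww cc; rewrite (eichlerE (transvP ww cc)) /eichler_mx star0 mul0mx mulmx0 subr0 addr0.
by rewrite mul_mx_scalar scalemxAl.
Qed.

Lemma transvJ g w c : w^h *m w = 0 -> invol A c = - c ->
  (g * transv w c * g^-1)%g = transv (g *m w) c.
Proof. by move=> ww cc; rewrite (eichlerJ _ (transvP ww cc)) mulmx0. Qed.

Lemma transvD w c d : w^h *m w = 0 -> invol A c = - c -> invol A d = - d ->
  (transv w c * transv w d)%g = transv w (c + d).
Proof.
move=> ww cc dd; rewrite (eichlerM (transvP ww cc) (transvP ww dd)).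
by rewrite star0 mul0mx subr0 addr0 -raddfD.
Qed.

Definition transv_group (X : {pred 'cV[A]_n}) : {group U} :=
  <<[set g | [exists w, exists c, [&& w \in X, w^h *m w == 0, invol A c == - c &
     g == transv w c]]]>>%G.

Lemma mem_transv_group (X : {pred 'cV[A]_n}) w c :
  w \in X -> w^h *m w = 0 -> invol A c = - c -> transv w c \in transv_group X.
Proof.
move=> Xw ww cc; apply: mem_gen; rewrite inE; apply/existsP; exists w; apply/existsP; exists c.
by rewrite Xw ww cc !eqxx.
Qed.

Lemma transv_group_sub (X : {pred 'cV[A]_n}) (H : {group U}) :
  (forall w c, w \in X -> w^h *m w = 0 -> invol A c = - c -> transv w c \in H) ->
  transv_group X \subset H.
Proof.
move=> XH; rewrite gen_subG; apply/subsetP=> g; rewrite inE.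
by case/existsP=> w /existsP[c /and4P[Xw /eqP ww /eqP cc /eqP->]]; apply: XH.
Qed.

End Hermitian.

(** * Frames and the Heisenberg group *)

Section Frames.
Variables (q : nat) (A : involRing).
Hypothesis hA : hermitian_ring q A.
Variable n : nat.
Local Notation U := (unitary A n).
Implicit Types (g h : U) (m r : nat).

Definition skew m : {pred 'M[A]_m} := [pred s | s^h == - s].

Lemma skewP m (s : 'M[A]_m) : reflect (s^h = - s) (s \in @skew m).
Proof. exact: eqP. Qed.

Definition hframe r (e f : 'M[A]_(n, r)) :=
  [/\ e^h *m e = 0, f^h *m f = 0 & f^h *m e = 1%:M].

Lemma hframe_dual r (e f : 'M[A]_(n, r)) : hframe e f -> e^h *m f = 1%:M.
Proof. by case=> _ _ fe; rewrite -[LHS]starK starM starK fe star1. Qed.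

Definition perp r m (e f : 'M[A]_(n, r)) : {pred 'M[A]_(n, m)} :=
  [pred u | (e^h *m u == 0) && (f^h *m u == 0)].

Lemma perpP r m (e f : 'M[A]_(n, r)) (u : 'M[A]_(n, m)) :
  reflect (e^h *m u = 0 /\ f^h *m u = 0) (u \in perp e f).
Proof. by apply: (iffP andP) => [] [/eqP-> /eqP->]. Qed.

Definition proj_perp r m (e f : 'M[A]_(n, r)) (z : 'M[A]_(n, m)) :=
  z - e *m (f^h *m z) - f *m (e^h *m z).

Lemma proj_perp_in r m (e f : 'M[A]_(n, r)) (z : 'M[A]_(n, m)) : hframe e f ->
  proj_perp e f z \in perp e f.
Proof.
move=> ef; have [ee ff fe] := ef; have ef1 := hframe_dual ef.
apply/perpP; rewrite /proj_perp; split; rewrite !mulmxBr !(mulmxA _^h) ?ee ?ff ?fe ?ef1.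
  by rewrite !mul1mx mul0mx subr0 subrr.
by rewrite !mul1mx mul0mx subr0 subrr.
Qed.

Lemma proj_perp_form r m k (e f : 'M[A]_(n, r)) (z : 'M[A]_(n, m)) (u : 'M[A]_(n, k)) :
  u \in perp e f -> u^h *m proj_perp e f z = u^h *m z.
Proof.
case/perpP=> eu fu.
have ue : u^h *m e = 0 by rewrite -[LHS]starK starM starK eu star0.
have uf : u^h *m f = 0 by rewrite -[LHS]starK starM starK fu star0.
by rewrite /proj_perp !mulmxBr !(mulmxA u^h) ue uf !mul0mx !subr0.
Qed.

(* A character of the skew-hermitian matrices is nondegenerate when the
   commutator pairing that it induces on the Heisenberg group is. *)
Definition nondeg r (lam : 'M[A]_r -> algC) :=
  [/\ lam 0 = 1,
      {in @skew r &, forall s t, lam (s + t) = lam s * lam t} &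
      forall al : 'rV[A]_r, al != 0 -> exists be : 'rV[A]_r,
        lam (be^h *m al - al^h *m be) != 1].

Lemma skew_comm m r (u v : 'M[A]_(m, r)) : u^h *m v - v^h *m u \in @skew r.
Proof. by apply/skewP; rewrite starB !starM !starK opprB. Qed.

Lemma hframe_neq0 r (e f : 'M[A]_(n, r)) (u : 'M[A]_(n, r)) : hframe e f ->
  u \in perp e f -> u != 0 -> exists2 z : 'cV[A]_n, z \in perp e f & z^h *m u != 0.
Proof.
move=> ef pu nu; apply/exists_inP; apply: contraNT nu; rewrite negb_exists => /forallP zu.
have {}zu (z : 'cV[A]_n) : z^h *m u = 0.
  have := zu (proj_perp e f z); rewrite proj_perp_in //= negbK => /eqP zu0.
  by rewrite -[LHS]starK starM starK -(proj_perp_form z pu) starM starK zu0.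
apply/eqP/matrixP=> i j; have /matrixP/(_ ord0 j) := zu (delta_mx i ord0).
rewrite !mxE (bigD1 i) //= !mxE !eqxx rmorph1 mul1r big1 ?addr0 // => k /negPf ki.
by rewrite !mxE ki rmorph0 mul0r.
Qed.

(** A vector [z] of the complement with z^h u nonzero reduces this to rows: for v = z be the
    argument of [lam] is the pairing of [be] with the row z^h u. *)
Lemma nondeg_perp r (e f : 'M[A]_(n, r)) lam (u : 'M[A]_(n, r)) :
  hframe e f -> nondeg lam -> u \in perp e f -> u != 0 ->
  exists2 v, v \in perp e f & lam (v^h *m u - u^h *m v) != 1.
Proof.
move=> ef [_ _ nd] pu nu; have [z /perpP[ez fz] zu] := hframe_neq0 ef pu nu.
have [be lbe] := nd _ zu; exists (z *m be).
  by apply/perpP; rewrite !mulmxA ez fz !mul0mx.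
by move: lbe; rewrite !starM starK !mulmxA.
Qed.

Definition half : A := odflt 0 [pick s : A | s + invol A s == 1].
Lemma halfP : half + invol A half = 1.
Proof.
rewrite /half; case: pickP => [s /eqP //|no]; have [s s1] := herm_trace hA.
by move: (no s); rewrite s1 eqxx.
Qed.

(** A section of Q -> Q/Z: the usual -u^h u / 2, with [half] in place of 1/2. *)
Definition sec m r (u : 'M[A]_(m, r)) : 'M[A]_r := - (half *: (u^h *m u)).

Lemma secP m r (u : 'M[A]_(m, r)) : sec u + (sec u)^h = - (u^h *m u).
Proof.
by rewrite /sec starN starZ starM starK -opprD -scalerDl halfP scale1r.
Qed.

Lemma eichlerP_sec r (e f u : 'M[A]_(n, r)) : hframe e f -> u \in perp e f ->
  eichlerP e u (sec u).
Proof. by case=> ee _ _ /perpP[eu _]; split=> //; apply: secP. Qed.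

(** The partner is the projection z' of [z], corrected by e0 (sec z'); this cancels the norm of z'
    and leaves its pairing with [e0] unchanged. *)
Lemma hframe_pair r (e f : 'M[A]_(n, r)) (e0 z : 'cV[A]_n) :
  hframe e f -> e0 \in perp e f -> e0^h *m e0 = 0 -> e0^h *m z = 1%:M ->
  exists2 f0, f0 \in perp e f & hframe e0 f0.
Proof.
move=> ef pe0 ee0 ez.
have [z' pz' ez'] : exists2 z', z' \in perp e f & e0^h *m z' = 1%:M.
  by exists (proj_perp e f z); rewrite ?proj_perp_in ?proj_perp_form.
exists (z' + e0 *m sec z').
  case/perpP: pe0 pz' => ee fe /perpP[ez'0 fz'0].
  by apply/perpP; split; rewrite !mulmxDr !mulmxA ?ez'0 ?fz'0 ?ee ?fe ?mul0mx ?addr0.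
have ze' : z'^h *m e0 = 1%:M by rewrite -[LHS]starK starM starK ez' star1.
split=> //; rewrite starD starM !(mulmxDl, mulmxDr) -!mulmxA ?ee0 ?(mulmxA e0^h) ?ee0 ?(mulmxA z'^h) ?ze' ?ez'.
  by rewrite !(mulmx0, mul0mx, mulmx1, mul1mx) addr0 -addrA secP subrr.
by rewrite !mulmx0 addr0.
Qed.

End Frames.

(** * Stone-von Neumann for a nondegenerate central character *)

Section Heisenberg.
Variables (q : nat) (A : involRing).
Hypothesis hA : hermitian_ring q A.
Variables (n : nat) (P : {group unitary A n}) (d : nat).
Variable rP : mx_representation algC P d.
Variables (r : nat) (e f : 'M[A]_(n, r)) (lam : 'M[A]_r -> algC).
Hypotheses (ef : hframe e f) (nd : nondeg lam).
Hypothesis PQ : forall u s, eichlerP e u s -> u \in perp e f -> eichler e u s \in P.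
Hypothesis Zscal : forall s, s \in @skew A r -> rP (eichler e 0 s) = (lam s)%:M.

Let repr_Kl x (M : 'M_d) : x \in P -> rP x^-1%g *m (rP x *m M) = M.
Proof. by move=> xP; rewrite mulmxA -repr_mxM ?groupV // mulVg repr_mx1 mul1mx. Qed.

Lemma skew0 : 0 \in @skew A r.
Proof. by apply/skewP; rewrite star0 oppr0. Qed.

Lemma perp0 m : (0 : 'M[A]_(n, m)) \in perp e f.
Proof. by apply/perpP; rewrite !mulmx0. Qed.

Lemma perpD m : {in perp e f &, forall u v : 'M[A]_(n, m), u + v \in perp e f}.
Proof. by move=> u v /perpP[eu fu] /perpP[ev fv]; apply/perpP; rewrite !mulmxDr eu ev fu fv addr0. Qed.

Lemma perpN m : {in perp e f, forall u : 'M[A]_(n, m), - u \in perp e f}.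
Proof. by move=> u /perpP[eu fu]; apply/perpP; rewrite !mulmxN eu fu oppr0. Qed.

Lemma perpZ m k (u : 'M[A]_(n, m)) (x : 'M[A]_(m, k)) : u \in perp e f -> u *m x \in perp e f.
Proof. by case/perpP=> eu fu; apply/perpP; rewrite !mulmxA eu fu !mul0mx. Qed.

Lemma perp_fix m (h : unitary A n) (u : 'M[A]_(n, m)) :
  h *m e = e -> h *m f = f -> (h *m u \in perp e f) = (u \in perp e f).
Proof.
move=> he hf; rewrite !inE -[in RHS](umx_form h e u) -[in RHS](umx_form h f u).
by rewrite he hf.
Qed.

Lemma eichler_scal u s t : eichlerP e u s -> eichlerP e u t -> u \in perp e f ->
  rP (eichler e u t) = lam (t - s) *: rP (eichler e u s).
Proof.
move=> Ps Pt pu; have ss : t - s \in @skew A r.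
  case: Ps Pt => _ _ su [_ _ tu]; apply/skewP; rewrite starB opprB.
  by apply/subr0_eq; rewrite opprB addrACA -opprD [t^h + t]addrC [s^h + s]addrC su tu subrr.
have P0 : eichlerP e 0 (t - s).
  by apply: eichlerP0; [case: Ps | apply/skewP].
have -> : eichler e u t = (eichler e u s * eichler e 0 (t - s))%g.
  by rewrite eichlerM // mulmx0 addr0 subr0 addrC subrK.
by rewrite repr_mxM ?PQ ?perp0 // Zscal // mul_mx_scalar.
Qed.

Lemma eichler_comm u v s t : eichlerP e u s -> eichlerP e v t ->
  u \in perp e f -> v \in perp e f ->
  rP (eichler e u s) *m rP (eichler e v t)
  = lam (v^h *m u - u^h *m v) *: (rP (eichler e v t) *m rP (eichler e u s)).
Proof.
move=> Pu Pv pu pv; rewrite -!repr_mxM ?PQ // !eichlerM // [v + u]addrC.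
have P1 := eichlerP_D Pu Pv; have P2 := eichlerP_D Pv Pu; rewrite [v + u]addrC in P2.
apply: (etrans (eichler_scal P2 P1 (perpD pu pv))); congr (lam _ *: _).
by rewrite opprB [s + t]addrC [LHS]addrC addrA subrK.
Qed.

(** Conjugation by a suitable element of Q preserves the trace but multiplies the matrix by a value
    of [lam] other than 1. *)
Lemma trace_eichler0 u s : eichlerP e u s -> u \in perp e f -> u != 0 ->
  \tr (rP (eichler e u s)) = 0.
Proof.
move=> Pu pu nu; have [v pv lv] := nondeg_perp ef nd pu nu.
have Pv := eichlerP_sec hA ef pv.
have yP : eichler e v (sec v) \in P by apply: PQ.
have : \tr (rP (eichler e u s)) = lam (v^h *m u - u^h *m v) * \tr (rP (eichler e u s)).
  rewrite -{1}[rP (eichler e u s)](repr_mxK rP yP) eichler_comm //.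
  by rewrite -scalemxAl mxtraceZ mxtrace_mulC repr_Kl.
move/eqP; rewrite -subr_eq0 -{1}[\tr _]mul1r -mulrBl mulf_eq0 subr_eq0 eq_sym.
by rewrite (negPf lv) => /eqP.
Qed.

Lemma eichlerP_iso (z : 'cV[A]_n) (al : 'rV[A]_r) :
  z \in perp e f -> z^h *m z = 0 -> eichlerP e (z *m al) 0.
Proof.
case: ef => ee _ _ /perpP[ez _] zz; split=> //; first by rewrite mulmxA ez mul0mx.
by rewrite star0 addr0 starM -mulmxA (mulmxA z^h) zz mul0mx mulmx0 oppr0.
Qed.

(** * Transvections in the enveloping algebra of the Heisenberg group *)

Section TransvectionInHeisenberg.
Variables (e0 f0 : 'cV[A]_n) (c : A).
Hypotheses (pe0 : e0 \in perp e f) (pf0 : f0 \in perp e f) (ef0 : hframe e0 f0).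
Hypotheses (cc : invol A c = - c) (tP : transv e0 c \in P).
Hypothesis fix_transv : forall w : 'rV[algC]_d,
  (forall al : 'rV[A]_r, w *m rP (eichler e (e0 *m al) 0) = w) ->
  w *m rP (transv e0 c) = w.

Let x (al : 'rV[A]_r) := eichler e (e0 *m al) 0.
Let y (be : 'rV[A]_r) := eichler e (f0 *m be) 0.
(** Up to the factor |A|^r, the projection onto the row vectors fixed by all x(al). *)
Let e1 := \sum_al rP (x al).

Let ee0 : e0^h *m e0 = 0. Proof. by case: ef0. Qed.
Let ff0 : f0^h *m f0 = 0. Proof. by case: ef0. Qed.
Let xP al : x al \in P. Proof. by rewrite PQ ?perpZ //; apply: eichlerP_iso. Qed.
Let yP be : y be \in P. Proof. by rewrite PQ ?perpZ //; apply: eichlerP_iso. Qed.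

Let e1_transv : e1 *m rP (transv e0 c) = e1.
Proof.
apply/row_matrixP=> i; rewrite row_mul; apply: fix_transv => al.
rewrite -row_mul; congr (row i _); rewrite /e1 mulmx_suml [RHS](reindex_inj (addIr al)).
apply: eq_bigr => be _; rewrite -(repr_mxM _ (xP be) (xP al)) /x eichlerM; try exact: eichlerP_iso.
by rewrite -mulmxDr starM addr0 -mulmxA (mulmxA e0^h) ee0 mul0mx mulmx0 subr0.
Qed.

Let te : transv e0 c *m e = e.
Proof.
have e0e : e0^h *m e = 0.
  by case/perpP: pe0 => ee _; rewrite -[LHS]starK starM starK ee star0.
by rewrite transvE // mulmxDl mul1mx -scalemxAl -mulmxA e0e mulmx0 scaler0 addr0.
Qed.

Let te0 : transv e0 c *m e0 = e0.
Proof. by rewrite transvE // mulmxDl mul1mx -scalemxAl -mulmxA ee0 mulmx0 scaler0 addr0. Qed.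

Let tf0 : transv e0 c *m f0 = f0 + c *: e0.
Proof.
by rewrite transvE // mulmxDl mul1mx -scalemxAl -mulmxA (hframe_dual ef0) mulmx1.
Qed.

Let transv_e1 : rP (transv e0 c) *m e1 = e1.
Proof.
rewrite -[RHS]e1_transv /e1 mulmx_suml mulmx_sumr; apply: eq_bigr => al _.
have J := eichlerJ (transv e0 c) (eichlerP_iso al pe0 ee0); rewrite te mulmxA te0 in J.
rewrite -(repr_mxM rP tP (xP al)) -(repr_mxM rP (xP al) tP); congr (rP _).
by rewrite /x -{2}J mulgKV.
Qed.

(** The transvection fixes [e] and sends [f0] to f0 + c e0, hence conjugates y(be) to the element
    attached to (f0 + c e0) be; the Heisenberg law splits that into y(be), x(c be) and a central
    factor. *)
Let transv_y be : (transv e0 c * y be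
  = y be * eichler e (e0 *m (c *: be)) 0 * eichler e 0 (c *: (be^h *m be)) * transv e0 c)%g.
Proof.
have J := eichlerJ (transv e0 c) (eichlerP_iso be pf0 ff0); rewrite te mulmxA tf0 in J.
have -> := canRL (mulgKV _) J; congr (_ * _)%g.
have Pz : eichlerP e 0 (c *: (be^h *m be)).
  apply: eichlerP0; first by case: ef.
  by rewrite starZ starM starK cc scaleNr.
have Py := eichlerP_iso be pf0 ff0; have Px := eichlerP_iso (c *: be) pe0 ee0.
have -> : (y be * eichler e (e0 *m (c *: be)) 0)%g
        = eichler e (f0 *m be + e0 *m (c *: be)) (- (c *: (be^h *m be))).
  rewrite (eichlerM Py Px) addr0 starM -mulmxA (mulmxA f0^h).
  by case: ef0 => _ _ ->; rewrite mul1mx -!scalemxAr add0r.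
rewrite eichlerM //; last first.
  have := eichlerP_D Py Px; rewrite addr0 add0r starM -mulmxA (mulmxA f0^h).
  by case: ef0 => _ _ ->; rewrite mul1mx -!scalemxAr.
by rewrite mulmx0 subr0 addr0 addNr mulmxDl -scalemxAl -scalemxAr.
Qed.

(** Conjugation by y(be) scales x(al) by an additive character of [be], nontrivial for al <> 0 by
    nondegeneracy. Orthogonality leaves the term al = 0. *)
Let resolution : \sum_be rP (y be) *m e1 *m rP (y be)^-1%g = (#|A| ^ r)%:R%:M.
Proof.
have conj al be : rP (y be) *m rP (x al) *m rP (y be)^-1%g
  = lam (al^h *m be - be^h *m al) *: rP (x al).
  rewrite /y /x eichler_comm ?perpZ //; try exact: eichlerP_iso.
  rewrite -scalemxAl (repr_mxK rP (yP be)) !starM -!mulmxA (mulmxA e0^h) (mulmxA f0^h).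
  by rewrite (hframe_dual ef0); case: ef0 => _ _ ->; rewrite !mul1mx.
transitivity (\sum_al \sum_be lam (al^h *m be - be^h *m al) *: rP (x al)).
  rewrite exchange_big; apply: eq_bigr => be _.
  by rewrite /e1 mulmx_sumr mulmx_suml; apply: eq_bigr => al _; apply: conj.
under eq_bigr => al _ do rewrite -scaler_suml.
case: nd => l0 lD ndl; rewrite (bigD1 0) //= [X in _ + X]big1 ?addr0 => [|al nal].
  rewrite /x mulmx0 eichler0; last by case: ef.
  rewrite repr_mx1 scalemx1; congr (_%:M).
  under eq_bigr do rewrite star0 mul0mx mulmx0 subr0 l0.
  by rewrite sumr_const card_mx mul1n.
have [be lbe] := ndl al nal.
suff -> : \sum_be lam (al^h *m be - be^h *m al) = 0 by rewrite scale0r.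
set S := \sum_be _; have : lam (be^h *m al - al^h *m be) * S = S.
  rewrite {2}/S (reindex_inj (addIr (- be))) /= mulr_sumr; apply: eq_bigr => b _.
  rewrite -lD ?skew_comm //; congr (lam _).
  by rewrite starB mulmxBl mulmxBr opprB [RHS]addrC [RHS]addrACA [LHS]addrACA; congr (_ + _); rewrite addrC.
move/eqP; rewrite -subr_eq0 -{2}[S]mul1r -mulrBl mulf_eq0 subr_eq0 (negPf lbe).
by move/eqP.
Qed.

Lemma transv_in_heis (X : 'M[algC]_d) :
  (forall u s, eichlerP e u s -> u \in perp e f -> comm_mx X (rP (eichler e u s))) ->
  comm_mx X (rP (transv e0 c)).
Proof.
move=> cX.
have comm_x al : comm_mx X (rP (x al)) by apply: cX; rewrite ?perpZ //; apply: eichlerP_iso.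
have comm_y be : comm_mx X (rP (y be)) by apply: cX; rewrite ?perpZ //; apply: eichlerP_iso.
have comm_yV be : comm_mx X (rP (y be)^-1%g).
  apply/esym; rewrite -[LHS](repr_mxK rP (yP be)) -(mulmxA _ X) (comm_y be) mulmxA.
  by rewrite -repr_mxM ?groupV ?yP // mulVg repr_mx1 mul1mx.
have commZ a Y : comm_mx X Y -> comm_mx X (a *: Y).
  by rewrite /comm_mx -scalemxAr -scalemxAl => ->.
have comm_e1 : comm_mx X e1 by apply: comm_mx_sum => al _; apply: comm_x.
have N0 : (#|A| ^ r)%:R != 0 :> algC.
  by rewrite pnatr_eq0 -lt0n expn_gt0; apply/orP; left; apply/card_gt0P; exists 0.
(* The resolution is inserted to the right of the transvection, which then moves past y(be) by
   [transv_y] and is absorbed by [e1]. Only elements of Q remain. *)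
have E : (#|A| ^ r)%:R *: rP (transv e0 c) = \sum_be lam (c *: (be^h *m be)) *:
    (rP (y be) *m rP (x (c *: be)) *m e1 *m rP (y be)^-1%g).
  rewrite -mul_mx_scalar -resolution mulmx_sumr; apply: eq_bigr => be _.
  have ss : c *: (be^h *m be) \in @skew A r.
    by apply/skewP; rewrite starZ starM starK cc scaleNr.
  have zP : eichler e 0 (c *: (be^h *m be)) \in P.
    by apply: PQ (perp0 _); apply: eichlerP0; [case: ef | apply/skewP].
  have xcP : eichler e (e0 *m (c *: be)) 0 \in P := xP _.
  rewrite !mulmxA -(repr_mxM rP tP (yP be)) transv_y.
  rewrite (repr_mxM rP (groupM (groupM (yP be) xcP) zP) tP).
  rewrite (repr_mxM rP (groupM (yP be) xcP) zP) (repr_mxM rP (yP be) xcP).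
  rewrite Zscal // mul_mx_scalar.
  by rewrite -!scalemxAl -[_ *m rP (transv e0 c) *m e1]mulmxA transv_e1.
rewrite -[rP _](scalerK N0) E; apply: (commZ); apply: comm_mx_sum => be _; apply: commZ.
by do 3?apply: comm_mxM.
Qed.
End TransvectionInHeisenberg.

Hypothesis Qcent : forall X : 'M[algC]_d,
  (forall u s, eichlerP e u s -> u \in perp e f -> comm_mx X (rP (eichler e u s))) ->
  is_scalar_mx X.
Hypothesis d_gt0 : (0 < d)%N.

Local Notation E u := (eichler e u (sec u)).
Local Notation N := #|[pred u : 'M[A]_(n, r) | u \in perp e f]|.

(** A sum over Q/Z: the representative of each class is immaterial because Z acts by scalars. *)
Definition heis_avg (X : 'M[algC]_d) :=
  \sum_(u | u \in perp e f) rP (E u) *m X *m rP (E u)^-1%g.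

Lemma heis_conj_scal X u s t : eichlerP e u s -> eichlerP e u t -> u \in perp e f ->
  rP (eichler e u s) *m X *m rP (eichler e u s)^-1%g
  = rP (eichler e u t) *m X *m rP (eichler e u t)^-1%g.
Proof.
move=> Ps Pt pu; have sP := PQ Ps pu; have tP := PQ Pt pu.
apply: (canLR (repr_mxK rP sP)); rewrite (eichler_scal Pt Ps pu).
by rewrite -scalemxAr (repr_mxKV rP tP) scalemxAl.
Qed.

Lemma heis_avg_comm X v t : eichlerP e v t -> v \in perp e f ->
  comm_mx (heis_avg X) (rP (eichler e v t)).
Proof.
move=> Pv pv; have vP := PQ Pv pv; rewrite /comm_mx /heis_avg mulmx_suml mulmx_sumr.
rewrite [LHS](reindex_onto (fun u => v + u) (fun u => - v + u)); last first.
  by move=> u _; rewrite addrA subrr add0r.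
have memv u : ((v + u \in perp e f) && (- v + (v + u) == u)) = (u \in perp e f).
  rewrite addrA addNr add0r eqxx andbT; apply/idP/idP => pu; last exact: perpD.
  by rewrite -[u]add0r -(addNr v) -addrA perpD ?perpN.
rewrite (eq_bigl _ _ memv); apply: eq_bigr => u pu.
have Pu := eichlerP_sec hA ef pu; have pvu := perpD pv pu.
have Puv := eichlerP_sec hA ef pvu; have uP := PQ Pu pu.
rewrite (heis_conj_scal X Puv (eichlerP_D Pv Pu) pvu) -(eichlerM Pv Pu) invMg.
rewrite !repr_mxM ?groupV // -!mulmxA; congr (_ *m (_ *m (_ *m _))).
by rewrite mulmxA (repr_mxKV rP vP).
Qed.

(** The sum commutes with Q, so it is a scalar by [Qcent], and its trace determines which one. *)
Lemma heis_avg_scalar X : heis_avg X = (N%:R * \tr X / d%:R)%:M.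
Proof.
have /is_scalar_mxP[a Ya] := Qcent (heis_avg_comm X).
have : \tr (heis_avg X) = N%:R * \tr X.
  rewrite /heis_avg raddf_sum /= -sum1_card natr_sum mulr_suml; apply: eq_bigr => u pu.
  have uP := PQ (eichlerP_sec hA ef pu) pu.
  by rewrite mxtrace_mulC repr_Kl // mul1r.
rewrite Ya mxtrace_scalar => <-; rewrite -[a *+ d]mulr_natr mulfK //.
by rewrite pnatr_eq0 -lt0n.
Qed.

(** Both sides are the trace of [heis_avg] as an operator on d x d matrices. Evaluated on matrix
    units through [heis_avg_scalar] it is N; as a sum over u of tr E(u) tr E(u)^-1 it is d^2, since
    only u = 0 contributes. *)
Lemma heis_degree : (d ^ 2)%N = N.
Proof.
suff: (d ^ 2)%:R = N%:R :> algC by move/eqP; rewrite eqr_nat => /eqP.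
have <- : \sum_(i < d) \sum_(j < d) (heis_avg (delta_mx i j)) i j = N%:R.
  under eq_bigr => i _.
    rewrite (bigD1 i) //= big1 => [|j /negPf ji]; last first.
      by rewrite heis_avg_scalar !mxE eq_sym ji mulr0n.
    rewrite heis_avg_scalar mxE eqxx mulr1n addr0.
    have -> : \tr (delta_mx i i) = 1 :> algC.
      rewrite /mxtrace (bigD1 i) //= mxE !eqxx big1 ?addr0 // => j /negPf ji.
      by rewrite mxE ji.
    over.
  by rewrite sumr_const card_ord mulr1 -[LHS]mulr_natr divfK // pnatr_eq0 -lt0n.
transitivity (\sum_(u | u \in perp e f) \tr (rP (E u)) * \tr (rP (E u)^-1%g)).
  rewrite (bigD1 0) ?perp0 //= big1 => [|u /andP[pu nu]]; last first.
    by rewrite (trace_eichler0 (eichlerP_sec hA ef pu) pu nu) mul0r.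
  have -> : sec (0 : 'M[A]_(n, r)) = 0 by rewrite /sec mulmx0 scaler0 oppr0.
  rewrite eichler0; last by case: ef.
  by rewrite invg1 repr_mx1 mxtrace1 -natrM addr0 mulnn.
rewrite /heis_avg; under [RHS]eq_bigr do under eq_bigr do rewrite summxE.
under [RHS]eq_bigr do rewrite exchange_big /=.
rewrite exchange_big /=; apply: eq_bigr => u pu.
rewrite /mxtrace mulr_suml; apply: eq_bigr => i _; rewrite mulr_sumr.
apply: eq_bigr => j _; rewrite mxE (bigD1 j) //= big1 ?addr0 => [|k /negPf kj].
  congr (_ * _); rewrite mxE (bigD1 i) //= mxE !eqxx mulr1 big1 ?addr0 // => k /negPf ki.
  by rewrite mxE ki mulr0.
by rewrite mxE big1 ?mul0r // => l _; rewrite mxE kj andbF mulr0.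
Qed.

(** The trace of heis_avg(h) h^-1 is d times the left side. It is also a sum over u of traces of
    E(u) (h E(u) h^-1)^-1, an element of Q attached to u - hu, whose trace is 0 unless h fixes u. *)
Lemma heis_trace_sq h : h \in P -> h *m e = e -> h *m f = f ->
  \tr (rP h) * \tr (rP h^-1%g) = #|[pred u : 'M[A]_(n, r) | (u \in perp e f) && (h *m u == u)]|%:R.
Proof.
move=> hP he hf; have d0 : d%:R != 0 :> algC by rewrite pnatr_eq0 -lt0n.
apply: (mulfI d0).
have -> : d%:R * (\tr (rP h) * \tr (rP h^-1%g)) = \tr (heis_avg (rP h) *m rP h^-1%g).
  rewrite heis_avg_scalar mul_scalar_mx mxtraceZ -heis_degree natrX.
  by field.
rewrite /heis_avg mulmx_suml raddf_sum /= -sum1_card natr_sum mulr_sumr.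
rewrite [RHS](eq_bigl (fun u => (u \in perp e f) && (h *m u == u))) // [RHS]big_mkcondr /=.
apply: eq_bigr => u pu; have Pu := eichlerP_sec hA ef pu.
have uP := PQ Pu pu; rewrite -!repr_mxM ?(groupM, groupV) //.
have huP : eichlerP e (h *m u) (sec u) by rewrite -{1}he; apply: eichlerP_J.
have -> : (E u * h * (E u)^-1 * h^-1)%g = (E u * (eichler e (h *m u) (sec u))^-1)%g.
  by have := eichlerJ h Pu; rewrite he => <-; rewrite !invMg invgK !mulgA.
case: eqP => [->|hu]; first by rewrite mulgV repr_mx1 mxtrace1 mulr1.
have phu : - (h *m u) \in perp e f by rewrite perpN // perp_fix.
have PV : eichlerP e (- (h *m u)) (sec u)^h.
  case: huP => ee ehu suh; split; rewrite ?mulmxN ?ehu ?oppr0 //.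
  by rewrite starK addrC suh starN mulNmx opprK.
have -> : (eichler e (h *m u) (sec u))^-1%g = eichler e (- (h *m u)) (sec u)^h.
  apply: umx_inj; rewrite umxV !eichlerE //; exact: eichler_mx_star.
rewrite eichlerM // trace_eichler0 //.
- exact: eichlerP_D.
- exact: perpD.
by rewrite subr_eq0; apply/eqP => uh; apply: hu.
Qed.

End Heisenberg.

(** * Heisenberg rank *)

Section Ladder.
Variables (q : nat) (A : involRing).
Hypothesis hA : hermitian_ring q A.
Variables (n : nat) (H : {group unitary A n}) (d : nat).
Variable rG : mx_representation algC H d.
Hypothesis HE : forall m (e u : 'M[A]_(n, m)) s, eichlerP e u s -> eichler e u s \in H.
Local Notation U := (unitary A n).

Definition eigvec r (e : 'M[A]_(n, r)) (lam : 'M[A]_r -> algC) m (w : 'M[algC]_(m, d)) :=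
  forall s, s \in @skew A r -> w *m rG (eichler e 0 s) = lam s *: w.

(* The representation [rG] has Heisenberg rank at least [r]. *)
Definition heis_state r := exists (e f : 'M[A]_(n, r)) (lam : 'M[A]_r -> algC),
  [/\ hframe e f, nondeg lam & exists2 w : 'rV_d, w != 0 & eigvec e lam w].

(** The negation provides exactly the data from which [heis_step] builds a frame of rank r + 1. *)
Definition heis_terminal r (e f : 'M[A]_(n, r)) lam :=
  forall (e0 : 'cV[A]_n) c (w : 'rV_d), e0 \in perp e f -> e0^h *m e0 = 0 ->
  invol A c = - c -> eigvec e lam w ->
  (forall al : 'rV[A]_r, w *m rG (eichler e (e0 *m al) 0) = w) ->
  w *m rG (transv e0 c) = w.

(** In the split case [w] is a pair of vectors over a field, and the entries of w w^h are products
    of a coordinate of one with a coordinate of the other. If both halves are nonzero, one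
    coordinate from each combines to give 1; otherwise w w^h = 0 and every transvection along [w] is
    trivial. *)
Lemma unimodular_or_null (w : 'cV[A]_n) :
  (exists z : 'cV[A]_n, w^h *m z = 1%:M) \/ w *m w^h = 0.
Proof.
have pair (a b : A) i j : invol A (w i ord0) * a + invol A (w j ord0) * b = 1 ->
    exists z : 'cV[A]_n, w^h *m z = 1%:M.
  move=> ab1; exists (a *: delta_mx i ord0 + b *: delta_mx j ord0).
  apply/matrixP=> k l; rewrite !ord1 mulmxDr -!scalemxAr -!colE !mxE eqxx -ab1.
  by rewrite mulrC [b * _]mulrC.
case: (herm_split hA) => [fieldA | [eps [eps0 eps1 epsV]]].
  have [-> | /matrix0Pn[i [j]]] := eqVneq w 0; first by right; rewrite mul0mx.
  rewrite ord1 => /fieldA[y wy]; left; apply: (pair (invol A y) 0 i i).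
  by rewrite mulr0 addr0 -rmorphM wy rmorph1.
have key (x : A) : eps * x = 0 -> x = invol A eps * x.
  by move=> ex; rewrite -[LHS]mul1r -eps1 mulrDl ex add0r.
have key' (x : A) : invol A eps * x = 0 -> x = eps * x.
  by move=> ex; rewrite -[LHS]mul1r -eps1 mulrDl ex addr0.
have [/existsP[i wi]|] := boolP [exists i, eps * w i ord0 != 0]; last first.
  rewrite negb_exists => /forallP w0; right; apply/matrixP=> i j.
  have {}w0 k : eps * w k ord0 = 0 by apply/eqP; move: (w0 k); rewrite negbK.
  rewrite mxE big_ord1 starE [RHS]mxE (key _ (w0 i)) mulrAC.
  by rewrite -(rmorphM (invol A)) w0 rmorph0 mul0r.
have [/existsP[j wj]|] := boolP [exists j, invol A eps * w j ord0 != 0]; last first.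
  rewrite negb_exists => /forallP w0; right; apply/matrixP=> j k.
  have {}w0 l : invol A eps * w l ord0 = 0 by apply/eqP; move: (w0 l); rewrite negbK.
  rewrite mxE big_ord1 starE [RHS]mxE (key' _ (w0 j)) mulrAC.
  by rewrite -[eps](involK) -(rmorphM (invol A)) w0 rmorph0 mul0r.
have [y wy] := epsV _ wi.
have [y' wy'] : exists y, eps * invol A (w j ord0) * y = eps.
  by apply: epsV; apply: contra wj => /eqP e0; rewrite -(involK (w j ord0)) -rmorphM e0 rmorph0.
left; apply: (pair (invol A eps * invol A y) (eps * y') i j).
rewrite -[RHS]eps1 addrC; congr (_ + _); first by rewrite -[RHS]wy'; ring.
by rewrite -[in RHS]wy !rmorphM; ring.
Qed.

Lemma transv_null (w : 'cV[A]_n) c : w^h *m w = 0 -> invol A c = - c ->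
  w *m w^h = 0 -> transv w c = 1%g.
Proof. by move=> ww cc w0; apply: umx_inj; rewrite transvE // w0 scaler0 addr0. Qed.

(** * Raising the Heisenberg rank by one *)

Section Step.
Variables (r : nat) (e f : 'M[A]_(n, r)) (lam : 'M[A]_r -> algC).
Hypotheses (ef : hframe e f) (nd : nondeg lam).
Variables (e0 : 'cV[A]_n) (c : A) (w : 'rV[algC]_d).
Hypotheses (pe0 : e0 \in perp e f) (ee0 : e0^h *m e0 = 0) (cc : invol A c = - c).
Hypotheses (ew : eigvec e lam w).
Hypothesis fix_w : forall al : 'rV[A]_r, w *m rG (eichler e (e0 *m al) 0) = w.
Hypothesis move_w : w *m rG (transv e0 c) != w.

Let Y_set := [set g | [exists a : A, (invol A a == - a) && (g == transv e0 a)]].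

Let mem_Y g : reflect (exists2 a, invol A a = - a & g = transv e0 a) (g \in Y_set).
Proof.
rewrite inE; apply: (iffP existsP) => [[a /andP[/eqP aa /eqP->]]|[a aa ->]]; exists a => //.
by rewrite aa !eqxx.
Qed.

Let Y_group : group_set Y_set.
Proof.
apply/group_setP; split.
  apply/mem_Y; exists 0; first by rewrite rmorph0 oppr0.
  by rewrite /transv raddf0 eichler0.
move=> g h /mem_Y[a aa ->] /mem_Y[b bb ->]; apply/mem_Y; exists (a + b).
  by rewrite rmorphD aa bb opprD.
by rewrite transvD.
Qed.

Let Y := Group Y_group.

Let Y_abelian : abelian Y.
Proof.
apply/centsP=> g /mem_Y[a aa ->] h /mem_Y[b bb ->].
by rewrite /commute !transvD // addrC.
Qed.

Let YH : Y \subset H.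
Proof. by apply/subsetP=> g /mem_Y[a aa ->]; apply/HE/transvP. Qed.

(** This is |Y| times the chi_i-component of [w] under the root group Y of [e0]. *)
Let wmu i := \sum_(y in Y) ('chi[Y]_i y)^* *: (w *m rG y).

Let wmu_eig i y : y \in Y -> wmu i *m rG y = 'chi_i y *: wmu i.
Proof.
move=> yY; have lin : 'chi_i \is a linear_char by apply/char_abelianP.
rewrite /wmu mulmx_suml scaler_sumr [RHS](reindex_inj (mulIg y)) /=.
have memY z : (z * y \in Y)%g = (z \in Y) by rewrite groupMr.
rewrite [RHS](eq_bigl _ _ memY); apply: eq_bigr => z zY.
rewrite (lin_charM lin zY yY) rmorphM -scalemxAl -mulmxA -repr_mxM ?(subsetP YH) // scalerA mulrCA.
by rewrite -normCK (normC_lin_char lin yY) expr1n mulr1.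
Qed.

Let sum_wmu : \sum_i wmu i = #|Y|%:R *: w.
Proof.
have lin i : 'chi[Y]_i \is a linear_char by apply/char_abelianP.
have sumY y : y \in Y -> \sum_i ('chi[Y]_i y)^* = #|Y|%:R *+ (y == 1%g).
  move=> yY; transitivity ((cfReg Y y)^*); last first.
    by rewrite cfRegE rmorphMn /= conjC_nat.
  rewrite cfReg_sum sum_cfunE rmorph_sum; apply: eq_bigr => i _.
  by rewrite cfunE lin_char1 // mul1r.
rewrite exchange_big /= (bigD1 1%g (group1 Y)) /= [X in _ + X]big1 ?addr0.
  by rewrite repr_mx1 mulmx1 -scaler_suml sumY ?group1 // eqxx mulr1n.
by move=> y /andP[yY ny]; rewrite -scaler_suml sumY // (negPf ny) mulr0n scale0r.
Qed.

(** If the trivial character were the only one to occur, [w] would be fixed by Y, against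
    [move_w]. *)
Let exists_mu : exists2 i, wmu i != 0 & exists2 a, invol A a = - a & 'chi[Y]_i (transv e0 a) != 1.
Proof.
case: (pickP (fun i : Iirr Y => (i != 0) && (wmu i != 0))) => [i /andP[ni wi]|all0].
  exists i => //; case: (pickP (fun a : A => (invol A a == - a) && ('chi[Y]_i (transv e0 a) != 1))).
    by move=> a /andP[/eqP aa na]; exists a.
  move=> tr; case/eqP: ni; apply/irr_inj/cfun_inP => y yY; rewrite irr0 cfun1E yY.
  have /mem_Y[a aa ->] := yY.
  by move: (tr a); rewrite aa eqxx /= => /negbFE/eqP.
have w0 : wmu 0 = #|Y|%:R *: w.
  rewrite -sum_wmu (bigD1 0) //= big1 ?addr0 // => i ni.
  by move: (all0 i); rewrite ni /= => /negbFE/eqP.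
case/eqP: move_w; have Y0 : #|Y|%:R != 0 :> algC by rewrite pnatr_eq0 -lt0n cardG_gt0.
rewrite -[w](scalerK Y0) -w0 -scalemxAl wmu_eig; last by apply/mem_Y; exists c.
rewrite irr0 cfun1E (_ : _ \in Y) ?scale1r //; by apply/mem_Y; exists c.
Qed.

Let ee : e^h *m e = 0. Proof. by case: ef. Qed.
Let e0e : e0^h *m e = 0.
Proof. by case/perpP: pe0 => ee1 _; rewrite -[LHS]starK starM starK ee1 star0. Qed.
Let ee0' : e^h *m e0 = 0. Proof. by case/perpP: pe0. Qed.

Let eichlerP_e0 s (al : 'rV[A]_r) : s \in @skew A r -> eichlerP e (e0 *m al) s.
Proof.
move=> /skewP ss; split=> //; first by rewrite mulmxA ee0' mul0mx.
by rewrite ss starM subrr -mulmxA (mulmxA e0^h) ee0 mul0mx mulmx0 oppr0.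
Qed.

Let transv_eichler a s (al : 'rV[A]_r) : invol A a = - a -> s \in @skew A r ->
  commute (transv e0 a) (eichler e (e0 *m al) s).
Proof.
move=> aa ss; have J := eichlerJ (transv e0 a) (eichlerP_e0 al ss).
have te : transv e0 a *m e = e.
  by rewrite transvE // mulmxDl mul1mx -scalemxAl -mulmxA e0e mulmx0 scaler0 addr0.
have te0 : transv e0 a *m e0 = e0.
  by rewrite transvE // mulmxDl mul1mx -scalemxAl -mulmxA ee0 mulmx0 scaler0 addr0.
by rewrite te mulmxA te0 in J; apply: (canRL (mulgKV _) J).
Qed.

Let e' : 'M[A]_(n, r + 1) := row_mx e e0.

(** The three factors act on [w] in known ways: the first by [lam], the second trivially by [fix_w],
    the third through the root group of [e0]. *)
Let eichler_block s11 (s12 : 'cV[A]_r) a : s11 \in @skew A r -> invol A a = - a ->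
  eichler e' 0 (block_mx s11 s12 (- s12^h) a%:M)
  = (eichler e 0 s11 * eichler e (e0 *m - s12^h) 0 * transv e0 a)%g.
Proof.
move=> /skewP ss aa.
have P1 : eichlerP e 0 s11 by apply: eichlerP0.
have P2 : eichlerP e (e0 *m - s12^h) 0 by apply: eichlerP_e0; apply: skew0.
have P3 : eichlerP e' 0 (block_mx s11 s12 (- s12^h) a%:M).
  apply: eichlerP0.
    rewrite /e' star_row_mx mul_col_row ee ee0 ee0' e0e; exact: block_mx0.
  by rewrite star_block ss starN starK star_scalar aa opp_block_mx opprK rmorphN.
rewrite eichlerM //; apply: umx_inj; rewrite umxM.
have P12 := eichlerP_D P1 P2.
rewrite (eichlerE P12) (eichlerE P3) transvE // add0r addr0 star0 mul0mx subr0.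
rewrite /eichler_mx star0 mulmx0 mul0mx subr0 addr0.
rewrite mulmxDr mulmx1 -scalemxAr !mulmxDl mulNmx mul1mx.
rewrite !starM starN starK -!(mulmxA _ e^h) -(mulmxA _ _ (e0 *m _)) -!(mulmxA _ e0^h).
rewrite !(mulmxA e0^h) !(mulmxA e^h) ee0 ee0' !(mul0mx, mulmx0) subr0 !addr0.
rewrite /e' star_row_mx mul_row_block mul_row_col !mulmxDl mul_mx_scalar.
rewrite -!addrA; congr (_ + _).
by rewrite mulNmx (mulmxN e) opprK mulmxA scalemxAl !addrA [RHS](ACl (3*1*2*4)).
Qed.

(** The new central character is [lam] on the upper left block times chi_i on the corner entry. It
    is nondegenerate on a row (0, a0) because, by [herm_skew_gen], a skew element at which chi_i is
    nontrivial can be written a0 x - (a0 x)*. *)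
Lemma heis_step : heis_state r.+1.
Proof.
have [i wi [a aa mua]] := exists_mu.
have lin : 'chi[Y]_i \is a linear_char by apply/char_abelianP.
have tY b : invol A b = - b -> transv e0 b \in Y by move=> bb; apply/mem_Y; exists b.
(* A null [e0] has only trivial transvections, which [move_w] excludes. *)
have [f0 pf0 [_ ff0 fe0]] : exists2 f0, f0 \in perp e f & hframe e0 f0.
  have [[z ez]|null] := unimodular_or_null e0; first exact: (hframe_pair hA ef pe0 ee0 ez).
  by case/eqP: move_w; rewrite transv_null // repr_mx1 mulmx1.
pose f' : 'M[A]_(n, r + 1) := row_mx f f0.
pose mu (s : 'M[A]_(r + 1)) := 'chi_i (transv e0 (drsubmx s ord0 ord0)).
pose lam' (s : 'M[A]_(r + 1)) := lam (ulsubmx s) * mu s.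
suff: heis_state (r + 1) by rewrite addn1.
have ul s : s \in @skew A (r + 1) -> ulsubmx s \in @skew A r.
  move/skewP/matrixP=> ss; apply/skewP/matrixP=> k l.
  by move: (ss (lshift 1 k) (lshift 1 l)); rewrite !mxE.
have dr s : s \in @skew A (r + 1) -> invol A (drsubmx s ord0 ord0) = - drsubmx s ord0 ord0.
  by move/skewP/matrixP=> ss; move: (ss (rshift r ord0) (rshift r ord0)); rewrite !mxE.
exists e', f', lam'; split.
- case: ef => _ ff fe; case/perpP: pf0 => ef1 ff1; case/perpP: pe0 => _ fe1.
  split; rewrite ?star_row_mx mul_col_row.
  + by rewrite ee ee0 ee0' e0e block_mx0.
  + rewrite ff ff0 ff1.
    have -> : f0^h *m f = 0 by rewrite -[LHS]starK starM starK ff1 star0.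
    exact: block_mx0.
  rewrite fe fe0 fe1.
  have -> : f0^h *m e = 0 by rewrite -[LHS]starK starM starK ef1 star0.
  by rewrite -scalar_mx_block.
- case: nd => l0 lD ndl; split.
  + have -> : lam' 0 = lam 0 * 'chi_i (transv e0 0).
      by rewrite /lam' /mu !mxE; congr (lam _ * _); apply/matrixP=> k l; rewrite !mxE.
    by rewrite l0 mul1r /transv raddf0 eichler0 // lin_char1.
  + move=> s t ss tt; rewrite /lam' /mu.
    have -> : ulsubmx (s + t) = ulsubmx s + ulsubmx t by apply/matrixP=> k l; rewrite !mxE.
    have -> : drsubmx (s + t) ord0 ord0 = drsubmx s ord0 ord0 + drsubmx t ord0 ord0 by rewrite !mxE.
    rewrite lD ?ul // -(transvD ee0 (dr _ ss) (dr _ tt)) (lin_charM lin (tY _ (dr _ ss)) (tY _ (dr _ tt))).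
    by rewrite mulrACA.
  have lam_block (al1 be1 : 'rV[A]_r) (a0 b0 : 'rV[A]_1) :
      lam' ((row_mx be1 b0)^h *m row_mx al1 a0 - (row_mx al1 a0)^h *m row_mx be1 b0)
      = lam (be1^h *m al1 - al1^h *m be1)
        * 'chi_i (transv e0 ((b0^h *m a0 - a0^h *m b0) ord0 ord0)).
    rewrite !star_row_mx !mul_col_row /lam' /mu opp_block_mx add_block_mx.
    by rewrite block_mxKul block_mxKdr.
  move=> al; rewrite -(hsubmxK al); set al1 := lsubmx al; set a0 := rsubmx al => nal.
  have [z1|/ndl[be lbe]] := eqVneq al1 0; last first.
    exists (row_mx be 0); rewrite lam_block star0 mul0mx mulmx0 subrr mxE.
    by rewrite /transv raddf0 eichler0 // lin_char1 // mulr1.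
  have na0 : a0 ord0 ord0 != 0.
    apply: contraNneq nal => a00; rewrite z1.
    have -> : a0 = 0 by rewrite [a0]mx11_scalar a00 raddf0.
    by rewrite row_mx0.
  have [x ax] := herm_skew_gen hA na0 aa.
  exists (row_mx 0 (invol A x)%:M); rewrite lam_block z1 star0 mul0mx subrr l0 mul1r.
  rewrite star_scalar involK mul_scalar_mx mul_mx_scalar !mxE.
  have a0E : a0 ord0 ord0 = al ord0 (rshift r ord0) by rewrite mxE.
  by rewrite -rmorphM [x * _]mulrC -a0E -ax.
exists (wmu i) => // s ss.
have [s11 [s12 [a' [-> ssu ssd]]]] : exists s11 s12 a',
    [/\ s = block_mx s11 s12 (- s12^h) a'%:M, s11 \in @skew A r & invol A a' = - a'].
  exists (ulsubmx s), (ursubmx s), (drsubmx s ord0 ord0); split; [|exact: ul | exact: dr].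
  rewrite -mx11_scalar -[LHS]submxK; congr (block_mx _ _ _ _).
  apply/matrixP=> k l; move/skewP/matrixP: ss => /(_ (rshift r k) (lshift 1 l)).
  by rewrite !mxE => ->; rewrite opprK.
have a'E : (a'%:M : 'M_1) ord0 ord0 = a' by rewrite mxE eqxx.
rewrite eichler_block // /lam' /mu block_mxKul block_mxKdr a'E.
have P1 : eichlerP e 0 s11 by apply: eichlerP0 => //; apply/skewP.
have P2 : eichlerP e (e0 *m - s12^h) 0 by apply: eichlerP_e0; apply: skew0.
have wmu_comm g k : g \in H -> w *m rG g = k *: w ->
    (forall y, y \in Y -> commute y g) -> wmu i *m rG g = k *: wmu i.
  move=> gH wg cg; rewrite /wmu mulmx_suml scaler_sumr; apply: eq_bigr => y yY.
  have yH := subsetP YH _ yY.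
  by rewrite -scalemxAl -mulmxA -repr_mxM // cg // repr_mxM // mulmxA wg -scalemxAl !scalerA mulrC.
rewrite !repr_mxM ?groupM ?HE //; last exact: transvP.
rewrite !mulmxA (wmu_comm _ (lam s11)) ?HE //; last 2 first.
- exact: ew.
- move=> y /mem_Y[b bb ->]; have := transv_eichler 0 bb ssu; by rewrite mulmx0.
rewrite -!scalemxAl (wmu_comm _ 1) ?HE //; last 2 first.
- by rewrite scale1r.
- move=> y /mem_Y[b bb ->]; apply: transv_eichler => //; exact: skew0.
by rewrite scale1r wmu_eig ?scalerA //; apply: tY.
Qed.

End Step.

Section Submodule.
Variables (r : nat) (e f : 'M[A]_(n, r)) (lam : 'M[A]_r -> algC) (P : {group U}).
Hypotheses (ef : hframe e f) (nd : nondeg lam) (PH : P \subset H).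
Hypothesis Pe : forall g, g \in P -> g *m e = e.

(** P fixes [e] and so centralises Z; the lam-eigenspace of Z is therefore a P-module. [rM] is a
    simple submodule of it, embedded by [V], and [rF] is the quotient of the whole module, kept so
    that the trace of [rM] can be split off as a character. *)
Lemma heis_submodule (w : 'rV[algC]_d) : w != 0 -> eigvec e lam w ->
  exists d' (rM : mx_representation algC P d') (V : 'M_(d', d)) d''
      (rF : mx_representation algC P d''),
  [/\ (0 < d' <= d)%N, mx_absolutely_irreducible rM,
      (exists K, V *m K = 1%:M) /\ eigvec e lam V,
      forall x, x \in P -> rM x *m V = V *m rG x &
      forall x, x \in P -> \tr (rM x) + \tr (rF x) = \tr (rG x)].
Proof.
move=> nw ew.
pose W := (\bigcap_(s | s \in @skew A r) kermx (rG (eichler e 0%R s) - (lam s)%:M))%MS.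
have WP m (v : 'M_(m, d)) : reflect (eigvec e lam v) (v <= W)%MS.
  apply: (iffP sub_bigcapmxP) => [Wv s ss | ev s ss].
    by move/sub_kermxP: (Wv s ss); rewrite mulmxBr mul_mx_scalar => /subr0_eq.
  by apply/sub_kermxP; rewrite mulmxBr mul_mx_scalar ev // subrr.
pose rP := subg_repr rG PH.
have Wmod : mxmodule rP W.
  apply/mxmoduleP=> x xP; apply/WP=> s ss; have xH := subsetP PH _ xP.
  have Ps : eichlerP e 0 s by apply: eichlerP0; [case: ef | apply/skewP].
  have xs : (x * eichler e 0 s = eichler e 0 s * x)%g.
    by have := eichlerJ x Ps; rewrite Pe // mulmx0 => J; apply: (canRL (mulgKV _) J).
  rewrite -mulmxA -(repr_mxM rG xH (HE Ps)) xs (repr_mxM rG (HE Ps) xH) mulmxA.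
  by rewrite (elimT (WP _ _) (submx_refl W)) // -scalemxAl.
have nW : W != 0.
  by apply: contraNneq nw => W0; have /WP := ew; rewrite W0 submx0.
(* [mxsimple_exists] gives the simple submodule under [classically], which can be opened only when
   the goal is a boolean. *)
apply: Classical_Prop.NNPP => no.
suff : false by [].
apply: (mxsimple_exists Wmod nW) => -[M simM sMW]; case: no.
have [Mmod nM _] := simM.
exists (\rank M), (submod_repr Mmod), (val_submod 1%:M), (\rank (cokermx M)), (factmod_repr Mmod).
split.
- by rewrite lt0n mxrank_eq0 nM rank_leq_row.
- by apply: (@groupC _ P); apply/submod_mx_irr.
- split; first by exists (in_submod M 1%:M); rewrite -in_submodE val_submodK.
  by apply/WP; apply: submx_trans (val_submodP _) sMW.
- move=> x xP; rewrite -val_submodE.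
  by rewrite -[submod_repr _ _]mul1mx val_submodJ.
by move=> x xP; rewrite mxtrace_sub_fact_mod.
Qed.

End Submodule.

End Ladder.

Lemma comm_gen (gT : finGroupType) (B : {set gT}) d (rM : mx_representation algC <<B>>%G d)
  (X : 'M_d) :
  (forall b, b \in B -> comm_mx X (rM b)) -> centgmx rM X.
Proof.
move=> cB; apply/centgmxP=> x xB.
have : x \in rcent rM X.
  apply: subsetP x xB; rewrite gen_subG; apply/subsetP=> b bB.
  by rewrite inE mem_gen //=; apply/eqP/cB.
by rewrite inE => /andP[_ /eqP].
Qed.

Section FixGroup.
Variables (A : involRing) (n m : nat).
Implicit Types (x : 'M[A]_(n, m)) (g : unitary A n).

Definition fix_set x := [set g : unitary A n | g *m x == x].

Lemma fix_group_set x : group_set (fix_set x).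
Proof.
apply/group_setP; split=> [|g h]; first by rewrite inE mul1mx.
by rewrite !inE => /eqP gx /eqP hx; rewrite -mulmxA hx gx.
Qed.

Canonical fix_group x := Group (fix_group_set x).

Lemma fixP x g : reflect (g *m x = x) (g \in fix_group x).
Proof. by rewrite inE; apply: eqP. Qed.

Lemma fix_perp g x (w : 'cV[A]_n) c : w^h *m x = 0 -> w^h *m w = 0 -> invol A c = - c ->
  g = transv w c -> g \in fix_group x.
Proof.
move=> wx ww cc ->; apply/fixP.
by rewrite transvE // mulmxDl mul1mx -scalemxAl -mulmxA wx mulmx0 scaler0 addr0.
Qed.
End FixGroup.

(** * The degree bound and the constituent theta of a terminal frame *)

Section HeisenbergRank.
Variables (q : nat) (A : involRing).
Hypothesis hA : hermitian_ring q A.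
Variables (n : nat) (H : {group unitary A n}) (d : nat).
Variable rG : mx_representation algC H d.
Hypothesis HE : forall m (e u : 'M[A]_(n, m)) s, eichlerP e u s -> eichler e u s \in H.
Local Notation U := (unitary A n).
Variables (r : nat) (e f : 'M[A]_(n, r)) (lam : 'M[A]_r -> algC).
Hypotheses (ef : hframe e f) (nd : nondeg lam).
Variable w : 'rV[algC]_d.
Hypotheses (nw : w != 0) (ew : eigvec rG e lam w).

Definition heis_gens := [set g : U | [exists u, exists s,
  [&& e^h *m u == 0, s + s^h == - (u^h *m u), u \in perp e f & g == eichler e u s]]].

Lemma heis_gensP g : reflect (exists u s, [/\ eichlerP e u s, u \in perp e f & g = eichler e u s])
  (g \in heis_gens).
Proof.
rewrite inE; apply: (iffP existsP) => [[u /existsP[s /and4P[/eqP eu /eqP su pu /eqP->]]]|].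
  by exists u, s; split=> //; split=> //; case: ef.
case=> u [s [[ee eu su] pu ->]]; exists u; apply/existsP; exists s.
by rewrite eu su pu !eqxx.
Qed.

Lemma heis_gensH : heis_gens \subset H.
Proof. by apply/subsetP=> g /heis_gensP[u [s [Pu _ ->]]]; apply: HE. Qed.

Lemma eichler_fix u s : eichlerP e u s -> u \in perp e f -> eichler e u s *m e = e.
Proof.
move=> Pu /perpP[eu _]; rewrite eichlerE // /eichler_mx; case: ef => ee _ _.
have ue : u^h *m e = 0 by rewrite -[LHS]starK starM starK eu star0.
by rewrite !mulmxDl mul1mx mulNmx -!mulmxA ee ue !mulmx0 subr0 !addr0.
Qed.

Lemma eigvec_scal d' (P : {group U}) (rM : mx_representation algC P d') (V : 'M_(d', d)) :
  (exists K, V *m K = 1%:M) -> eigvec rG e lam V ->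
  (forall x, x \in P -> rM x *m V = V *m rG x) ->
  (forall u s, eichlerP e u s -> u \in perp e f -> eichler e u s \in P) ->
  forall s, s \in @skew A r -> rM (eichler e 0 s) = (lam s)%:M.
Proof.
move=> [K VK] eV rMV PQ s ss; rewrite -[LHS]mulmx1 -VK mulmxA rMV ?eV // -?scalemxAl ?VK ?scalemx1 //.
by apply: PQ (perp0 _ _ _); apply: eichlerP0; [case: ef | apply/skewP].
Qed.

(** A simple module for Q alone inside the eigenspace already has degree squared equal to |Q/Z|. *)
Lemma heis_lower : (#|[pred u : 'M[A]_(n, r) | u \in perp e f]| <= d ^ 2)%N.
Proof.
pose P := <<heis_gens>>%G.
have PH : P \subset H by rewrite gen_subG heis_gensH.
have PQ u s : eichlerP e u s -> u \in perp e f -> eichler e u s \in P.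
  by move=> Pu pu; apply: mem_gen; apply/heis_gensP; exists u, s.
have Pe g : g \in P -> g *m e = e.
  move=> gP; apply/fixP; apply: subsetP g gP; rewrite gen_subG.
  by apply/subsetP=> g /heis_gensP[u [s [Pu pu ->]]]; apply/fixP; apply: eichler_fix.
have [d' [rM [V [d'' [rF [/andP[d'0 d'd] irrM [VK eV] rMV _]]]]]] :=
  heis_submodule HE ef PH Pe nw ew.
rewrite -(heis_degree hA ef nd PQ (eigvec_scal VK eV rMV PQ) _ d'0) ?leq_sqr //.
move=> X cX; apply: (mx_abs_irr_cent_scalar irrM); apply: comm_gen => b /heis_gensP[u [s [Pu pu ->]]].
exact: cX.
Qed.

Hypothesis term : heis_terminal rG e f lam.

(** [theta] is afforded by a simple module for the group P generated by Q and S. By [transv_in_heis]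
    a matrix commuting with Q commutes with S too, hence is scalar. So Q alone satisfies the
    hypotheses of [heis_trace_sq], which applies to S because S fixes [e] and [f]. *)
Lemma heis_terminal_char : exists theta : 'CF(transv_group (perp e f)),
  [/\ theta \is a character, 'Res[transv_group (perp e f)] (cfRepr rG) - theta \is a character &
    forall h, h \in transv_group (perp e f) ->
      `|theta h| ^+ 2 = #|[pred u : 'M[A]_(n, r) | (u \in perp e f) && (h *m u == u)]|%:R]
  /\ theta != 0.
Proof.
set S := transv_group (perp e f).
pose P := <<heis_gens :|: [set g | [exists w0 : 'cV[A]_n, exists c, [&& w0 \in perp e f, w0^h *m w0 == 0, invol A c == - c &
     g == transv w0 c]]]>>%G.
have SP : S \subset P by apply: genS; apply: subsetUr.
have PQ u s : eichlerP e u s -> u \in perp e f -> eichler e u s \in P.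
  by move=> Pu pu; apply: mem_gen; rewrite inE; apply/orP; left; apply/heis_gensP; exists u, s.
have SfixE : S \subset fix_group e.
  apply: transv_group_sub => z c /perpP[ez _] zz cc; apply: (fix_perp _ zz cc erefl).
  by rewrite -[LHS]starK starM starK ez star0.
have SfixF : S \subset fix_group f.
  apply: transv_group_sub => z c /perpP[_ fz] zz cc; apply: (fix_perp _ zz cc erefl).
  by rewrite -[LHS]starK starM starK fz star0.
have SH : S \subset H by apply: transv_group_sub => z c _ zz cc; apply/HE/transvP.
have PH : P \subset H.
  rewrite gen_subG subUset heis_gensH /=; apply: subset_trans SH; exact: subset_gen.
have Pe g : g \in P -> g *m e = e.
  move=> gP; apply/fixP; apply: subsetP g gP; rewrite gen_subG subUset; apply/andP; split.
    by apply/subsetP=> g /heis_gensP[u [s [Pu pu ->]]]; apply/fixP; apply: eichler_fix.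
  by apply: subset_trans SfixE; exact: subset_gen.
have [d' [rM [V [d'' [rF [/andP[d'0 d'd] irrM [VK eV] rMV trMF]]]]]] :=
  heis_submodule HE ef PH Pe nw ew.
have Zscal := eigvec_scal VK eV rMV PQ.
have Qcent X : (forall u s, eichlerP e u s -> u \in perp e f -> comm_mx X (rM (eichler e u s))) ->
    is_scalar_mx X.
  move=> cX; apply: (mx_abs_irr_cent_scalar irrM); apply: comm_gen => b.
  rewrite inE => /orP[/heis_gensP[u [s [Pu pu ->]]]|]; first exact: cX.
  rewrite inE => /existsP[e0 /existsP[c /and4P[pe0 /eqP ee0 /eqP cc /eqP->]]].
  have [[z ez]|null] := unimodular_or_null hA e0; last first.
    by rewrite transv_null // repr_mx1; apply: comm_mx1.
  have [f0 pf0 ef0] := hframe_pair hA ef pe0 ee0 ez.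
  have tP : transv e0 c \in P by apply: (subsetP SP); apply: mem_transv_group.
  apply: (transv_in_heis ef nd PQ Zscal pe0 pf0 ef0 cc tP _ cX) => v vfix.
  have [K VKK] := VK.
  have xP al : eichler e (e0 *m al) 0 \in P.
    by apply: PQ; [apply: (eichlerP_iso ef) | apply: perpZ].
  rewrite -[LHS]mulmx1 -VKK mulmxA -(mulmxA v) rMV // mulmxA.
  rewrite (term pe0 ee0 cc) -?mulmxA ?VKK ?mulmx1 //.
    by move=> s ss; rewrite -mulmxA eV // -scalemxAr.
  by move=> al; rewrite -!mulmxA -rMV // mulmxA vfix.
pose rS := subg_repr rM SP.
exists (cfRepr rS); split; first split.
- exact: cfRepr_char.
- have -> : 'Res[S] (cfRepr rG) - cfRepr rS = cfRepr (subg_repr rF SP).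
    apply/cfun_inP => x xS; rewrite !cfunE cfResE // cfunE xS (subsetP SH) //=.
    by rewrite -trMF ?(subsetP SP) // !mulr1n addrAC subrr add0r.
  exact: cfRepr_char.
- move=> h hS; have hP := subsetP SP h hS.
  rewrite -(heis_trace_sq hA ef nd PQ Zscal Qcent d'0 hP); last 2 first.
  + by apply/fixP; apply: (subsetP SfixE).
  + by apply/fixP; apply: (subsetP SfixF).
  rewrite normCK; have cfE x : x \in S -> cfRepr rS x = \tr (rM x) by move=> xS; rewrite cfunE xS mulr1n.
  by rewrite -(char_inv _ (cfRepr_char rS)) !cfE ?groupV.
apply/eqP => /(congr1 (fun phi : 'CF(S) => phi 1%g)); rewrite cfRepr1 cfunE => /eqP.
by rewrite pnatr_eq0 -leqn0 leqNgt d'0.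
Qed.

End HeisenbergRank.

(** * Transitivity of the transvection groups *)

Section Transitivity.
Variables (q : nat) (A : involRing).
Hypothesis hA : hermitian_ring q A.
Variable n : nat.
Local Notation U := (unitary A n).
Implicit Types (g t : U) (k : nat) (u v w : 'cV[A]_n).

Definition supp k : {pred 'cV[A]_n} := [pred w : 'cV[A]_n | [forall i : 'I_n, (i < k)%N ==> (w i ord0 == 0)]].

Lemma suppP k w : reflect (forall i : 'I_n, (i < k)%N -> w i ord0 = 0) (w \in supp k).
Proof.
apply: (iffP forallP) => [kw i ik | kw i]; first by have /implyP/(_ ik)/eqP := kw i.
by apply/implyP=> /kw ->.
Qed.

Lemma supp0 k : 0 \in supp k.
Proof. by apply/suppP=> i _; rewrite mxE. Qed.

Lemma suppD k : {in supp k &, forall u v, u + v \in supp k}.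
Proof. by move=> u v /suppP ku /suppP kv; apply/suppP=> i ik; rewrite mxE ku ?kv ?addr0. Qed.

Lemma suppZ k a : {in supp k, forall u, a *: u \in supp k}.
Proof. by move=> u /suppP ku; apply/suppP=> i ik; rewrite mxE ku ?mulr0. Qed.

Lemma suppN k : {in supp k, forall u, - u \in supp k}.
Proof. by move=> u ku; rewrite -scaleN1r suppZ. Qed.

Lemma supp_leq k l w : (k <= l)%N -> w \in supp l -> w \in supp k.
Proof. by move=> kl /suppP lw; apply/suppP=> i ik; apply/lw/(leq_trans ik). Qed.

(** Indexed by a natural number, with value 0 beyond the range, so that indices can be shifted
    freely. *)
Definition delta (m : nat) : 'cV[A]_n := \col_i (i == m :> nat)%:R.

Lemma delta_supp k m : (k <= m)%N -> delta m \in supp k.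
Proof. by move=> km; apply/suppP=> i ik; rewrite mxE ltn_eqF // (leq_trans ik). Qed.

Lemma delta_form (i : 'I_n) m (M : 'M[A]_(n, m)) : (delta i)^h *m M = row i M.
Proof.
apply/matrixP=> a b; rewrite !mxE (bigD1 i) //= !mxE eqxx rmorph1 mul1r big1 ?addr0 //.
by move=> j /negPf ji; rewrite !mxE val_eqE ji rmorph0 mul0r.
Qed.

Lemma supp_delta k : {in supp k, forall w, w = \sum_(i < n | (k <= i)%N) w i ord0 *: delta i}.
Proof.
move=> w /suppP kw; apply/matrixP=> i j; rewrite ord1 summxE.
have [ki|ik] := leqP k i.
  rewrite (bigD1 i) //= !mxE eqxx mulr1 big1 ?addr0 // => l /andP[_ /negPf li].
  by rewrite !mxE [_ == _]eq_sym val_eqE li mulr0.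
rewrite kw // big1 // => l kl; rewrite !mxE [_ == _](_ : _ = false) ?mulr0 //.
by apply/eqP=> il; move: ik; rewrite il ltnNge kl.
Qed.

Definition tgroup k : {group U} := transv_group (supp k).

Lemma tgroup_leq k l : (k <= l)%N -> tgroup l \subset tgroup k.
Proof.
move=> kl; apply: transv_group_sub => w c lw ww cc; apply: mem_transv_group => //.
exact: supp_leq lw.
Qed.

Lemma tgroup_supp k t w : t \in tgroup k -> w \in supp k -> t *m w \in supp k.
Proof.
move=> tT kw; pose N := [set g : U | [forall w : 'cV_n, (w \in supp k) ==> (g *m w \in supp k)]].
have NP g : reflect (forall w, w \in supp k -> g *m w \in supp k) (g \in N).
  rewrite inE; apply: (iffP forallP) => H v; first by move/implyP: (H v).
  exact/implyP/H.
have gN : group_set N.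
  apply/group_setP; split=> [|g h /NP gN /NP hN]; apply/NP => v kv; first by rewrite mul1mx.
  by rewrite umxM -mulmxA gN ?hN.
suff : t \in Group gN by move/NP; apply.
apply: subsetP t tT; apply: transv_group_sub => v c kv vv cc; apply/NP => u ku.
rewrite transvE // mulmxDl mul1mx -scalemxAl -mulmxA [v^h *m u]mx11_scalar mul_mx_scalar.
by rewrite suppD // !suppZ.
Qed.

(* Products of three transvections give the Eichler elements of isotropic vectors. *)
Lemma eichler_isotropic k (e v : 'cV[A]_n) : e \in supp k -> v \in supp k ->
  e^h *m e = 0 -> v^h *m v = 0 -> e^h *m v = 0 -> eichler e v 0 \in tgroup k.
Proof.
move=> ke kv ee vv ev; have [c [d cc cd]] := herm_skew_unit hA.
have ve : v^h *m e = 0 by rewrite -[LHS]starK starM starK ev star0.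
have dd : invol A d = - d.
  have : invol A c * invol A d = 1 by rewrite -rmorphM cd rmorph1.
  rewrite cc mulNr => /(congr1 (fun x => - d * x)).
  by rewrite mulr1 mulNr mulrN opprK mulrA [d * c]mulrC cd mul1r.
have wd : (d *: v)^h *m (d *: v) = 0 by rewrite starZ -scalemxAl -scalemxAr vv !scaler0.
have ww : (e + d *: v)^h *m (e + d *: v) = 0.
  rewrite starD !mulmxDl !mulmxDr ee wd starZ -scalemxAl -!scalemxAr ve ev.
  by rewrite !scaler0 !addr0.
have Pv : eichlerP e v 0 by split; rewrite ?vv ?star0 ?addr0 ?oppr0.
have E : transv (e + d *: v) c = (transv e c * transv (d *: v) c * eichler e v 0)%g.
  apply: umx_inj; rewrite 2!umxM (transvE ww cc) (transvE ee cc) (transvE wd cc) (eichlerE Pv).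
  have dvv : (d *: v)^h *m v = 0 by rewrite starZ -scalemxAl vv scaler0.
  have dve : (d *: v)^h *m e = 0 by rewrite starZ -scalemxAl ve scaler0.
  have mul3 (E V X : 'M[A]_n) : E *m V = 0 -> E *m X = 0 -> V *m X = 0 ->
      (1%:M + E) *m (1%:M + V) *m (1%:M + X) = 1%:M + (E + V + X).
    move=> EV EX VX; rewrite (mulmxDl _ _ (1%:M + V)) mul1mx (mulmxDr E) EV mulmx1 addr0.
    by rewrite mulmxDr mulmx1 !mulmxDl mul1mx EX VX !addr0 -!addrA [V + _]addrCA.
  have -> : eichler_mx e v 0 = 1%:M + (v *m e^h - e *m v^h).
    by rewrite /eichler_mx mulmx0 mul0mx addr0 addrA.
  rewrite mul3; last 3 first.
  - by rewrite -scalemxAl -scalemxAr -!mulmxA (mulmxA e^h) -scalemxAr ev scaler0 mul0mx mulmx0 !scaler0.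
  - by rewrite -scalemxAl mulmxBr -!mulmxA !(mulmxA e^h) ev ee !mul0mx !mulmx0 subr0 scaler0.
  - by rewrite -scalemxAl mulmxBr -!mulmxA !(mulmxA _^h) dvv dve !mul0mx !mulmx0 subr0 scaler0.
  congr (_ + _); rewrite starD starZ dd !(mulmxDl, mulmxDr) -!(scalemxAl, scalemxAr).
  rewrite !scalerDr !scalerA !mulrN cd scaleN1r scale1r !scaleNr.
  by rewrite !addrA [LHS](ACl (1*4*3*2)).
have -> : eichler e v 0 = ((transv (d *: v) c)^-1 * (transv e c)^-1 * transv (e + d *: v) c)%g.
  by rewrite E !mulgA mulgKV mulVg mul1g.
by rewrite !groupM ?groupV // mem_transv_group // ?suppD ?suppZ.
Qed.

Lemma delta_norm i : (i < n)%N -> (delta i)^h *m delta i = 1%:M.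
Proof.
move=> ilt; rewrite [LHS]mx11_scalar (delta_form (Ordinal ilt)) !mxE /=.
by rewrite eqxx.
Qed.

Lemma delta_orth i j : i != j -> (delta i)^h *m delta j = 0.
Proof.
move=> ij; rewrite [LHS]mx11_scalar mxE big1 ?raddf0 // => l _; rewrite !mxE.
by case: eqP => [->|]; rewrite ?(negPf ij) ?mulr0 // rmorph0 mul0r.
Qed.

Definition kap : A := odflt 0 [pick k : A | k * invol A k == -1].
Lemma kapP : kap * invol A kap = -1.
Proof.
rewrite /kap; case: pickP => [s /eqP //|no]; have [s s1] := herm_norm hA.
by move: (no s); rewrite s1 eqxx.
Qed.

(** With [hpf], a hyperbolic pair on the coordinates i and j: [hpe] is isotropic since kap kap* =
    -1, and subtracting [half] times it from delta i gives an isotropic partner. [locked] stops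
    simplification from unfolding them. *)
Definition hpe i j := locked (delta i + kap *: delta j).
Definition hpf i j := locked (delta i - half A *: hpe i j).

Lemma hpeE i j : hpe i j = delta i + kap *: delta j.
Proof. by rewrite /hpe -lock. Qed.

Lemma hpfE i j : hpf i j = delta i - half A *: hpe i j.
Proof. by rewrite /hpf -lock. Qed.

Lemma hp_frame i j : (i < n)%N -> (j < n)%N -> i != j -> hframe (hpe i j) (hpf i j).
Proof.
move=> ilt jlt ij; have ji : j != i by rewrite eq_sym.
have dd := (delta_norm ilt, delta_norm jlt, delta_orth ij, delta_orth ji).
have ee : (hpe i j)^h *m hpe i j = 0.
  rewrite hpeE starD starZ !(mulmxDl, mulmxDr) -!(scalemxAl, scalemxAr) !dd.
  by rewrite !scaler0 addr0 add0r scalerA mulrC kapP scaleN1r subrr.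
have de : (delta i)^h *m hpe i j = 1%:M.
  by rewrite hpeE mulmxDr -scalemxAr !dd scaler0 addr0.
have ed : (hpe i j)^h *m delta i = 1%:M by rewrite -[LHS]starK starM starK de star1.
split=> //; rewrite hpfE starB starZ !(mulmxBl, mulmxBr) -!(scalemxAl, scalemxAr) ?ee ?de ?ed ?dd.
  rewrite !scaler0 subr0 -{1}[1%:M]scale1r -(halfP hA) scalerDl.
  by rewrite [_ *: _ + _]addrC addrK subrr.
by rewrite scaler0 subr0.
Qed.

Lemma hp_supp k i j : (k <= i)%N -> (k <= j)%N -> (hpe i j \in supp k) /\ (hpf i j \in supp k).
Proof.
move=> ki kj; have ke : hpe i j \in supp k by rewrite hpeE suppD ?suppZ ?delta_supp.
by split=> //; rewrite hpfE suppD ?suppN ?suppZ ?delta_supp.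
Qed.

Lemma delta_hp i j : delta i = hpf i j + half A *: hpe i j.
Proof. by rewrite hpfE subrK. Qed.

(** Each delta i with i >= l is a combination of the two isotropic vectors of a hyperbolic pair on i
    and another coordinate j >= l, which exists as l + 2 <= n. [eichler_isotropic] handles isotropic
    vectors, and changing [s] costs a transvection along [e]. *)
Lemma eichler_supp k l (e v : 'cV[A]_n) s0 : (k <= l)%N -> (l.+2 <= n)%N ->
  e \in supp k -> (forall x, x \in supp l -> e^h *m x = 0) -> v \in supp l ->
  eichlerP e v s0 -> eichler e v s0 \in tgroup k.
Proof.
move=> kl ln ke el lv Pvs; have [ee _ _] := Pvs.
pose good v := forall s, eichlerP e v s -> eichler e v s \in tgroup k.
have skew_good (x : 'cV[A]_n) (s t : 'M[A]_1) : eichlerP e x s -> eichlerP e x t ->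
    eichler e x s \in tgroup k -> eichler e x t \in tgroup k.
  move=> Ps Pt sT; have ss : (t - s)^h = - (t - s).
    case: Ps Pt => _ _ su [_ _ tu]; rewrite starB opprB; apply/subr0_eq.
    by rewrite opprB addrACA -opprD [t^h + t]addrC [s^h + s]addrC su tu subrr.
  have -> : eichler e x t = (eichler e x s * eichler e 0 (t - s))%g.
    by rewrite eichlerM ?mulmx0 ?addr0 ?subr0 ?[s + _]addrC ?subrK //; apply: eichlerP0.
  rewrite groupM //.
  have -> : eichler e 0 (t - s) = transv e ((t - s) ord0 ord0) by rewrite /transv -mx11_scalar.
  apply: mem_transv_group => //.
  by have := congr1 (fun M : 'M[A]_1 => M ord0 ord0) ss; rewrite /= starE => ->; rewrite [LHS]mxE.
have good_iso x : x \in supp l -> x^h *m x = 0 -> good x.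
  move=> lx xx s Ps; apply: (skew_good x 0) => //.
    by split=> //; [exact: el | rewrite xx star0 addr0 oppr0].
  by apply: eichler_isotropic => //; [exact: supp_leq lx | exact: el].
have goodD x y : x \in supp l -> y \in supp l -> good x -> good y -> good (x + y).
  move=> lx ly gx gy s Ps.
  have Px : eichlerP e x (sec x) by split=> //; [exact: el | exact: (secP hA)].
  have Py : eichlerP e y (sec y) by split=> //; [exact: el | exact: (secP hA)].
  apply: skew_good (eichlerP_D Px Py) Ps _.
  by rewrite -(eichlerM Px Py); apply: groupM; [apply: gx | apply: gy].
suff: v \in supp l /\ good v by case=> _ gv; apply: gv.
have iso (a : A) i : (l <= i < n)%N -> a *: delta i \in supp l /\ good (a *: delta i).
  move=> /andP[li ilt]; split; first by rewrite suppZ ?delta_supp.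
  have [j [lj jlt ij]] : exists j, [/\ (l <= j)%N, (j < n)%N & i != j].
    have [->|nil] := eqVneq i l; first by exists l.+1; rewrite leqnSn ln neq_ltn ltnSn.
    by exists l; rewrite leqnn nil (leq_trans _ ln).
  have [he hf] := hp_supp li lj; have [hee hff _] := hp_frame ilt jlt ij.
  rewrite (delta_hp i j) scalerDr scalerA; apply: goodD; rewrite ?suppZ //.
    by apply: good_iso; rewrite ?suppZ // starZ -scalemxAl -scalemxAr hff !scaler0.
  by apply: good_iso; rewrite ?suppZ // starZ -scalemxAl -scalemxAr hee !scaler0.
rewrite (supp_delta lv); elim/big_ind: _ => [|x y [lx gx] [ly gy]|i li].
- by split; [exact: supp0 | apply: good_iso; rewrite ?supp0 ?mulmx0].
- by split; [exact: suppD | apply: goodD].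
by apply: iso; rewrite li ltn_ord.
Qed.

Definition hform u v : A := (u^h *m v) ord0 ord0.
Local Notation "<[ u , v ]>" := (hform u v).

Lemma hformE u v : u^h *m v = <[u, v]>%:M.
Proof. exact: mx11_scalar. Qed.

Lemma hformDl u v w : <[u + v, w]> = <[u, w]> + <[v, w]>.
Proof. by rewrite /hform starD mulmxDl mxE. Qed.

Lemma hformDr u v w : <[u, v + w]> = <[u, v]> + <[u, w]>.
Proof. by rewrite /hform mulmxDr mxE. Qed.

Lemma hformZl a u v : <[a *: u, v]> = invol A a * <[u, v]>.
Proof. by rewrite /hform starZ -scalemxAl mxE. Qed.

Lemma hformZr a u v : <[u, a *: v]> = a * <[u, v]>.
Proof. by rewrite /hform -scalemxAr mxE. Qed.

Lemma hformNr u v : <[u, - v]> = - <[u, v]>.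
Proof. by rewrite /hform mulmxN mxE. Qed.

Lemma hform0l u : <[0, u]> = 0.
Proof. by rewrite /hform star0 mul0mx mxE. Qed.

Definition hform_lin := (hformDl, hformDr, hformZl, hformZr, hformNr).

Lemma hformC u v : invol A <[u, v]> = <[v, u]>.
Proof. by rewrite /hform -starE starM starK. Qed.

Lemma hform_umx g u v : <[g *m u, g *m v]> = <[u, v]>.
Proof. by rewrite /hform umx_form. Qed.

Lemma hform_mul u v w : u *m (v^h *m w) = <[v, w]> *: u.
Proof. by rewrite hformE mul_mx_scalar. Qed.

Lemma hform_delta (i : 'I_n) u : <[delta i, u]> = u i ord0.
Proof. by rewrite /hform delta_form mxE. Qed.

(** * Normal form of a unimodular vector under transvections *)

Section CanonicalForm.
Variable k : nat.
Hypothesis kn : (k.+4 <= n)%N.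
Local Notation T := (tgroup k).
Local Notation e1 := (hpe k k.+1).
Local Notation f1 := (hpf k k.+1).
Local Notation e2 := (hpe k.+2 k.+3).
Local Notation f2 := (hpf k.+2 k.+3).

Let k0n : (k < n)%N. Proof. by move: kn; lia. Qed.
Let k1n : (k.+1 < n)%N. Proof. by move: kn; lia. Qed.
Let k2n : (k.+2 < n)%N. Proof. by move: kn; lia. Qed.
Let k3n : (k.+3 < n)%N. Proof. by move: kn; lia. Qed.

Let frame1 : hframe e1 f1. Proof. by apply: hp_frame; rewrite // neq_ltn ltnSn. Qed.
Let frame2 : hframe e2 f2. Proof. by apply: hp_frame; rewrite // neq_ltn ltnSn. Qed.

Let supp_e1 : e1 \in supp k. Proof. by case: (@hp_supp k k k.+1). Qed.
Let supp_f1 : f1 \in supp k. Proof. by case: (@hp_supp k k k.+1). Qed.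
Let supp_e2 : e2 \in supp k.+2. Proof. by case: (@hp_supp k.+2 k.+2 k.+3). Qed.
Let supp_f2 : f2 \in supp k.+2. Proof. by case: (@hp_supp k.+2 k.+2 k.+3). Qed.

Let form1 : (<[e1, e1]> = 0) * (<[f1, f1]> = 0) * (<[e1, f1]> = 1) * (<[f1, e1]> = 1).
Proof.
have [ee ff fe] := frame1; have ef := hframe_dual frame1.
by do !split; rewrite /hform ?ee ?ff ?fe ?ef mxE ?eqxx.
Qed.

Let form2 : (<[e2, e2]> = 0) * (<[f2, f2]> = 0) * (<[e2, f2]> = 1) * (<[f2, e2]> = 1).
Proof.
have [ee ff fe] := frame2; have ef := hframe_dual frame2.
by do !split; rewrite /hform ?ee ?ff ?fe ?ef mxE ?eqxx.
Qed.

Let orth_delta i x : (i < k.+2)%N -> x \in supp k.+2 -> <[delta i, x]> = 0.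
Proof.
move=> ik /suppP kx; have ilt : (i < n)%N by apply: leq_trans ik (ltnW k2n).
by rewrite (hform_delta (Ordinal ilt)) kx.
Qed.

Let orth1 x : x \in supp k.+2 -> (<[e1, x]> = 0) * (<[f1, x]> = 0).
Proof.
move=> kx; have e0 : <[e1, x]> = 0 by rewrite hpeE !hform_lin !orth_delta // mulr0 addr0.
by split=> //; rewrite hpfE -scaleN1r !hform_lin e0 orth_delta // !mulr0 addr0.
Qed.

Let orth1' x : x \in supp k.+2 -> (<[x, e1]> = 0) * (<[x, f1]> = 0).
Proof. by move=> kx; rewrite -hformC orth1 // -(hformC f1) orth1 // rmorph0. Qed.

Lemma supp_perp u : u \in supp k -> <[e1, u]> = 0 -> <[f1, u]> = 0 -> u \in supp k.+2.
Proof.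
move=> ku eu fu; apply/suppP=> i; rewrite -hform_delta.
have du : <[delta k, u]> = 0 by rewrite (delta_hp k k.+1) !hform_lin eu fu mulr0 addr0.
rewrite ltnS leq_eqVlt => /orP[/eqP ik|]; last rewrite ltnS leq_eqVlt => /orP[/eqP ->|ik] //.
  rewrite ik; move: eu; rewrite hpeE !hform_lin du add0r => /(congr1 (fun a => kap * a)).
  by rewrite mulr0 mulrA kapP mulN1r => /eqP; rewrite oppr_eq0 => /eqP.
by rewrite hform_delta; move/suppP: ku => ->.
Qed.

Lemma supp_rest u : u \in supp k -> u - (<[f1, u]> *: e1 + <[e1, u]> *: f1) \in supp k.+2.
Proof.
move=> ku; apply: supp_perp; rewrite ?suppD ?suppN ?suppD ?suppZ // !hform_lin !form1.
  by rewrite mulr0 mulr1 add0r subrr.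
by rewrite mulr0 mulr1 addr0 subrr.
Qed.

Lemma hform_nondeg u : u \in supp k -> (forall x, x \in supp k.+2 -> <[x, u]> = 0) ->
  u = <[f1, u]> *: e1 + <[e1, u]> *: f1.
Proof.
move=> ku xu; apply/subr0_eq; have /suppP ku' := supp_rest ku.
apply/matrixP=> i j; rewrite ord1 [RHS]mxE; have [ki|ik] := leqP k.+2 i; last exact: ku'.
have kd := delta_supp ki.
by rewrite -hform_delta !hform_lin xu // !(orth1' kd) !mulr0 addr0 oppr0 addr0.
Qed.

Lemma move_gen (e v : 'cV[A]_n) s u : e \in supp k -> <[e, e]> = 0 ->
  (forall x, x \in supp k.+2 -> <[e, x]> = 0) -> v \in supp k.+2 ->
  s + invol A s = - <[v, v]> ->
  exists2 t, t \in T & t *m u = u + <[e, u]> *: v - <[v, u]> *: e + (s * <[e, u]>) *: e.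
Proof.
move=> ke ee ex kv sv.
have P0 : eichlerP e v s%:M.
  by split; rewrite !hformE ?ee ?ex ?raddf0 // star_scalar -raddfD /= sv raddfN.
exists (eichler e v s%:M).
  apply: (eichler_supp (l := k.+2)) => //; first by apply: leq_trans (leqnSn k) _.
  by move=> x kx; rewrite hformE ex ?raddf0.
rewrite eichlerE // /eichler_mx !mulmxDl mul1mx mulNmx -!mulmxA !hform_mul.
by rewrite hformE -scalar_mxM mul_mx_scalar.
Qed.

Lemma move_e v s u : v \in supp k.+2 -> s + invol A s = - <[v, v]> ->
  exists2 t, t \in T & t *m u = u + <[e1, u]> *: v - <[v, u]> *: e1 + (s * <[e1, u]>) *: e1.
Proof. by move=> kv sv; apply: move_gen; rewrite ?form1 // => x kx; rewrite orth1. Qed.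

Lemma move_f v s u : v \in supp k.+2 -> s + invol A s = - <[v, v]> ->
  exists2 t, t \in T & t *m u = u + <[f1, u]> *: v - <[v, u]> *: f1 + (s * <[f1, u]>) *: f1.
Proof. by move=> kv sv; apply: move_gen; rewrite ?form1 // => x kx; rewrite orth1. Qed.

Lemma half_norm v : - (half A * <[v, v]>) + invol A (- (half A * <[v, v]>)) = - <[v, v]>.
Proof. by rewrite rmorphN rmorphM hformC -opprD -mulrDl (halfP hA) mul1r. Qed.

(** The Eichler element along [e1] with v = -b u0 cancels the part u0 of [u] orthogonal to [e1] and
    [f1]. *)
Lemma canonical_kill u b : u \in supp k -> <[e1, u]> * b = 1 ->
  exists2 t, t \in T & exists x, t *m u = x *: e1 + <[e1, u]> *: f1.
Proof.
move=> ku yb.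
have [u0 ku0 xu0] : exists2 u0, u0 \in supp k.+2 & forall x, x \in supp k.+2 -> <[x, u0]> = <[x, u]>.
  exists (u - (<[f1, u]> *: e1 + <[e1, u]> *: f1)) => [|x kx]; first exact: supp_rest.
  by rewrite !hform_lin !(orth1' kx) !mulr0 addr0 oppr0 addr0.
have kv : (- b) *: u0 \in supp k.+2 by rewrite suppZ.
have [t tT tu] := move_e u kv (half_norm _).
exists t => //; exists <[f1, t *m u]>.
rewrite [LHS]hform_nondeg ?tgroup_supp //.
  congr (_ + _ *: _).
  by rewrite tu !hform_lin !form1 !(orth1 ku0) !(mulr0, addr0, oppr0).
move=> x kx; rewrite tu !hform_lin !(orth1' kx) !(mulr0, addr0, oppr0).
by rewrite xu0 // mulrA mulrN yb mulN1r subrr.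
Qed.

(** The pair [e2], [f2] is scratch space: y e2 is added first, then an Eichler element along [f1]
    turns the coefficient y of [f1] into y - (1 - b) y = 1, and [canonical_kill] clears what was
    spilled outside the first plane. *)
Lemma canonical_monic x y b : y * b = 1 ->
  exists2 t, t \in T & exists x', t *m (x *: e1 + y *: f1) = x' *: e1 + f1.
Proof.
move=> yb; have [u uE] : exists u, u = x *: e1 + y *: f1 by eexists.
rewrite -uE; have ku : u \in supp k by rewrite uE suppD ?suppZ.
have eu : <[e1, u]> = y by rewrite uE !hform_lin !form1 mulr0 add0r mulr1.
have xu z : z \in supp k.+2 -> <[z, u]> = 0.
  by move=> kz; rewrite uE !hform_lin !(orth1' kz) !mulr0 addr0.
have [|t1 t1T t1u] := @move_e e2 0 u supp_e2; first by rewrite form2 oppr0 rmorph0 addr0.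
rewrite eu xu // mul0r !scale0r subr0 addr0 in t1u.
have [u1 u1E] : exists u1, u1 = u + y *: e2 by eexists.
pose a := invol A (1 - b); have kv : a *: f2 \in supp k.+2 by rewrite suppZ.
have [|t2 t2T t2u] := @move_f (a *: f2) 0 u1 kv.
  by rewrite !hform_lin !form2 !mulr0 rmorph0 addr0 oppr0.
have ku1 : t2 *m u1 \in supp k.
  by rewrite tgroup_supp // u1E suppD // suppZ // (@supp_leq k k.+2) // ltnW.
have eu2 : <[e1, t2 *m u1]> = 1.
  rewrite t2u !hform_lin !(orth1 supp_f2) !form1 mul0r !(mulr0, mulr1, addr0, mul0r).
  rewrite u1E !hform_lin !form2 (orth1 supp_e2) eu xu // mulr0 mulr1 addr0 add0r.
  by rewrite /a involK mulrBl mul1r mulrC yb opprB addrC subrK.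
have [|t3 t3T [x' t3u]] := @canonical_kill (t2 *m u1) 1 ku1; first by rewrite eu2 mulr1.
exists (t3 * t2 * t1)%g; first by rewrite !groupM.
by exists x'; rewrite !umxM -!mulmxA t1u -u1E t3u eu2 scale1r.
Qed.

Definition canon a := f1 + (half A * a) *: e1.

Lemma canonical_unit u b : u \in supp k -> <[e1, u]> * b = 1 ->
  exists2 t, t \in T & t *m u = canon <[u, u]>.
Proof.
move=> ku yb; have [t1 t1T [x t1u]] := canonical_kill ku yb.
have [t2 t2T [x' t2u]] := canonical_monic x yb.
have norm : x' + invol A x' = <[u, u]>.
  rewrite -(hform_umx t1) -(hform_umx t2) t1u t2u !hform_lin !form1.
  by rewrite !(mulr0, mulr1, addr0, add0r) addrC.
(* Both terms have trace <u,u>, so [s] is skew and a transvection along [e1] adds it to the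
   coefficient of [e1]. *)
set s := half A * <[u, u]> - x'.
have [|t3 t3T t3u] := @move_e 0 s (x' *: e1 + f1) (supp0 _).
  rewrite hform0l oppr0 /s rmorphB rmorphM hformC addrACA -mulrDl (halfP hA) mul1r.
  by rewrite -opprD norm subrr.
exists (t3 * t2 * t1)%g; first by rewrite !groupM.
rewrite !umxM -!mulmxA t1u t2u t3u hform0l scale0r subr0 scaler0 addr0.
rewrite !hform_lin !form1 mulr0 add0r mulr1 addrAC -scalerDl addrC.
by rewrite /s [x' + _]addrC subrK.
Qed.

(** When <e1,u> = 0, a transvection along [f1] carries <f1,u> over to it. If that vanishes too, [u]
    has a nonzero coordinate i >= k + 2, which the Eichler element along [f1] with v = delta i
    carries over. *)
Lemma unit_coeff_field u : (forall x : A, x != 0 -> exists y, x * y = 1) ->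
  u \in supp k -> u != 0 -> exists2 t, t \in T & exists b, <[e1, t *m u]> * b = 1.
Proof.
move=> fieldA ku nu; suff [t tT nt] : exists2 t, t \in T & <[e1, t *m u]> != 0.
  by exists t => //; apply: fieldA.
have [y0|ny] := eqVneq <[e1, u]> 0; last by exists 1%g; rewrite ?group1 // mul1mx.
have [x0|nx] := eqVneq <[f1, u]> 0; last first.
  have [c [d cc cd]] := herm_skew_unit hA.
  have [|t tT tu] := @move_f 0 c u (supp0 _).
    by rewrite cc subrr hform0l oppr0.
  exists t => //; rewrite tu hform0l scale0r subr0 scaler0 addr0 !hform_lin !form1 y0 mulr1 add0r.
  by apply: contraNneq nx => cx; rewrite -[<[_, _]>]mul1r -cd mulrAC cx mul0r.
have ku2 := supp_perp ku y0 x0.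
have [i ni] : exists i, u i ord0 != 0.
  by have /matrix0Pn[i [j]] := nu; rewrite ord1; exists i.
have ki : delta i \in supp k.+2.
  by apply: delta_supp; rewrite leqNgt; apply: contra ni => ik; move/suppP: ku2 => ->.
have [t tT tu] := move_f u ki (half_norm _).
exists t => //; rewrite tu x0 !(mulr0, scale0r, addr0) !hform_lin y0 form1 hform_delta.
by rewrite mulr1 add0r oppr_eq0.
Qed.

Lemma split_idem (eps : A) : eps * invol A eps = 0 -> eps + invol A eps = 1 -> eps * eps = eps.
Proof. by move=> eps0 eps1; rewrite -[RHS]mulr1 -eps1 mulrDr eps0 addr0. Qed.

Section SplitRing.
Variable eps : A.
Hypotheses (eps0 : eps * invol A eps = 0) (eps1 : eps + invol A eps = 1).
Hypothesis epsV : forall x, eps * x != 0 -> exists y, eps * x * y = eps.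

(* The vectors [eps *: v] are isotropic, so each half of the ring can be moved separately. *)
Lemma split_move (fe : bool) v u : v \in supp k.+2 ->
  let e := if fe then f1 else e1 in
  exists2 t, t \in T & t *m u = u + (<[e, u]> * eps) *: v - (invol A eps * <[v, u]>) *: e.
Proof.
move=> kv; have kev : eps *: v \in supp k.+2 by rewrite suppZ.
have s0 : 0 + invol A 0 = - <[eps *: v, eps *: v]>.
  by rewrite rmorph0 addr0 !hform_lin mulrA [_ * eps]mulrC eps0 mul0r oppr0.
case: fe.
  have [t tT tu] := move_f u kev s0; exists t => //.
  by rewrite tu mul0r scale0r addr0 scalerA hformZl.
have [t tT tu] := move_e u kev s0; exists t => //.
by rewrite tu mul0r scale0r addr0 scalerA hformZl.
Qed.

Lemma split_zero u : u \in supp k -> eps * <[e1, u]> = 0 -> eps * <[f1, u]> = 0 ->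
  (forall i, (k.+2 <= i < n)%N -> eps * <[delta i, u]> = 0) -> eps *: u = 0.
Proof.
move=> ku y0 x0 d0; apply/matrixP=> i j; rewrite ord1 [RHS]mxE -hform_delta hformZr.
have [ki|ik] := leqP k.+2 i; first by rewrite d0 // ki ltn_ord.
have /suppP/(_ i ik) := supp_rest ku; rewrite -hform_delta !hform_lin.
move/eqP; rewrite subr_eq0 => /eqP ->; rewrite mulrDr !mulrA x0 y0 !mul0r addr0 //.
Qed.

End SplitRing.

(** A coordinate beyond k + 1 whose eps-half is nonzero can be carried to <e1,u> by a move along
    [f1]. If only <f1,u> has a nonzero eps-half, it is first copied to coordinate k + 2. *)
Lemma split_coeff (eps : A) u : eps * invol A eps = 0 -> eps + invol A eps = 1 ->
  u \in supp k -> eps *: u != 0 -> exists2 t, t \in T & eps * <[e1, t *m u]> != 0.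
Proof.
move=> eps0 eps1 ku nu.
have eps0' : invol A eps * invol A (invol A eps) = 0 by rewrite involK mulrC.
have eps1' : invol A eps + invol A (invol A eps) = 1 by rewrite involK addrC.
have step v : v \in supp k -> (exists2 i, (k.+2 <= i < n)%N & eps * <[delta i, v]> != 0) ->
    exists2 t, t \in T & eps * <[e1, t *m v]> != 0.
  move=> kv [i /andP[ki iltn] ni]; have kd := delta_supp ki.
  have [y0|ny] := eqVneq (eps * <[e1, v]>) 0; last by exists 1%g; rewrite ?group1 // mul1mx.
  have [t tT tv] := split_move eps0' true v kd.
  exists t => //; rewrite tv !hform_lin involK !form1 (orth1 kd) mulr0 addr0 mulr1.
  by rewrite mulrBr y0 add0r oppr_eq0 mulrA (split_idem eps0 eps1).
have [y0|ny] := eqVneq (eps * <[e1, u]>) 0; last by exists 1%g; rewrite ?group1 // mul1mx.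
have [/existsP[i /andP[ki ni]]|none] :=
    boolP [exists i : 'I_n, (k.+2 <= i)%N && (eps * <[delta i, u]> != 0)].
  by apply: step => //; exists i; rewrite ?ki ?ltn_ord.
have d0 i : (k.+2 <= i < n)%N -> eps * <[delta i, u]> = 0.
  case/andP=> ki ilt; apply: contraNeq none => ni.
  by apply/existsP; exists (Ordinal ilt); rewrite ki.
have nx : eps * <[f1, u]> != 0.
  by apply: contraNneq nu => x0; rewrite (split_zero ku y0 x0 d0).
have kd : delta k.+2 \in supp k.+2 by apply: delta_supp.
have [t1 t1T t1u] := split_move eps0 true u kd.
have dn : <[delta k.+2, delta k.+2]> = 1 by rewrite /hform delta_norm // mxE eqxx.
have [|t2 t2T t2u] := @step (t1 *m u) (tgroup_supp t1T ku).
  exists k.+2; rewrite ?leqnn // t1u !hform_lin (orth1' kd) mulr0 oppr0 addr0 dn mulr1.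
  by rewrite mulrDr d0 ?leqnn // add0r mulrCA (split_idem eps0 eps1) mulrC.
by exists (t2 * t1)%g; rewrite ?groupM // umxM -mulmxA.
Qed.

Lemma split_unit (eps : A) u : eps * invol A eps = 0 -> eps + invol A eps = 1 ->
  (forall x, eps * x != 0 -> exists y, eps * x * y = eps) ->
  u \in supp k -> eps * <[e1, u]> != 0 -> invol A eps *: u != 0 ->
  exists2 t, t \in T & exists b, <[e1, t *m u]> * b = 1.
Proof.
move=> eps0 eps1 epsV ku ny nu.
have eps0' : invol A eps * invol A (invol A eps) = 0 by rewrite involK mulrC.
have eps1' : invol A eps + invol A (invol A eps) = 1 by rewrite involK addrC.
have epsV' x : invol A eps * x != 0 -> exists y, invol A eps * x * y = invol A eps.
  move=> nx; have [|y ey] := epsV (invol A x).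
    by apply: contra nx => /eqP ex; rewrite -[x](involK) -rmorphM ex rmorph0.
  by exists (invol A y); rewrite -{1}[x]involK -!rmorphM ey.
have unit2 y : eps * y != 0 -> invol A eps * y != 0 -> exists b, y * b = 1.
  move=> /epsV[b1 yb1] /epsV'[b2 yb2]; exists (eps * b1 + invol A eps * b2).
  transitivity (eps * y * b1 + invol A eps * y * b2); first by ring.
  by rewrite yb1 yb2.
have step v : v \in supp k -> eps * <[e1, v]> != 0 ->
    (exists2 i, (k.+2 <= i < n)%N & invol A eps * <[delta i, v]> != 0) ->
    exists2 t, t \in T & exists b, <[e1, t *m v]> * b = 1.
  move=> kv nyv [i /andP[ki iltn] ni]; have kd := delta_supp ki.
  have [y0|nyv'] := eqVneq (invol A eps * <[e1, v]>) 0; last first.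
    by exists 1%g; rewrite ?group1 // mul1mx; apply: unit2.
  have [t tT tv] := split_move eps0 true v kd.
  exists t => //; rewrite tv !hform_lin !form1 (orth1 kd) mulr0 addr0 mulr1; apply: unit2.
    by rewrite mulrBr mulrA eps0 mul0r subr0.
  by rewrite mulrBr y0 add0r oppr_eq0 mulrA (split_idem eps0' eps1').
have [y0|ny'] := eqVneq (invol A eps * <[e1, u]>) 0; last first.
  by exists 1%g; rewrite ?group1 // mul1mx; apply: unit2.
have [/existsP[i /andP[ki ni]]|none] :=
    boolP [exists i : 'I_n, (k.+2 <= i)%N && (invol A eps * <[delta i, u]> != 0)].
  by apply: step => //; exists i; rewrite ?ki ?ltn_ord.
have d0 i : (k.+2 <= i < n)%N -> invol A eps * <[delta i, u]> = 0.
  case/andP=> ki ilt; apply: contraNeq none => ni.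
  by apply/existsP; exists (Ordinal ilt); rewrite ki.
have nx : invol A eps * <[f1, u]> != 0.
  by apply: contraNneq nu => x0; rewrite (split_zero ku y0 x0 d0).
(* The condition eps <v,u> = 0 makes the move along [f1] change [u] only in the other half, so the
   eps-half already gained is not lost. The two coordinates k + 2 and k + 3 leave room for this
   equation and for an entry 1 in [v]. *)
have [v [kv [i ki dv] ev]] : exists v, [/\ v \in supp k.+2,
    exists2 i, (k.+2 <= i < n)%N & <[delta i, v]> = 1 & eps * <[v, u]> = 0].
  have dn i : (i < n)%N -> <[delta i, delta i]> = 1.
    by move=> ilt; rewrite /hform delta_norm // mxE eqxx.
  have [a0|na] := eqVneq (eps * <[delta k.+2, u]>) 0.
    by exists (delta k.+2); split; rewrite ?delta_supp //; exists k.+2; rewrite ?leqnn ?dn.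
  have [w aw] := epsV _ na.
  exists (delta k.+3 + (- invol A (w * <[delta k.+3, u]>)) *: delta k.+2); split.
  - by rewrite suppD ?suppZ ?delta_supp.
  - exists k.+3; first by rewrite leqnSn.
    rewrite !hform_lin dn // {2}/hform delta_orth ?mxE ?mulr0 ?addr0 //.
    by rewrite neq_ltn ltnSn orbT.
  rewrite !hform_lin rmorphN involK mulNr mulrDr mulrN.
  have -> : eps * (w * <[delta k.+3, u]> * <[delta k.+2, u]>)
          = (eps * <[delta k.+2, u]> * w) * <[delta k.+3, u]> by ring.
  by rewrite aw subrr.
have [t1 t1T t1u] := split_move eps0' true u kv.
rewrite involK ev scale0r subr0 in t1u.
have [||t2 t2T [b t2u]] := @step (t1 *m u) (tgroup_supp t1T ku).
- by rewrite t1u !hform_lin (orth1 kv) mulr0 addr0.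
- exists i => //; rewrite t1u !hform_lin dv mulr1 mulrDr d0 // add0r mulrCA.
  by rewrite (split_idem eps0' eps1') mulrC.
by exists (t2 * t1)%g; rewrite ?groupM //; exists b; rewrite umxM -mulmxA.
Qed.

Theorem tgroup_canonical u z : u \in supp k -> <[u, z]> = 1 ->
  exists2 t, t \in T & t *m u = canon <[u, u]>.
Proof.
move=> ku uz.
suff [t1 t1T [b t1u]] : exists2 t, t \in T & exists b, <[e1, t *m u]> * b = 1.
  have [t2 t2T t2u] := canonical_unit (tgroup_supp t1T ku) t1u.
  exists (t2 * t1)%g; first by rewrite groupM.
  by rewrite umxM -mulmxA t2u hform_umx.
have nz (a : A) : a *: u = 0 -> invol A a = 0.
  by move=> au; rewrite -[invol A a]mulr1 -uz -hformZl au /hform star0 mul0mx mxE.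
have inj0 (a : A) : invol A a = 0 -> a = 0 by move=> a0; rewrite -[a]involK a0 rmorph0.
case: (herm_split hA) => [fieldA|[eps [eps0 eps1 epsV]]].
  apply: unit_coeff_field => //; apply: contraNneq (oner_neq0 A) => u0.
  by apply/eqP/inj0/nz; rewrite u0 scaler0.
have neps : eps != 0.
  by apply: contraNneq (oner_neq0 A) => e0; rewrite -eps1 e0 rmorph0 addr0.
have [|t1 t1T ny] := split_coeff eps0 eps1 ku.
  by apply: contra neps => /eqP/nz/inj0->.
have [|t2 t2T [b t2u]] := split_unit eps0 eps1 epsV (tgroup_supp t1T ku) ny.
  apply: contra neps => /eqP; rewrite scalemxAr => /(congr1 (mulmx (umx t1^-1%g))).
  by rewrite umxKV mulmx0 => /nz; rewrite involK => ->.
by exists (t2 * t1)%g; rewrite ?groupM //; exists b; rewrite umxM -mulmxA.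
Qed.

End CanonicalForm.
End Transitivity.

(** * Stabilisers of basis vectors and the commutator subgroup *)

Section Generation.
Variables (q : nat) (A : involRing).
Hypothesis hA : hermitian_ring q A.
Variable n : nat.
Local Notation U := (unitary A n).
Local Notation "<[ u , v ]>" := (hform u v).
Local Notation T := (@tgroup A n).
Local Notation delta := (@delta A n).
Implicit Types (g h t : U) (k : nat) (u v w : 'cV[A]_n).

Lemma tgroup_transitive k u v z z' : (k.+4 <= n)%N -> u \in supp k -> v \in supp k ->
  <[u, z]> = 1 -> <[v, z']> = 1 -> <[u, u]> = <[v, v]> ->
  exists2 t, t \in T k & t *m u = v.
Proof.
move=> kn ku kv uz vz uv.
have [t tT tu] := tgroup_canonical hA kn ku uz.
have [t' tT' tv] := tgroup_canonical hA kn kv vz.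
exists (t'^-1 * t)%g; first by rewrite groupM ?groupV.
by rewrite umxM -mulmxA tu uv -tv umxKV.
Qed.

Lemma hform_deltas (i j : nat) : (i < n)%N -> <[delta i, delta j]> = (i == j)%:R.
Proof.
move=> ilt; case: eqVneq => [<-|ij]; last by rewrite /hform delta_orth ?mxE.
by rewrite (hform_delta (Ordinal ilt)) mxE /=; case: eqP.
Qed.

Definition fixd k : {group U} := fix_group (\matrix_(i < n, j < k) (i == j :> nat)%:R : 'M[A]_(n, k)).

Lemma fixdP k g : reflect (forall j, (j < k)%N -> g *m delta j = delta j) (g \in fixd k).
Proof.
have colE (M : 'M[A]_n) (j : nat) (jk : (j < k)%N) :
    col (Ordinal jk) (M *m (\matrix_(i < n, l < k) (i == l :> nat)%:R)) = M *m delta j.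
  by rewrite !colE -mulmxA -colE; congr (M *m _); apply/matrixP=> a b; rewrite !mxE.
apply: (iffP (fixP _ _)) => [gx j jk | gx].
  by rewrite -(colE g j jk) gx -[X in col _ X]mul1mx colE mul1mx.
apply/matrixP=> i j; have := gx j (ltn_ord j).
rewrite -(colE g j (ltn_ord j)) => /matrixP/(_ i ord0).
rewrite mxE (_ : Ordinal _ = j); last exact: val_inj.
by move=> ->; rewrite !mxE.
Qed.

Lemma fixd_form k g i j : g \in fixd k -> (i < k)%N -> <[delta i, g *m delta j]> = <[delta i, delta j]>.
Proof. by move=> /fixdP gk ik; rewrite -{1}(gk i ik) hform_umx. Qed.

Lemma tgroup_fixd k : T k \subset fixd k.
Proof.
apply: transv_group_sub => w c kw ww cc; apply/fixdP=> j jk.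
rewrite transvE // mulmxDl mul1mx -scalemxAl -mulmxA.
suff -> : w^h *m delta j = 0 by rewrite mulmx0 scaler0 addr0.
rewrite -[LHS]starK starM starK; suff -> : (delta j)^h *m w = 0 by rewrite star0.
have [jn|nj] := ltnP j n.
  rewrite (delta_form (Ordinal jn)); apply/matrixP=> a b; rewrite !ord1 !mxE.
  by move/suppP: kw => ->.
apply/matrixP=> a b; rewrite !mxE big1 // => i _.
by rewrite !mxE ltn_eqF ?rmorph0 ?mul0r // (leq_trans (ltn_ord i)).
Qed.

(** [g] sends delta k to a unimodular vector of supp k of the same norm, and T k is transitive on
    such vectors. *)
Lemma fixd_step k g : (k.+4 <= n)%N -> g \in fixd k ->
  exists2 t, t \in T k & (t * g)%g \in fixd k.+1.
Proof.
move=> kn gk; have kltn : (k < n)%N by move: kn; lia.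
have dk : delta k \in supp k by apply: delta_supp.
have gd : g *m delta k \in supp k.
  by apply/suppP=> i ik; rewrite -hform_delta (fixd_form _ gk ik) hform_deltas ?ltn_eqF.
have dd : <[delta k, delta k]> = 1 by rewrite hform_deltas ?eqxx.
have [t tT tg] : exists2 t, t \in T k & t *m (g *m delta k) = delta k.
  by apply: (tgroup_transitive kn gd dk (z := g *m delta k) (z' := delta k)); rewrite ?hform_umx.
exists t => //; apply/fixdP=> j; rewrite ltnS leq_eqVlt => /orP[/eqP->|jk].
  by rewrite umxM -mulmxA tg.
have tg' : (t * g)%g \in fixd k by rewrite groupM // (subsetP (tgroup_fixd k)).
exact: (elimT (fixdP _ _) tg').
Qed.

Lemma fixd_factor k g : (k + 3 <= n)%N -> g \in fixd k ->
  exists2 t, t \in T k & (t * g)%g \in fixd (n - 3).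
Proof.
move=> kn; have [m nE] : exists m, (n - 3 = k + m)%N by exists (n - 3 - k)%N; move: kn; lia.
rewrite nE; elim: m k g nE {kn} => [|m IHm] k g nE gk.
  by exists 1%g; rewrite ?group1 // mul1g addn0.
have [|t tT tg] := @fixd_step k g _ gk; first by move: nE; lia.
have [|t' tT' tg'] := IHm k.+1 _ _ tg; first by move: nE; lia.
exists (t' * t)%g; last by rewrite -mulgA -addSnnS.
by rewrite groupM // (subsetP (tgroup_leq _ _ (leqnSn k))).
Qed.

(** Such an element is determined by a 3 x 3 block. Three coordinates are left over because
    [fixd_step] asks for k + 4 <= n. *)
Lemma card_fixd_small : (3 <= n)%N -> (#|fixd (n - 3)| <= #|A| ^ 9)%N.
Proof.
move=> n3; pose phi g : 'M[A]_3 := \matrix_(a, b) <[delta (n - 3 + a), g *m delta (n - 3 + b)]>.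
rewrite (_ : 9 = 3 * 3)%N // -card_mx -(card_in_imset (f := phi)) ?max_card //.
move=> g h gk hk /matrixP E; apply: umx_inj; apply/matrixP=> i j.
have entry (x : U) : x i j = <[delta i, x *m delta j]>.
  rewrite hform_delta mxE (bigD1 j) //= mxE eqxx mulr1 big1 ?addr0 // => l /negPf lj.
  by rewrite mxE val_eqE lj mulr0.
rewrite !entry; have [ik|ki] := ltnP i (n - 3); first by rewrite !(fixd_form (k := (n - 3)%N)).
have [jk|kj] := ltnP j (n - 3); first by rewrite (elimT (fixdP _ _) gk j jk) (elimT (fixdP _ _) hk j jk).
have lt3 (l : 'I_n) : (n - 3 <= l)%N -> (l - (n - 3) < 3)%N by have := ltn_ord l; lia.
have := E (Ordinal (lt3 _ ki)) (Ordinal (lt3 _ kj)); rewrite !mxE /=.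
by rewrite !subnKC.
Qed.

Lemma card_fixd k : (k + 3 <= n)%N -> (#|fixd k| <= #|T k| * #|A| ^ 9)%N.
Proof.
move=> kn; have n3 : (3 <= n)%N by move: kn; lia.
apply: (@leq_trans (#|T k| * #|fixd (n - 3)|)); last by rewrite leq_mul2l card_fixd_small ?orbT.
apply: (@leq_trans #|T k * fixd (n - 3)|%g); last first.
  by rewrite mul_cardG leq_pmulr ?cardG_gt0.
apply/subset_leq_card/subsetP=> g gk; have [t tT tg] := fixd_factor kn gk.
by apply/mulsgP; exists t^-1%g (t * g)%g; rewrite ?groupV ?mulKg.
Qed.

Lemma tgroup_normal g t : t \in T 0 -> (g * t * g^-1)%g \in T 0.
Proof.
move=> tT; suff : (T 0 :^ g^-1)%g \subset T 0.
  by move/subsetP; apply; rewrite mem_conjgV conjgE !mulgA mulVg mul1g mulgKV.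
rewrite -genJ gen_subG; apply/subsetP=> _ /imsetP[x xS ->].
move: xS; rewrite inE => /existsP[w /existsP[c /and4P[_ /eqP ww /eqP cc /eqP->]]].
rewrite conjgE invgK mulgA transvJ //; apply: mem_transv_group => //.
  by apply/suppP.
by rewrite umx_form.
Qed.

Lemma umx_delta_inj g h : (forall j, (j < n)%N -> g *m delta j = h *m delta j) -> g = h.
Proof.
move=> gh; apply: umx_inj; apply/matrixP=> i j.
have colE (M : 'M[A]_n) : M i j = (M *m delta j) i ord0.
  rewrite mxE (bigD1 j) //= mxE eqxx mulr1 big1 ?addr0 // => l /negPf lj.
  by rewrite mxE val_eqE lj mulr0.
by rewrite !colE gh.
Qed.

Lemma umx_fix_sum g (P : pred 'I_n) (c : 'I_n -> A) :
  (forall i, P i -> g *m delta i = delta i) ->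
  g *m (\sum_(i | P i) c i *: delta i) = \sum_(i | P i) c i *: delta i.
Proof. by move=> gP; rewrite mulmx_sumr; apply: eq_bigr => i Pi; rewrite -scalemxAr gP. Qed.

Lemma delta_sum w : w = \sum_(i < n) w i ord0 *: delta i.
Proof.
apply/matrixP=> i j; rewrite ord1 summxE (bigD1 i) //= !mxE eqxx mulr1 big1 ?addr0 // => l /negPf li.
by rewrite !mxE [_ == _]eq_sym val_eqE li mulr0.
Qed.

(** [a] acts on the last three coordinates and [b] on the first three, which are disjoint for n >=
    6. *)
Lemma fix_complement_commute (a b : U) : (6 <= n)%N -> a \in fixd (n - 3) ->
  (forall j, (3 <= j < n)%N -> b *m delta j = delta j) -> commute a b.
Proof.
move=> n6 /fixdP afix bfix; apply: umx_delta_inj => j jn; rewrite !umxM -!mulmxA.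
have aentry (i : 'I_n) : (n - 3 <= j)%N -> (i < n - 3)%N -> (a *m delta j) i ord0 = 0.
  move=> nj i3; rewrite -hform_delta -{1}(afix i i3) hform_umx hform_deltas //.
  by rewrite ltn_eqF // (leq_trans i3).
have bentry (i : 'I_n) : (j < 3)%N -> (3 <= i)%N -> (b *m delta j) i ord0 = 0.
  move=> j3 i3; rewrite -hform_delta -{1}(bfix i) ?i3 ?ltn_ord // hform_umx hform_deltas //.
  by rewrite gtn_eqF // (leq_trans j3).
have [j3|j3] := ltnP j 3.
  rewrite (afix j); last by move: n6 j3; lia.
  rewrite [b *m delta j]delta_sum (bigID (fun i : 'I_n => (i < 3)%N)) /= [X in _ + X]big1 ?addr0.
    by rewrite umx_fix_sum // => i i3; apply: afix; move: n6 i3; lia.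
  by move=> i; rewrite -leqNgt => i3; rewrite bentry // scale0r.
rewrite (bfix j) ?j3 //; have [jl|jl] := ltnP j (n - 3); first by rewrite afix // bfix ?j3.
rewrite [a *m delta j]delta_sum (bigID (fun i : 'I_n => (n - 3 <= i)%N)) /= [X in _ + X]big1 ?addr0.
  by rewrite umx_fix_sum // => i i3; apply: bfix; rewrite ltn_ord andbT; move: n6 i3; lia.
by move=> i; rewrite -ltnNge => i3; rewrite aentry // scale0r.
Qed.

Lemma rev_unitary_subproof : let M := \matrix_(i < n, j < n) (rev_ord i == j)%:R : 'M[A]_n in
  M^h *m M == 1%:M.
Proof.
apply/eqP/matrixP=> i j; rewrite !mxE (bigD1 (rev_ord i)) //= !mxE rev_ordK eqxx rmorph1 mul1r.
rewrite big1 ?addr0 // => k /negPf ki.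
by rewrite !mxE -{1}[i]rev_ordK (inj_eq rev_ord_inj) ki rmorph0 mul0r.
Qed.

Definition rev_unitary : U := Unitary rev_unitary_subproof.

Lemma rev_unitary_delta (j : 'I_n) : rev_unitary *m delta j = delta (rev_ord j).
Proof.
apply/matrixP=> i l; rewrite mxE (bigD1 j) //= !mxE eqxx mulr1 big1 ?addr0 => [|k /negPf kj].
  by have -> : (rev_ord i == j) = (i == rev_ord j) by rewrite -(inj_eq rev_ord_inj) rev_ordK.
by rewrite [delta j _ _]mxE val_eqE kj mulr0.
Qed.

(** Modulo the normal subgroup T 0, [g] is represented by a unitary acting on the last three
    coordinates. Conjugating by the reversal of coordinates, [h] is represented by one acting on the
    first three, and the two commute. *)
Lemma unitary_commutator g h : (6 <= n)%N -> [~ g, h]%g \in T 0.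
Proof.
move=> n6; have n3 : (0 + 3 <= n)%N by move: n6; lia.
have all0 x : x \in fixd 0 by apply/fixdP.
have nT x : x \in 'N(T 0)%g.
  rewrite inE; apply/subsetP=> _ /imsetP[t tT ->].
  by have := tgroup_normal x^-1%g tT; rewrite invgK conjgE mulgA.
have [t tT tg] := fixd_factor n3 (all0 g).
have [t' tT' th] := fixd_factor n3 (all0 (rev_unitary^-1 * h * rev_unitary)%g).
have [x xE] : exists x, x = (t' * (rev_unitary^-1 * h * rev_unitary))%g by eexists.
rewrite -xE in th; set a := (t * g)%g in tg; set b := (rev_unitary * x * rev_unitary^-1)%g.
have ab : commute a b.
  apply: fix_complement_commute => // j /andP[j3 jn].
  rewrite /b 2!umxM -!mulmxA.
  have -> : umx rev_unitary^-1%g *m delta j = delta (rev_ord (Ordinal jn)).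
    by rewrite -[j in LHS]/(nat_of_ord (Ordinal jn)) -{1}[Ordinal jn]rev_ordK -rev_unitary_delta umxKV.
  rewrite (elimT (fixdP _ _) th); last by rewrite /=; move: j3 jn n6; lia.
  by rewrite rev_unitary_delta rev_ordK.
have bE : coset (T 0) b = coset (T 0) h.
  rewrite /b xE !morphM ?morphV ?groupM ?groupV ?nT //= (coset_id tT') mul1g.
  by rewrite !mulgA mulgK mulgV mul1g.
have aE : coset (T 0) a = coset (T 0) g by rewrite /a morphM ?nT //= (coset_id tT) mul1g.
apply: coset_idr; first exact: nT.
rewrite morphR ?nT //= -aE -bE; apply/eqP/commgP.
by rewrite /commute -!morphM ?nT // ab.
Qed.

Lemma tgroup_der1 (H : {group U}) : (6 <= n)%N -> (H^`(1) \subset T 0)%g.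
Proof.
by move=> n6; rewrite gen_subG; apply/subsetP=> _ /imset2P[g h _ _ ->]; apply: unitary_commutator.
Qed.

End Generation.

(** * Fixed points and moments *)

Section Counting.
Variables (q : nat) (A : involRing).
Hypothesis hA : hermitian_ring q A.
Variable n : nat.
Local Notation U := (unitary A n).
Local Notation "<[ u , v ]>" := (hform u v).
Local Notation T := (@tgroup A n).
Local Notation delta := (@delta A n).
Implicit Types (g h t : U) (k : nat) (u v w : 'cV[A]_n).

(** A nonzero vector fails to be unimodular only in the split case, when one half of it is 0.
    Filling that half with delta k makes it unimodular, and the complementary idempotent recovers
    [u]. *)
Lemma unimodular_multiple k u : (k < n)%N -> u \in supp k ->
  exists a v, [/\ v \in supp k, u = a *: v & exists z, <[v, z]> = 1].
Proof.
move=> kn ku; have dk : delta k \in supp k by apply: delta_supp.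
have dd : <[delta k, delta k]> = 1 by rewrite hform_deltas ?eqxx.
have [u0|nu] := eqVneq u 0.
  by exists 0, (delta k); split; rewrite ?scale0r //; exists (delta k).
have unim v : (exists z, v^h *m z = 1%:M) -> exists z, <[v, z]> = 1.
  by case=> z vz; exists z; rewrite /hform vz mxE eqxx.
case: (herm_split hA) => [fieldA|[eps [eps0 eps1 epsV]]].
  exists 1, u; rewrite scale1r; split=> //; have [i [j ni]] := matrix0Pn _ nu.
  rewrite ord1 in ni; have [y iy] := fieldA _ ni.
  exists (invol A y *: delta i); rewrite hformZr -hformC hform_delta -rmorphM mulrC.
  by rewrite iy rmorph1.
have eps0' : invol A eps * invol A (invol A eps) = 0 by rewrite involK mulrC.
have eps1' : invol A eps + invol A (invol A eps) = 1 by rewrite involK addrC.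
have idem := split_idem eps0 eps1; have idem' := split_idem eps0' eps1'.
have both v : eps *: v != 0 -> invol A eps *: v != 0 -> exists z, <[v, z]> = 1.
  move=> /matrix0Pn[i [j]]; rewrite ord1 mxE => ni /matrix0Pn[i' [j']]; rewrite ord1 mxE => ni'.
  apply: unim; have [//|v0] := unimodular_or_null hA v.
  have /matrixP/(_ i i') := v0; rewrite mxE big_ord1 starE mxE => vv.
  have [y vy] := epsV _ ni.
  case/eqP: ni'; rewrite -[_ * v i' ord0]involK rmorphM involK -vy.
  transitivity (invol A (eps * y * (v i ord0 * invol A (v i' ord0)))); last first.
    by rewrite vv mulr0 rmorph0.
  by congr (invol A _); ring.
have half0 (e : A) : e * e = e -> e * invol A e = 0 -> e + invol A e = 1 ->
    (forall v, e *: v != 0 -> invol A e *: v != 0 -> exists z, <[v, z]> = 1) ->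
    e *: u = 0 -> exists a v, [/\ v \in supp k, u = a *: v & exists z, <[v, z]> = 1].
  move=> ee e0 e1 bothe eu.
  have uE : invol A e *: u = u by rewrite -[RHS]scale1r -e1 scalerDl eu add0r.
  exists (invol A e), (u + e *: delta k); split; first by rewrite suppD // suppZ.
    by rewrite scalerDr scalerA mulrC e0 scale0r addr0 uE.
  apply: bothe; last by rewrite scalerDr scalerA mulrC e0 scale0r addr0 uE.
  rewrite scalerDr eu add0r scalerA ee; apply: contra nu => /eqP ed.
  have e00 : e = 0.
    rewrite -[e]involK -[invol A e]mulr1 -dd -hformZl ed hform0l.
    by rewrite rmorph0.
  by rewrite -uE e00 rmorph0 scale0r.
have [e0|ne] := eqVneq (eps *: u) 0; first exact: (half0 eps).
have [e0|ne'] := eqVneq (invol A eps *: u) 0.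
  by apply: (half0 (invol A eps)) => // v; rewrite involK => nv nv'; apply: both.
by exists 1, u; rewrite scale1r; split=> //; apply: both.
Qed.

Lemma move_into k u : (k.+4 <= n)%N -> u \in supp k ->
  exists2 t, t \in T k & forall i : 'I_n, (k.+2 <= i)%N -> (t *m u) i ord0 = 0.
Proof.
move=> kn ku; have kltn : (k < n)%N by move: kn; lia.
have [a [v [kv -> [z vz]]]] := unimodular_multiple kltn ku.
have [t tT tv] := tgroup_canonical hA kn kv vz.
exists t => // i ki; rewrite -scalemxAr tv /canon hpfE hpeE !mxE.
have [ik|_] := eqVneq (i : nat) k; first by move: ki; rewrite ik; lia.
have [ik|_] := eqVneq (i : nat) k.+1; first by move: ki; rewrite ik ltnn.
by rewrite !(mulr0, addr0, subr0, oppr0).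
Qed.

Lemma col_mulmx (R : comNzRingType) m p r (l : 'I_r) (M : 'M[R]_(m, p)) (x : 'M_(p, r)) :
  col l (M *m x) = M *m col l x.
Proof. by rewrite !colE mulmxA. Qed.

(** Columns are treated one by one. Column j is moved by T (2 j), which fixes the first 2 j basis
    vectors, hence the columns already placed and the low part of the new one. *)
Lemma move_tuple N (x : 'M[A]_(n, N)) : (2 * N + 2 <= n)%N ->
  exists2 t, t \in T 0 & forall (i : 'I_n) l, (2 * N <= i)%N -> (t *m x) i l = 0.
Proof.
move=> Nn.
suff H j : (j <= N)%N -> exists2 t, t \in T 0 &
    forall (i : 'I_n) (l : 'I_N), (l < j)%N -> (2 * j <= i)%N -> (t *m x) i l = 0.
  by have [t tT tx] := H N (leqnn N); exists t => // i l Ni; apply: tx.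
elim: j => [|j IHj] jN; first by exists 1%g; rewrite ?group1.
have [t tT tx] := IHj (ltnW jN); have jN' := jN; pose l0 := Ordinal jN; pose u := col l0 (t *m x).
pose u1 : 'cV[A]_n := \col_i (if (2 * j <= i)%N then u i ord0 else 0).
have ku1 : u1 \in supp (2 * j).
  by apply/suppP=> i ij; rewrite mxE leqNgt ij.
have [|t' tT' tu1] := move_into _ ku1; first by move: jN' Nn; lia.
have tfix := subsetP (tgroup_fixd _ _ _) _ tT'.
have fix_low (y : 'cV[A]_n) : (forall i : 'I_n, (2 * j <= i)%N -> y i ord0 = 0) -> t' *m y = y.
  move=> y0; rewrite [y]delta_sum (bigID (fun i : 'I_n => (i < 2 * j)%N)) /= [X in _ + X]big1 ?addr0.
    by rewrite umx_fix_sum // => i ij; apply: (elimT (fixdP _ _) tfix).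
  by move=> i; rewrite -leqNgt => ij; rewrite y0 // scale0r.
exists (t' * t)%g; first by rewrite groupM // (subsetP (tgroup_leq _ _ (leq0n (2 * j)))).
move=> i l lj ij; have ij' : (2 * j <= i)%N by move: ij; lia.
have -> : ((t' * t)%g *m x) i l = (t' *m col l (t *m x)) i ord0.
  by rewrite umxM -mulmxA -col_mulmx [RHS]mxE.
move: lj; rewrite ltnS leq_eqVlt => /orP[/eqP lj|lj]; last first.
  by rewrite fix_low => [|a ja]; rewrite [LHS]mxE; apply: tx.
have -> : l = l0 by apply: val_inj.
rewrite -/u (_ : u = (u - u1) + u1); last by rewrite subrK.
rewrite mulmxDr mxE tu1 ?addr0; last by move: ij; lia.
rewrite fix_low => [|a ja]; first by rewrite !mxE ij' subrr.
by rewrite mxE [(- u1) _ _]mxE [u1 _ _]mxE ja subrr.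
Qed.

(** A matrix [u] is determined by e^h u, f^h u and its projection, so at most |A|^(2 r^2) matrices
    share a projection. *)
Lemma card_perp_lower r (e f : 'M[A]_(n, r)) : hframe e f ->
  (#|A| ^ (r * (n - 2 * r)) <= #|[pred u : 'M[A]_(n, r) | u \in perp e f]|)%N.
Proof.
move=> ef; have A0 : (0 < #|A|)%N by apply/card_gt0P; exists 0.
set B := [pred u | _].
have H : (#|A| ^ (n * r) <= #|A| ^ (r * r) * #|A| ^ (r * r) * #|B|)%N.
  pose phi (u : 'M[A]_(n, r)) : 'M[A]_r * 'M[A]_r * 'M[A]_(n, r) :=
    (e^h *m u, f^h *m u, proj_perp e f u).
  have phi_inj : injective phi.
    move=> u v [eu fu]; rewrite /proj_perp eu fu => /(congr1 (fun x => x + f *m (e^h *m v))).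
    by rewrite !subrK => /(congr1 (fun x => x + e *m (f^h *m v))); rewrite !subrK.
  rewrite -!card_mx -card_prod -cardsT -(card_imset _ phi_inj) -(cardX (predT : pred ('M[A]_r * 'M[A]_r)) B).
  apply/subset_leq_card/subsetP=> x /imsetP[u _ ->].
  by rewrite inE /=; apply: proj_perp_in.
have [rn|nr] := leqP (2 * r) n; last first.
  rewrite (_ : n - 2 * r = 0)%N ?muln0 ?expn0; last by move: nr; lia.
  by apply/card_gt0P; exists 0; rewrite inE perp0.
rewrite -(@leq_pmul2l (#|A| ^ (r * r) * #|A| ^ (r * r))) ?muln_gt0 ?expn_gt0 ?A0 //.
apply: leq_trans H; rewrite -!expnD leq_pexp2l //; nia.
Qed.

Definition fixnum g := #|[pred u : 'cV[A]_n | g *m u == u]|.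

Lemma fixnum_mx g N : #|[pred x : 'M[A]_(n, N) | g *m x == x]| = (fixnum g ^ N)%N.
Proof.
pose cols (x : 'M[A]_(n, N)) := [ffun l => col l x].
have cols_inj : injective cols.
  move=> x y /ffunP xy; apply/matrixP=> i l.
  by have := xy l; rewrite !ffunE => /matrixP/(_ i ord0); rewrite !mxE.
rewrite -[N in RHS]card_ord -card_ffun_on -(card_imset _ cols_inj).
apply: eq_card => c; apply/imsetP/ffun_onP => [[x /eqP gx ->] l | gc].
  by rewrite ffunE inE -col_mulmx gx.
exists (\matrix_(i, l) c l i ord0).
  rewrite inE; apply/eqP/matrixP=> i l; have /eqP/matrixP/(_ i ord0) := gc l.
  by rewrite !mxE => <-; apply: eq_bigr => j _; rewrite mxE.
by apply/ffunP=> l; rewrite ffunE; apply/matrixP=> i j; rewrite ord1 !mxE.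
Qed.

Lemma fixnum_gt0 g : (0 < fixnum g)%N.
Proof. by apply/card_gt0P; exists 0; rewrite inE mulmx0. Qed.

(** The inverse turns left multiplication into a right action, the convention of the library. *)
Definition mx_act N (x : 'M[A]_(n, N)) g : 'M[A]_(n, N) := umx g^-1%g *m x.

Lemma mx_act_is_action N : is_action [set: U] (@mx_act N).
Proof.
apply: is_total_action => [x | x g h]; first by rewrite /mx_act invg1 mul1mx.
by rewrite /mx_act invMg umxM mulmxA.
Qed.

Canonical mx_action N := Action (mx_act_is_action N).

(* Burnside: every orbit on N-tuples has a representative supported on the first 2N coordinates. *)
Lemma fixnum_moment (H : {group U}) N : T 0 \subset H -> (2 * N + 2 <= n)%N ->
  (\sum_(h in H) fixnum h ^ N <= #|A| ^ (2 * N * N) * #|H|)%N.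
Proof.
move=> TH Nn; have actsH : [acts H, on [set: 'M[A]_(n, N)] | mx_action N].
  by apply/subsetP=> g gH; rewrite !inE /=; apply/subsetP=> x _; rewrite !inE.
have := Frobenius_Cauchy actsH.
have -> : (\sum_(h in H) #|'Fix_([set: 'M[A]_(n, N)] | mx_action N)[h]%g| = \sum_(h in H) fixnum h ^ N)%N.
  apply: eq_bigr => h hH; rewrite -fixnum_mx; apply: eq_card => x.
  rewrite !inE sub1set inE /= /mx_act; apply/eqP/eqP => [hx | {1}<-]; last exact: umxKV.
  by rewrite -[in LHS]hx umxVK.
move=> ->; rewrite leq_mul2r; apply/orP; right.
pose Y := [set x : 'M[A]_(n, N) | [forall i : 'I_n, forall l, (2 * N <= i)%N ==> (x i l == 0)]].
apply: (@leq_trans #|orbit (mx_action N) H @: Y|).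
  apply/subset_leq_card/subsetP=> _ /imsetP[x _ ->].
  have [t tT tx] := move_tuple x Nn; apply/imsetP; exists (t *m x).
    rewrite inE; apply/forallP=> i; apply/forallP=> l; apply/implyP=> il; exact/eqP/tx.
  apply/esym/orbit_eqP/orbitP; exists t^-1%g; first by rewrite groupV (subsetP TH).
  by rewrite /= /mx_act invgK.
apply: leq_trans (leq_imset_card _ _) _.
pose res (x : 'M[A]_(n, N)) : 'M[A]_(2 * N, N) :=
  \matrix_(i, l) ((delta i)^h *m x) ord0 l.
rewrite -card_mx -(card_in_imset (f := res)) ?max_card // => x y.
rewrite !inE => /forallP x0 /forallP y0 /matrixP xy; apply/matrixP=> i l.
have [Ni|iN] := leqP (2 * N) i.
  by have /forallP/(_ l)/implyP/(_ Ni)/eqP-> := x0 i; have /forallP/(_ l)/implyP/(_ Ni)/eqP-> := y0 i.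
by have := xy (Ordinal iN) l; rewrite [LHS]mxE [RHS]mxE /= !(delta_form i) [LHS]mxE [RHS]mxE.
Qed.

End Counting.

(** * Moments of characters *)

Lemma char_exp_sub (gT : finGroupType) (G : {group gT}) (chi phi : 'CF(G)) k :
  chi \is a character -> phi \is a character ->
  (chi + phi) ^+ k - chi ^+ k \is a character.
Proof.
move=> Cc Cp; elim: k => [|k IHk]; first by rewrite !expr0 subrr rpred0.
have -> : (chi + phi) ^+ k.+1 - chi ^+ k.+1
        = chi * ((chi + phi) ^+ k - chi ^+ k) + phi * (chi + phi) ^+ k.
  by rewrite !exprS mulrDl mulrBr addrAC.
by apply: rpredD; apply: rpredM => //; apply: rpredX; apply: rpredD.
Qed.

Lemma char_cfdot_ge0 (gT : finGroupType) (G : {group gT}) (chi psi : 'CF(G)) :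
  chi \is a character -> psi \is a character -> 0 <= '[chi, psi].
Proof. by move=> Cc Cp; rewrite natr_ge0 ?Cnat_cfdot_char. Qed.

Lemma char_norm_le (gT : finGroupType) (G : {group gT}) (chi phi : 'CF(G)) :
  chi \is a character -> phi \is a character -> '[chi] <= '[chi + phi].
Proof.
move=> Cc Cp; rewrite cfdotDl !cfdotDr -!addrA lerDl !addr_ge0 ?char_cfdot_ge0 //.
Qed.

(** In the sum defining the norm of chi^k, only the terms from the class of [g] are kept. *)
Lemma moment_bound (gT : finGroupType) (G : {group gT}) (chi : 'CF(G)) k g : g \in G ->
  `|chi g| ^+ (2 * k) <= #|'C_G[g]%g|%:R * '[chi ^+ k].
Proof.
move=> gG; have G0 : #|G|%:R != 0 :> algC by rewrite pnatr_eq0 -lt0n cardG_gt0.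
have cl : (#|(g ^: G)%g| * #|'C_G[g]%g|)%N = #|G| by rewrite -index_cent1 mulnC Lagrange ?subsetIl.
have C0 : #|'C_G[g]%g|%:R != 0 :> algC by rewrite pnatr_eq0 -lt0n cardG_gt0.
rewrite (cfnormE (cfun_onG _)) mulrA.
have -> : #|'C_G[g]%g|%:R * #|G|%:R^-1 = #|(g ^: G)%g|%:R^-1 :> algC.
  by rewrite -cl natrM invfM mulrCA mulfV ?mulr1.
rewrite mulrC ler_pdivlMr; last by rewrite ltr0n; apply/card_gt0P; exists g; apply: class_refl.
have sub : (g ^: G)%g \subset G by rewrite class_subG.
have -> : `|chi g| ^+ (2 * k) * #|(g ^: G)%g|%:R = \sum_(h in (g ^: G)%g) `|(chi ^+ k) h| ^+ 2.
  rewrite -[#|_|]sum1_card natr_sum mulr_sumr; apply: eq_bigr => h /imsetP[y yG ->].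
  by rewrite mulr1 exp_cfunE ?groupJ // cfunJ // normrX -exprM mulnC.
rewrite [X in _ <= X](bigID (mem (g ^: G)%g)) /=.
rewrite [X in X + _](eq_bigl (mem (g ^: G)%g)) ?lerDl ?sumr_ge0 // => [h _|h].
  by rewrite exprn_ge0 ?normr_ge0.
by rewrite andb_idl //; apply: (subsetP sub).
Qed.

(** * Degree and values of one irreducible character *)

Section CharacterBound.
Variables (q : nat) (A : involRing).
Hypothesis hA : hermitian_ring q A.
Variables (n : nat) (H : {group unitary A n}).
Hypothesis HE : forall m (e u : 'M[A]_(n, m)) s, eichlerP e u s -> eichler e u s \in H.
Local Notation U := (unitary A n).
Local Notation T := (@tgroup A n).
Variable i : Iirr H.
Local Notation rG := 'Chi_i.
Local Notation d := (irr_degree (socle_of_Iirr i)).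

Lemma irr1_degree : 'chi_i 1%g = d%:R.
Proof. by rewrite -[in LHS]irrRepr cfRepr1. Qed.

Lemma degree_gt0 : (0 < d)%N.
Proof. by have := irr1_gt0 i; rewrite irr1_degree ltr0n. Qed.

Lemma tgroupH k : T k \subset H.
Proof. by apply: transv_group_sub => w c _ ww cc; apply/HE/transvP. Qed.

Lemma heis_state0 : heis_state rG 0.
Proof.
exists 0, 0, (fun _ => 1); split.
- by split; rewrite ?mulmx0 //; apply/matrixP=> -[].
- by split=> // [s t _ _|al]; [rewrite mul1r | rewrite [al]thinmx0 eqxx].
exists (const_mx 1).
  apply/matrix0Pn; exists ord0, (Ordinal degree_gt0); rewrite mxE oner_neq0 //.
move=> s _; rewrite scale1r (flatmx0 s) eichler0 ?repr_mx1 ?mulmx1 //.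
by rewrite star0 mul0mx.
Qed.

Lemma heis_dichotomy R : heis_state rG R \/
  exists r (e f : 'M[A]_(n, r)) lam (w : 'rV_d),
    [/\ (r < R)%N, hframe e f, nondeg lam, w != 0 & eigvec rG e lam w]
    /\ heis_terminal rG e f lam.
Proof.
elim: R => [|R IHR]; first by left; exact: heis_state0.
case: IHR => [IHR|[r [e [f [lam [w [[rR ef nd nw ew] term]]]]]]]; last first.
  by right; exists r, e, f, lam, w; split=> //; split=> //; apply: ltnW.
have [e [f [lam [ef nd [w nw ew]]]]] := IHR.
case: (classic (heis_terminal rG e f lam)) => [term|nterm].
  by right; exists R, e, f, lam, w; split=> //; split.
left; apply: NNPP => no; case: nterm => e0 c v pe0 ee0 cc ev fv.
apply/eqP; apply: contraT => move_v; case: no.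
exact: (heis_step hA HE ef nd pe0 ee0 cc ev fv move_v).
Qed.

Lemma degree_lower r (e f : 'M[A]_(n, r)) lam (w : 'rV_d) :
  hframe e f -> nondeg lam -> w != 0 -> eigvec rG e lam w ->
  (q ^ (r * (n - 2 * r)) <= d)%N.
Proof.
move=> ef nd nw ew.
have := leq_trans (card_perp_lower ef) (heis_lower hA HE ef nd nw ew).
by rewrite (herm_card hA) -expnM mulnC expnM leq_sqr.
Qed.

(** For an empty frame, terminality says that every transvection fixes every vector. The derived
    subgroup, being contained in T 0, then acts trivially. *)
Lemma terminal0_linear (e f : 'M[A]_(n, 0)) lam : (6 <= n)%N ->
  hframe e f -> nondeg lam -> heis_terminal rG e f lam -> 'chi_i 1%g = 1.
Proof.
move=> n6 ef [l0 _ _] term.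
have eich1 (u : 'M[A]_(n, 0)) s : eichler e u s = 1%g.
  by rewrite [e]thinmx0 [u]thinmx0 [s]thinmx0 eichler0 // star0 mul0mx.
have trivT t : t \in T 0 -> rG t = 1%:M.
  move=> tT; have tK : t \in rker rG.
    apply: subsetP t tT; apply: transv_group_sub => w c _ ww cc; rewrite inE (HE (transvP ww cc)) /=.
    apply/eqP/row_matrixP=> j; rewrite row_mul; apply: (term w c) => //.
    - by apply/perpP; rewrite [e]thinmx0 [f]thinmx0 star0 !mul0mx.
    - by move=> s _; rewrite eich1 repr_mx1 mulmx1 (flatmx0 s) l0 scale1r.
    by move=> al; rewrite eich1 repr_mx1 mulmx1.
  by case/rkerP: tK.
apply/lin_char1; rewrite lin_irr_der1.
apply: subset_trans (tgroup_der1 hA H n6) _; apply/subsetP=> t tT.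
rewrite cfkerEirr inE -irrRepr !cfunE group1 (subsetP (tgroupH 0)) // trivT // repr_mx1.
by rewrite eqxx.
Qed.

Lemma fixnumJ (g y : U) : fixnum (g ^ y)%g = fixnum g.
Proof.
pose f (u : 'cV[A]_n) := umx y^-1%g *m u.
have finj : injective f by move=> u v /(congr1 (mulmx y)); rewrite !umxVK.
rewrite /fixnum -[RHS](card_imset _ finj); apply: eq_card => u; apply/eqP/imsetP => [gu|[v /eqP gv ->]].
  exists (y *m u); last by rewrite /f umxKV.
  by rewrite inE -{2}gu conjgE !umxM -!mulmxA umxVK.
by rewrite /f conjgE !umxM -!mulmxA umxVK gv.
Qed.

(** If h^y lies in T k, then [h] fixes the first k columns of y, which leaves fixnum h ^ k choices
    for them. The y with given columns lie in one coset of fixd k. *)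
Lemma card_conj_fixd k h : h \in H -> (k + 3 <= n)%N ->
  (#|[set y in H | (h ^ y)%g \in T k]| <= fixnum h ^ k * (#|T k| * #|A| ^ 9))%N.
Proof.
move=> hH kn; pose C : 'M[A]_(n, k) := \matrix_(a < n, j < k) (a == j :> nat)%:R.
pose X := [set x : 'M[A]_(n, k) | h *m x == x].
have cX : #|X| = (fixnum h ^ k)%N.
  by rewrite -fixnum_mx; apply: eq_card => x; rewrite !inE.
rewrite -cX -sum1_card (partition_big (fun y : U => y *m C) (mem X)) /=; last first.
  move=> y; rewrite !inE => /andP[yH hT]; have := subsetP (tgroup_fixd _ _ _) _ hT.
  move/fixP; rewrite -/C conjgE !umxM -!mulmxA => /(congr1 (mulmx y)).
  by rewrite umxVK => /eqP.
rewrite -[X in (_ <= X * _)%N]sum1_card big_distrl /=; apply: leq_sum => x xX; rewrite mul1n.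
case: (pickP [pred y | (y \in [set y in H | (h ^ y)%g \in T k]) && (y *m C == x)]) => [y0|no]; last first.
  by rewrite big_pred0.
case/andP=> _ /eqP y0x; rewrite sum1_card; apply: leq_trans (card_fixd hA kn).
rewrite -[X in (_ <= X)%N](card_imset _ (mulgI y0)); apply/subset_leq_card/subsetP=> y.
move=> /andP[_ /eqP yx].
apply/imsetP; exists (y0^-1 * y)%g; last by rewrite mulKVg.
by apply/fixP; rewrite umxM -mulmxA -/C yx -y0x umxKV.
Qed.

(** The majorant is induced from a conjugate S' of T (4 r) inside S; Frobenius reciprocity makes
    chi_i a constituent. In the formula for the induced value, [card_conj_fixd] counts the nonzero
    terms, and its factor |T (4 r)| cancels against |S'|. *)
Lemma terminal_majorant r (e f : 'M[A]_(n, r)) lam (w : 'rV_d) : (4 * r + 3 <= n)%N ->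
  hframe e f -> nondeg lam -> w != 0 -> eigvec rG e lam w -> heis_terminal rG e f lam ->
  exists2 phi : 'CF(H), phi \is a character &
    forall h, h \in H -> `|('chi_i + phi) h| <= (#|A| ^ 9 * fixnum h ^ (r + 4 * r))%:R.
Proof.
move=> rn ef nd nw ew term.
have [theta [[Ctheta Cres normtheta] ntheta]] := heis_terminal_char hA HE ef nd nw ew term.
set S := transv_group (perp e f) in theta Ctheta Cres normtheta ntheta *.
(* The 2 r columns of [e] and [f] go into the first 4 r coordinates, so that vectors of supp (4 r)
   become orthogonal to them. *)
have [|t tT tef] := @move_tuple q A hA n (r + r) (row_mx e f); first by move: rn; lia.
pose k := (4 * r)%N; pose S' := (T k :^ t)%G.
have te (z : 'cV[A]_n) : z \in supp k -> umx t^-1%g *m z \in perp e f.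
  move=> /suppP kz.
  have ortho (x : 'M[A]_(n, r)) : (forall (a : 'I_n) l, (k <= a)%N -> (t *m x) a l = 0) ->
      x^h *m (umx t^-1%g *m z) = 0.
    move=> x0; rewrite -(umx_form t x) umxVK; apply/matrixP=> a b; rewrite !mxE big1 // => c _.
    rewrite starE; have [kc|ck] := leqP k c; first by rewrite x0 // rmorph0 mul0r.
    by rewrite ord1 kz // mulr0.
  apply/perpP; rewrite mul_mx_row in tef; split; apply: ortho => a l ka.
    by have := tef a (lshift r l); rewrite row_mxEl; apply; move: ka; rewrite /k; lia.
  by have := tef a (rshift r l); rewrite row_mxEr; apply; move: ka; rewrite /k; lia.
have S'S : S' \subset S.
  rewrite /= -genJ gen_subG; apply/subsetP=> _ /imsetP[x xS ->].
  move: xS; rewrite inE => /existsP[z /existsP[c /and4P[kz /eqP zz /eqP cc /eqP->]]].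
  have := transvJ t^-1%g zz cc; rewrite invgK conjgE mulgA => ->.
  by apply: mem_transv_group => //; [apply: te | rewrite umx_form].
have SH : S \subset H by apply: transv_group_sub => z c _ zz cc; apply/HE/transvP.
have S'H := subset_trans S'S SH.
pose tau := 'Res[S'] theta; have Ctau : tau \is a character by apply: cfRes_char.
have Cres' : 'Res[S'] 'chi_i - tau \is a character.
  rewrite /tau -(cfResRes _ S'S SH) -raddfB; apply: cfRes_char.
  by rewrite -irrRepr.
have iInd : i \in irr_constt ('Ind[H] tau).
  rewrite irr_consttE -cfdot_Res_r -(subrK tau ('Res[S'] 'chi_i)) cfdotDr.
  rewrite lt0r_neq0 // ltr_wpDl ?char_cfdot_ge0 // cfnorm_gt0.
  by apply: contraNneq ntheta => tau0; rewrite -(char1_eq0 Ctheta) -(cfRes1 S') -/tau tau0 cfunE.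
have [phi Cphi indE] := constt_charP i (cfInd_char H Ctau) iInd.
exists phi => // h hH; rewrite -indE cfIndE //.
have F1 : 1 <= (fixnum h)%:R :> algC by rewrite ler1n fixnum_gt0.
have tau_le x : x \in S' -> `|tau x| <= (fixnum x ^ r)%:R.
  move=> xS'; have xS := subsetP S'S x xS'.
  have Fx : 1 <= (fixnum x ^ r)%:R :> algC by rewrite ler1n expn_gt0 fixnum_gt0.
  rewrite -(@ler_pXn2r _ 2) ?nnegrE ?normr_ge0 ?ler0n // /tau cfResE // normtheta //.
  apply: (@le_trans _ _ (fixnum x ^ r)%:R); last by rewrite expr2 ler_peMl ?ler0n.
  by rewrite ler_nat -fixnum_mx; apply/subset_leq_card/subsetP=> u; rewrite !inE => /andP[].
have S'card : #|S'| = #|T k| by rewrite cardJg.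
rewrite normrM normfV normr_nat mulrC ler_pdivrMr ?ltr0n ?cardG_gt0 //.
apply: (le_trans (ler_norm_sum _ _ _)).
rewrite (bigID (fun y : U => (h ^ y)%g \in S')) /= [X in _ + X]big1 ?addr0; last first.
  by move=> y /andP[yH nS]; rewrite cfun0 ?normr0.
apply: (@le_trans _ _ (\sum_(y in H | (h ^ y)%g \in S') (fixnum h ^ r)%:R)).
  by apply: ler_sum => y /andP[yH yS]; rewrite -(fixnumJ h y) tau_le.
rewrite sumr_const -[_ *+ _]mulr_natr -!natrM ler_nat.
have card_le : (#|[pred y in H | (h ^ y)%g \in S']| <= fixnum h ^ k * (#|T k| * #|A| ^ 9))%N.
  apply: leq_trans (card_conj_fixd hH rn).
  rewrite -[X in (X <= _)%N](card_imset _ (mulIg t^-1%g)); apply/subset_leq_card/subsetP=> _ /imsetP[y /andP[yH yS] ->].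
  have tH := subsetP (tgroupH 0) _ tT.
  rewrite inE groupM ?groupV //= conjgM.
  by rewrite -mem_conjg.
rewrite S'card; apply: (leq_trans (leq_mul (leqnn _) card_le)).
rewrite expnD -/k; move: (fixnum h ^ r)%N (fixnum h ^ k)%N (#|A| ^ 9)%N #|T k| => a b c m.
by apply: eq_leq; ring.
Qed.

(** The exponents are 2 j times those of the majorant: 18 j = 2 j * 9 for |A| and N = 10 r j = 2 j *
    5 r for [fixnum], whose N-th moment costs |A|^(2 N^2). The norm of chi_i ^+ j is at most that of
    the j-th power of the majorant. *)
Lemma terminal_bound r (e f : 'M[A]_(n, r)) lam (w : 'rV_d) j g :
  (4 * r + 3 <= n)%N -> (2 * (10 * r * j) + 2 <= n)%N ->
  hframe e f -> nondeg lam -> w != 0 -> eigvec rG e lam w -> heis_terminal rG e f lam ->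
  g \in H ->
  `|'chi_i g| ^+ (2 * j)
    <= (#|'C_H[g]%g| * #|A| ^ (18 * j + 2 * (10 * r * j) * (10 * r * j)))%:R.
Proof.
move=> rn jn ef nd nw ew term gH.
have [phi Cphi psi_le] := terminal_majorant rn ef nd nw ew term.
apply: (le_trans (moment_bound _ _ gH)); rewrite natrM ler_wpM2l ?ler0n //.
have Cchi := irr_char i.
have Cexp : 'chi_i ^+ j \is a character by apply: rpredX.
have := char_norm_le Cexp (char_exp_sub j Cchi Cphi).
rewrite addrC subrK => /le_trans; apply.
rewrite (cfnormE (cfun_onG _)) mulrC ler_pdivrMr ?ltr0n ?cardG_gt0 //.
apply: (@le_trans _ _ (\sum_(h in H) (#|A| ^ (18 * j) * fixnum h ^ (10 * r * j))%:R)).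
  apply: ler_sum => h hH; rewrite exp_cfunE // normrX -exprM.
  apply: (le_trans (lerXn2r _ _ _ (psi_le h hH))); rewrite ?nnegrE ?normr_ge0 ?ler0n //.
  rewrite -natrX ler_nat expnMn -!expnM; apply: eq_leq.
  by congr (_ ^ _ * _ ^ _)%N; lia.
rewrite -natr_sum -natrM ler_nat -big_distrr /= expnD -[X in (_ <= X)%N]mulnA leq_mul2l.
apply/orP; right.
exact: (fixnum_moment hA (tgroupH 0) jn).
Qed.

Lemma degree_state R : heis_state rG R -> (q ^ (R * (n - 2 * R)) <= d)%N.
Proof. by case=> e [f [lam [ef nd [w nw ew]]]]; apply: (degree_lower ef nd nw ew). Qed.

End CharacterBound.

(** With this j, |chi(g)|^(2 j) is the power 2 (c + 1) of |chi(g)|^(2^m). A bound q^(c n + B) with B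
    <= n is then at most q^((c + 1) n), which a degree of at least q^(n / 2) absorbs. *)
Definition moment_order c m := (2 ^ m * c.+1)%N.
(** The exponent of q lost in [terminal_bound] for r up to 2^m c; the outer factor 2 comes from |A|
    = q^2. *)
Definition moment_cost c m :=
  let j := moment_order c m in let N := (10 * (2 ^ m * c) * j)%N in
  (2 * (18 * j + 2 * N * N))%N.
Definition rank_threshold c m :=
  (4 * (2 ^ m * c) + 2 * (10 * (2 ^ m * c) * moment_order c m) + moment_cost c m + 6)%N.

Theorem unitary_character_bound q (A : involRing) n (H : {group unitary A n}) c m (i : Iirr H) g :
  hermitian_ring q A ->
  (forall m (e u : 'M[A]_(n, m)) s, eichlerP e u s -> eichler e u s \in H) ->
  (rank_threshold c m <= n)%N -> g \in H -> (#|'C_H[g]%g| <= q ^ (c * n))%N ->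
  `|'chi_i g| ^+ (2 ^ m) <= 'chi_i 1%g.
Proof.
move=> hA HE; rewrite /rank_threshold; set R := (2 ^ m * c)%N; set j := moment_order c m.
move=> nlarge gH Cg; have M0 : (0 < 2 ^ m)%N by rewrite expn_gt0.
have q1 := herm_q_gt1 hA; have q0 : (0 < q)%N by apply: ltnW.
have a0 : 0 <= `|'chi_i g| by apply: normr_ge0.
have root_le N (b : nat) (x : nat) : (0 < N)%N ->
    (`|'chi_i g| ^+ (2 ^ m)) ^+ N <= x%:R -> (x <= b ^ N)%N -> `|'chi_i g| ^+ (2 ^ m) <= b%:R.
  move=> N0 ax xb; rewrite -(@ler_pXn2r _ N) ?nnegrE ?exprn_ge0 ?ler0n //.
  by apply: (le_trans ax); rewrite -natrX ler_nat.
have n6 : (6 <= n)%N by move: nlarge; lia.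
have Rn : (4 * R <= n)%N by move: nlarge; lia.
(* At rank R = 2^m c the degree d is at least q^(R n / 2), because 4 R <= n. Then |chi(g)|^2 <= q^(c
   n), raised to the power 2^m, gives q^(R n) <= d^2. *)
have [st|[r [e [f [lam [w [[rR ef nd nw ew] term]]]]]]] := heis_dichotomy hA HE i R.
  have dl := degree_state hA HE st; rewrite irr1_degree.
  apply: (root_le 2%N _ ((q ^ (c * n)) ^ (2 ^ m))%N) => //.
    rewrite exprAC natrX ler_pXn2r ?nnegrE ?exprn_ge0 ?ler0n //.
    have := moment_bound 'chi_i 1 gH; rewrite expr1 cfnorm_irr mulr1 muln1 => /le_trans; apply.
    by rewrite ler_nat.
  apply: (@leq_trans ((q ^ (R * (n - 2 * R))) ^ 2)); last by rewrite leq_sqr.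
  rewrite -!expnM leq_pexp2l //.
  have -> : (c * n * 2 ^ m = R * n)%N by rewrite /R; ring.
  by rewrite -mulnA leq_mul2l; apply/orP; right; move: Rn; lia.
have [r0|r1] := posnP r.
  have chi1 : 'chi_i 1%g = 1.
    move: e f lam ef nd ew term; rewrite r0 => e f lam ef nd ew term.
    exact: (terminal0_linear hA HE n6 ef nd term).
  rewrite chi1 exprn_ile1 //; have := char1_ge_norm g (irr_char i).
  by rewrite chi1.
have dl := degree_lower hA HE ef nd nw ew; rewrite irr1_degree.
pose N0 := (10 * R * j)%N; pose N1 := (10 * r * j)%N.
have N10 : (N1 <= N0)%N by rewrite /N1 /N0 !leq_mul // ltnW.
have rn : (4 * r + 3 <= n)%N by move: nlarge rR; lia.
have jn : (2 * N1 + 2 <= n)%N by move: nlarge N10; rewrite -/N0; lia.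
have bound := terminal_bound hA HE rn jn ef nd nw ew term gH.
pose B := (2 * (18 * j + 2 * N1 * N1))%N.
have Bn : (B <= n)%N.
  apply: (@leq_trans (moment_cost c m)); last by move: nlarge; lia.
  have -> : moment_cost c m = (2 * (18 * j + 2 * N0 * N0))%N by [].
  by rewrite leq_pmul2l // leq_add2l leq_mul // leq_pmul2l.
apply: (root_le (2 * c.+1)%N _ (q ^ (c * n + B))%N) => //.
  rewrite -exprM (_ : 2 ^ m * (2 * c.+1) = 2 * j)%N; last by rewrite /j /moment_order; ring.
  apply: (le_trans bound); rewrite ler_nat (herm_card hA) -expnM expnD leq_mul //.
apply: (@leq_trans ((q ^ (r * (n - 2 * r))) ^ (2 * c.+1))); last by rewrite leq_exp2r.
rewrite -expnM leq_pexp2l //; apply: (@leq_trans (c.+1 * n)); first by rewrite mulSn addnC leq_add2r.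
have -> : (r * (n - 2 * r) * (2 * c.+1) = c.+1 * (r * (2 * (n - 2 * r))))%N.
  by move: (n - 2 * r)%N => x; ring.
rewrite leq_pmul2l //; apply: (@leq_trans (2 * (n - 2 * r))).
  by move: Rn rR; lia.
by rewrite leq_pmull.
Qed.

(** * Linear and unitary groups over finite fields *)

(** D is the full linear or unitary group, where the centraliser is measured even when G is its
    special subgroup. *)
Lemma unitary_transport q (A : involRing) n (gT : finGroupType) (G D : {group gT})
    (f : gT -> unitary A n) c m (i : Iirr G) g :
  hermitian_ring q A -> G \subset D ->
  {in G &, {morph f : x y / (x * y)%g}} -> {in G &, injective f} ->
  (forall m (e u : 'M[A]_(n, m)) s, eichlerP e u s -> exists2 x, x \in G & f x = eichler e u s) ->
  (rank_threshold c m <= n)%N -> g \in G -> (#|'C_D[g]%g| <= q ^ (c * n))%N ->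
  `|'chi_i g| ^+ (2 ^ m) <= 'chi_i 1%g.
Proof.
move=> hA GD fM finj fE nlarge gG Cg.
pose F := Morphism fM; have injF : ('injm F)%g by apply/injmP.
have isoF : isom G (F @* G)%g F by apply/isomP.
have HE k (e u : 'M[A]_(n, k)) s : eichlerP e u s -> eichler e u s \in (F @* G)%G.
  by move=> /fE[x xG <-]; apply: (mem_morphim F).
have := @unitary_character_bound q A n (F @* G)%G c m (isom_Iirr isoF i) (F g) hA HE nlarge.
rewrite isom_IirrE -(morph1 F) !cfIsomE ?group1 //; apply; first exact: mem_morphim.
rewrite -(injm_subcent1 injF) // card_injm ?subsetIl //.
by apply: leq_trans Cg; apply/subset_leq_card/setSI.
Qed.

Section EichlerOrder.
Variables (A : involRing) (n m p : nat).
Hypothesis pA : p%:R = 0 :> A.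

Lemma eichler_exp (e u : 'M[A]_(n, m)) s k : eichlerP e u s ->
  exists2 s', eichlerP e (k%:R *: u) s' & (eichler e u s ^+ k)%g = eichler e (k%:R *: u) s'.
Proof.
move=> Pu; have [ee _ _] := Pu; elim: k => [|k [s' Ps' IHk]].
  exists 0; rewrite scale0r; last by rewrite expg0 eichler0.
  by apply: eichlerP0; rewrite // star0 oppr0.
have -> : k.+1%:R *: u = u + k%:R *: u by rewrite -natr1 scalerDl scale1r addrC.
exists (s + s' - u^h *m (k%:R *: u)); first exact: eichlerP_D.
by rewrite expgS -(eichlerM Pu Ps') -IHk.
Qed.

(** The p-th power kills [u] and so is central in the Heisenberg group; a second p-th power kills
    the central part. *)
Lemma eichler_exp_char (e u : 'M[A]_(n, m)) s : eichlerP e u s -> (eichler e u s ^+ (p * p))%g = 1%g.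
Proof.
move=> Pu; have [ee _ _] := Pu; have [s' Ps'] := eichler_exp p Pu.
rewrite pA scale0r in Ps' * => E1.
suff H k : eichler e 0 (k%:R *: s') = (eichler e 0 s' ^+ k)%g.
  by rewrite expgM E1 -H pA scale0r eichler0.
have ss : s'^h = - s'.
  by have [_ _] := Ps'; rewrite mulmx0 oppr0 addrC => /eqP; rewrite addr_eq0 => /eqP.
elim: k => [|k IHk]; first by rewrite scale0r eichler0 // expg0.
have Pk : eichlerP e 0 (k%:R *: s') by apply: eichlerP0 => //; rewrite starZ rmorph_nat ss scalerN.
have -> : k.+1%:R *: s' = s' + k%:R *: s' by rewrite -natr1 scalerDl scale1r addrC.
rewrite expgS -IHk; apply/esym; have := eichlerM Ps' Pk.
by rewrite mulmx0 subr0 addr0.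
Qed.
End EichlerOrder.

Section FrobeniusRing.
Variables (F : finFieldType) (p k : nat).
Hypotheses (p_pr : prime p) (k_gt0 : (0 < k)%N).
Let q := (p ^ k)%N.
Hypothesis cardF : #|F| = (q ^ 2)%N.

Let q_gt1 : (1 < q)%N. Proof. by rewrite -(exp1n k) ltn_exp2r ?prime_gt1. Qed.

Let pcharF : p \in [pchar F].
Proof. by apply: (@card_finPcharP _ _ (k * 2)); rewrite // expnM. Qed.

Definition frobq (x : F) : F := x ^+ (p ^ k).

Fact frobq_zmod : zmod_morphism frobq.
Proof.
move=> x y; apply/eqP; rewrite -subr_eq opprK /frobq -exprDn_pchar ?subrK //.
by rewrite pnatX pnatE // pcharF.
Qed.

Fact frobq_monoid : monoid_morphism frobq.
Proof. by split; rewrite /frobq ?expr1n // => x y; rewrite exprMn. Qed.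

HB.instance Definition _ := GRing.isZmodMorphism.Build F F frobq frobq_zmod.
HB.instance Definition _ := GRing.isMonoidMorphism.Build F F frobq frobq_monoid.

Fact frobqK : involutive frobq.
Proof. by move=> x; rewrite /frobq -exprM mulnn -cardF expf_card. Qed.

Definition frob_ring : involRing := @InvolRing F frobq frobqK.

Lemma frobqE x : invol frob_ring x = x ^+ q. Proof. by []. Qed.

Let q0 : (0 < q)%N. Proof. exact: ltnW. Qed.

(* A polynomial x^q - a x cannot vanish on the whole field, which has q^2 elements. *)
Lemma exists_not_frob (a : F) : exists x, x ^+ q != a * x.
Proof.
apply/existsP; apply: contraT; rewrite negb_exists => /forallP all0.
pose P : {poly F} := 'X^q - a *: 'X.
have nP : P != 0.
  apply/eqP => /(congr1 (fun Q : {poly F} => Q`_q)); rewrite coefB coefXn eqxx coefZ coefX coef0.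
  by rewrite gtn_eqF // mulr0 subr0 => /eqP; rewrite oner_eq0.
have sz : (size P <= q.+1)%N.
  rewrite (leq_trans (size_polyD _ _)) // geq_max size_polyXn leqnn size_polyN.
  by rewrite (leq_trans (size_scale_leq _ _)) // size_polyX ltnS.
have := max_poly_roots nP _ (enum_uniq F); rewrite -cardE cardF => H.
have {}H : (q ^ 2 < q.+1)%N.
  apply: leq_trans sz; apply: H; apply/allP => x _; rewrite /root !hornerE subr_eq0.
  by have := all0 x; rewrite negbK.
by move: H; rewrite ltnS -{2}(expn1 q) leq_exp2l.
Qed.

Lemma frob_hermitian : hermitian_ring q frob_ring.
Proof.
have skewU : exists2 c : F, c != 0 & exists x : F, c = x - x ^+ q.
  have [x nx] := exists_not_frob 1; exists (x - x ^+ q); last by exists x.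
  by rewrite subr_eq0 eq_sym; rewrite mul1r in nx.
have skew0 (c x : F) : c = x - x ^+ q -> frobq c = - c.
  by move=> ->; rewrite rmorphB /= -[frobq (x ^+ q)]/(frobq (frobq x)) frobqK opprB.
split=> //.
(* In every characteristic (-1)^(q - 1) = 1. Writing -1 = z^a with z primitive, this forces q + 1 to
   divide a, and -1 is the norm of z^(a / (q + 1)). *)
- have [z primz] : exists z : F, (q ^ 2).-1.-primitive_root z.
    pose rs := [seq x <- enum F | x != 0].
    have : has (q ^ 2).-1.-primitive_root rs.
      have nz0 : (0 < (q ^ 2).-1)%N by rewrite -subn1 subn_gt0 -(exp1n 2) ltn_sqr.
      have uniq_rs : uniq rs by apply/filter_uniq/enum_uniq.
      apply: has_prim_root => //.
        apply/allP=> x; rewrite mem_filter => /andP[nx _]; rewrite unity_rootE -cardF.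
        rewrite -(inj_eq (mulfI nx)) -exprS prednK ?mulr1 ?expf_card //.
        by apply/card_gt0P; exists x.
      rewrite -(card_uniqP uniq_rs) -cardF -(cardC1 (0 : F)).
      by apply/eq_leq/eq_card => x; rewrite mem_filter mem_enum !inE andbT.
    by case/hasP=> z _; exists z.
  have m1 : (-1 : F) ^+ q.-1 = 1.
    have := frobq_monoid; have : frobq (-1) = -1 by rewrite rmorphN rmorph1.
    rewrite /frobq -/q -(prednK q0) exprS mulN1r => /eqP; rewrite eqr_opp => /eqP.
    by [].
  have : (-1 : F) ^+ (q ^ 2).-1 = 1.
    have -> : ((q ^ 2).-1 = q.-1 * q.+1)%N by rewrite -!subn1 -[q.+1]addn1 -subn_sqr exp1n.
    by rewrite exprM m1 expr1n.
  case/(prim_rootP primz) => -[a alt] /= aE {alt}.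
  have : (q.+1 %| a)%N.
    have : ((q ^ 2).-1 %| a * q.-1)%N by rewrite (prim_order_dvd primz) exprM -aE m1.
    have -> : ((q ^ 2).-1 = q.+1 * q.-1)%N.
      by rewrite mulnC -!subn1 -[q.+1]addn1 -subn_sqr exp1n.
    by rewrite dvdn_pmul2r // -subn1 subn_gt0.
  case/dvdnP=> b ab; exists (z ^+ b); rewrite frobqE -exprS -exprM -ab; exact: esym.
(* Any x of nonzero trace, divided by its trace, has trace 1. *)
- have [x nx] := exists_not_frob (-1); rewrite mulN1r in nx.
  have nt : x + x ^+ q != 0 by rewrite addrC addr_eq0.
  exists (x / (x + x ^+ q)).
  have tt : frobq (x + x ^+ q) = x + x ^+ q.
    by rewrite rmorphD /= -[frobq (x ^+ q)]/(frobq (frobq x)) frobqK addrC.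
  by rewrite /= fmorph_div /= tt -mulrDl -[frobq x]/(x ^+ q) mulfV.
- have [c nc [x cx]] := skewU; exists c, c^-1; [exact: skew0 cx | exact: mulfV].
(* The ratio of two skew elements is fixed by the involution, so multiplying c0 = x - x^q by c / c0
   keeps its shape. *)
- move=> y c ny cc; have [c0 nc0 [x c0x]] := skewU; exists (c / c0 * x / y).
  have fix_a : frobq (c / c0) = c / c0.
    by rewrite fmorph_div /= (skew0 _ _ c0x) [frobq c]cc invrN mulrNN.
  rewrite [y * _]mulrC divfK // /= rmorphM /= fix_a -mulrBr -[frobq x]/(x ^+ q) -c0x divfK //.
by left => x nx; exists x^-1; apply: mulfV.
Qed.

End FrobeniusRing.

Section SwapRing.
Variable F : finFieldType.

Definition swap_sort := (F * F)%type.
HB.instance Definition _ := GRing.ComNzRing.on swap_sort.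
HB.instance Definition _ := Finite.on swap_sort.

Definition swap (x : swap_sort) : swap_sort := (x.2, x.1).

Fact swap_zmod : zmod_morphism swap. Proof. by []. Qed.
Fact swap_monoid : monoid_morphism swap. Proof. by []. Qed.
HB.instance Definition _ := GRing.isZmodMorphism.Build swap_sort swap_sort swap swap_zmod.
HB.instance Definition _ := GRing.isMonoidMorphism.Build swap_sort swap_sort swap swap_monoid.

Fact swapK : involutive swap. Proof. by case. Qed.

Definition swap_ring : involRing := @InvolRing swap_sort swap swapK.

Lemma swap_hermitian : hermitian_ring #|F| swap_ring.
Proof.
split.
- by rewrite (cardD1 0) (cardD1 1) !inE oner_neq0.
- by rewrite card_prod mulnn.
- exists ((-1, 1) : swap_sort); congr pair; rewrite /= ?mulr1 ?mul1r //.
- exists ((1, 0) : swap_sort); congr pair; rewrite /= ?addr0 ?add0r //.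
- exists ((1, -1) : swap_sort); exists ((1, -1) : swap_sort); congr pair; rewrite /= ?opprK ?mulr1 ?mulrNN ?mulr1 //.
- move=> [y1 y2] [c1 c2] ny [c2E c1E]; have {}c2E : c2 = - c1 by [].
  have [y10|ny1] := eqVneq y1 0.
    have ny2 : y2 != 0 by apply: contraNneq ny => y20; rewrite y10 y20.
    exists (0, c2 / y2); congr pair; rewrite /= mulr0.
      by rewrite sub0r mulrC divfK // c2E opprK.
    by rewrite subr0 mulrC divfK.
  exists (c1 / y1, 0); congr pair; rewrite /= mulr0.
    by rewrite subr0 mulrC divfK.
  by rewrite sub0r mulrC divfK.
right; exists (1, 0); split.
- by congr pair; rewrite /= ?mulr0 ?mul0r.
- by congr pair; rewrite /= ?addr0 ?add0r.
move=> [x1 x2] nx; have nx1 : x1 != 0.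
  by apply: contraNneq nx => ->; rewrite /eq_op /= mulr0 mul0r !eqxx.
by exists (x1^-1, 0); congr pair; rewrite /= ?mul1r ?mulfV ?mul0r.
Qed.

End SwapRing.

Section LinearGroups.
Variables (F : finFieldType) (p : nat).
Hypothesis pcharF : p \in [pchar F].

(** In characteristic p, (det g - 1)^(p^2) = det(g)^(p^2) - 1 = 0. *)
Lemma det_pexp_eq1 n (g : {'GL_n[F]}) : (g ^+ (p * p))%g = 1%g -> \det (GLval g) = 1.
Proof.
move=> gp.
have detX k : \det (GLval (g ^+ k)%g) = \det (GLval g) ^+ k.
  elim: k => [|k IHk]; first by rewrite expg0 expr0 det1.
  by rewrite expgS exprS -IHk -det_mulmx.
have frobB x : (x - 1) ^+ p = x ^+ p - 1 :> F.
  by rewrite -!(pFrobenius_autE pcharF) rmorphB rmorph1.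
have : (\det (GLval g) - 1) ^+ (p * p) = 0.
  by rewrite exprM !frobB -exprM -detX gp det1 subrr.
by move/eqP; rewrite expf_eq0 subr_eq0 => /andP[_ /eqP].
Qed.

Lemma mem_SLe eps n q (g : {'GL_n[F]}) : g \in GLe eps n F q ->
  (g ^+ (p * p))%g = 1%g -> g \in SLe eps n F q.
Proof.
move=> gG gp; rewrite inE gG /= mem_gen // inE; apply/eqP; exact: det_pexp_eq1.
Qed.

End LinearGroups.

Lemma GLval_surj (F : finFieldType) n (M N : 'M[F]_n.-1.+1) :
  N *m M = 1%:M -> exists g : {'GL_n[F]}, GLval g = M.
Proof.
move=> NM; have uM : M \in unitmx by case/mulmx1_unit: NM.
by exists (FinRing.Unit uM).
Qed.

(* Eichler elements satisfy x^(p^2) = 1, so they have determinant 1 and a map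
   onto the unitary group sends elements of SL onto them. *)
Lemma linear_group_bound (F : finFieldType) p q r n eps (sl : bool) (A : involRing)
    (f : {'GL_n[F]} -> unitary A n.-1.+1) c m
    (G := if sl then SLe eps n F r else GLe eps n F r) (i : Iirr G) g :
  p \in [pchar F] -> p%:R = 0 :> A -> hermitian_ring q A ->
  {in GLe eps n F r &, {morph f : x y / (x * y)%g}} ->
  {in GLe eps n F r &, injective f} ->
  (forall y : unitary A n.-1.+1, exists2 x, x \in GLe eps n F r & f x = y) ->
  (rank_threshold c m <= n)%N -> g \in G ->
  (#|'C_(GLe eps n F r)[g]%g| <= q ^ (c * n))%N ->
  `|'chi_i g| ^+ (2 ^ m) <= 'chi_i 1%g.
Proof.
move=> pF pA hA fM finj fsurj nlarge.
have n_gt0 : (0 < n)%N by rewrite (leq_trans _ nlarge) ?addn_gt0 ?orbT.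
have sGD : G \subset GLe eps n F r by rewrite /G; case: (sl) => //; apply: subsetIl.
move=> gG; rewrite -[X in (_ * X)%N](prednK n_gt0).
move=> Cg; apply: (@unitary_transport q A n.-1.+1 _ G (GLe eps n F r) f c m i g hA sGD _ _ _ _ gG Cg).
- by move=> x y /(subsetP sGD) ? /(subsetP sGD) ?; apply: fM.
- by move=> x y /(subsetP sGD) ? /(subsetP sGD) ?; apply: finj.
- move=> k e u s Pu; have [x xD fx] := fsurj (eichler e u s); exists x => //.
  rewrite /G; case: (sl) => //; apply: (mem_SLe pF) => //.
  have f1 : f 1%g = 1%g.
    by apply: (mulgI (f 1%g)); rewrite -fM ?group1 // !mulg1.
  apply: finj; rewrite ?groupX ?group1 // f1 -(eichler_exp_char pA Pu) -fx.
  elim: (p * p)%N => [|j IHj]; first by rewrite !expg0.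
  by rewrite !expgS fM ?groupX // IHj.
by rewrite prednK.
Qed.

(** * The groups GU and SU *)

Section UnitaryCase.
Variables (F : finFieldType) (p k n : nat).
Hypotheses (p_pr : prime p) (k_gt0 : (0 < k)%N) (cardF : #|F| = ((p ^ k) ^ 2)%N).
Local Notation A := (frob_ring p_pr cardF).
Local Notation G := (GLe false n F (p ^ k)).

Definition GU_map (g : {'GL_n[F]}) : unitary A n.-1.+1 :=
  insubd (1%g : unitary A n.-1.+1) (GLval g : 'M[A]_n.-1.+1).

Lemma mem_GU_set (g : {'GL_n[F]}) : (g \in GU_set n F (p ^ k)) =
  ((GLval g : 'M[A]_n.-1.+1)^h *m (GLval g : 'M[A]_n.-1.+1) == 1%:M).
Proof. by rewrite inE. Qed.

Lemma GU_group_set : group_set (GU_set n F (p ^ k)).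
Proof.
apply/group_setP; split=> [|g h]; first by rewrite mem_GU_set star1 mulmx1.
have unitaryM (M N : 'M[A]_n.-1.+1) : M^h *m M = 1%:M -> N^h *m N = 1%:M ->
    (M *m N)^h *m (M *m N) = 1%:M.
  by move=> MM NN; rewrite starM -mulmxA (mulmxA M^h) MM mul1mx.
by rewrite !mem_GU_set => /eqP gg /eqP hh; apply/eqP; apply: (unitaryM _ _ gg hh).
Qed.

Lemma GUeE : G = GU_set n F (p ^ k) :> {set _}.
Proof. by rewrite /= -[X in <<X>>%g]/(gval (Group GU_group_set)) genGid. Qed.

Lemma umx_GU_map g : g \in G -> umx (GU_map g) = GLval g.
Proof.
rewrite GUeE mem_GU_set => gg.
by rewrite /GU_map -[LHS]/(val _) val_insubd gg.
Qed.

Lemma GU_bound (sl : bool) c m (H := if sl then SLe false n F (p ^ k) else G) (i : Iirr H) g :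
  (rank_threshold c m <= n)%N -> g \in H -> (#|'C_G[g]%g| <= (p ^ k) ^ (c * n))%N ->
  `|'chi_i g| ^+ (2 ^ m) <= 'chi_i 1%g.
Proof.
have pF : p \in [pchar F] by apply: (@card_finPcharP _ _ (k * 2)); rewrite // expnM.
apply: (@linear_group_bound F p (p ^ k) (p ^ k) n false sl A GU_map c m i g) => //.
- exact: pcharf0.
- exact: frob_hermitian.
- move=> x y xG yG; apply: umx_inj.
  by rewrite umx_GU_map ?groupM // umxM !umx_GU_map.
- move=> x y xG yG /(congr1 (@umx _ _)); rewrite !umx_GU_map //; exact: val_inj.
move=> y; have [x xy] : exists x : {'GL_n[F]}, GLval x = umx y.
  exact: (@GLval_surj _ _ _ (umx y)^h (umxP y)).
have xG : x \in G by rewrite GUeE mem_GU_set xy; apply/eqP/umxP.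
by exists x => //; apply: umx_inj; rewrite umx_GU_map.
Qed.

End UnitaryCase.

(** * The groups GL and SL *)

Section SwapCase.
Variables (F : finFieldType) (p k n : nat).
Hypotheses (p_pr : prime p) (cardF : #|F| = (p ^ k)%N).
Local Notation A := (swap_ring F).

Definition pairmx a b (M N : 'M[F]_(a, b)) : 'M[A]_(a, b) :=
  \matrix_(i, j) ((M i j, N i j) : swap_sort F).

Lemma pairmxM a b d (M N : 'M[F]_(a, b)) (M' N' : 'M[F]_(b, d)) :
  pairmx M N *m pairmx M' N' = pairmx (M *m M') (N *m N').
Proof.
apply/matrixP=> i j; rewrite !mxE [LHS]surjective_pairing; congr pair.
  by rewrite (raddf_sum (@fst F F)); apply: eq_bigr => l _; rewrite !mxE.
by rewrite (raddf_sum (@snd F F)); apply: eq_bigr => l _; rewrite !mxE.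
Qed.

Lemma star_pairmx a b (M N : 'M[F]_(a, b)) : (pairmx M N)^h = pairmx N^T M^T.
Proof. by apply/matrixP=> i j; rewrite starE !mxE. Qed.

Lemma pairmx1 a : pairmx 1%:M 1%:M = 1%:M :> 'M[A]_a.
Proof. by apply/matrixP=> i j; rewrite !mxE; case: eqP. Qed.

Lemma pairmx_inj a b (M N M' N' : 'M[F]_(a, b)) : pairmx M N = pairmx M' N' -> M = M' /\ N = N'.
Proof. by move=> E; split; apply/matrixP=> i j; have /matrixP/(_ i j) := E; rewrite !mxE => -[]. Qed.

Lemma pairmx_surj a b (P : 'M[A]_(a, b)) : exists M N, P = pairmx M N.
Proof.
exists (\matrix_(i, j) (P i j : F * F).1), (\matrix_(i, j) (P i j : F * F).2).
by apply/matrixP=> i j; rewrite !mxE; case: (P i j).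
Qed.

(** Over F x F with the swap, a pair (M, N) is unitary exactly when N^T M = 1, so the unitary group
    consists of the pairs of g and its inverse transpose. *)
Definition GL_map (g : {'GL_n[F]}) : unitary A n.-1.+1 :=
  insubd (1%g : unitary A n.-1.+1) (pairmx (GLval g) (GLval g^-1%g)^T).

Lemma umx_GL_map g : umx (GL_map g) = pairmx (GLval g) (GLval g^-1%g)^T.
Proof.
rewrite /GL_map -[LHS]/(val _) val_insubd star_pairmx pairmxM trmxK -trmx_mul.
have gg : GLval g^-1%g *m GLval g = 1%:M by rewrite -[_ *m _]/(GLval (g^-1 * g)%g) mulVg.
by rewrite gg trmx1 pairmx1 eqxx.
Qed.

Lemma GL_bound (sl : bool) c m
    (H := if sl then SLe true n F (p ^ k) else GLe true n F (p ^ k)) (i : Iirr H) g :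
  (rank_threshold c m <= n)%N -> g \in H ->
  (#|'C_(GLe true n F (p ^ k))[g]%g| <= (p ^ k) ^ (c * n))%N ->
  `|'chi_i g| ^+ (2 ^ m) <= 'chi_i 1%g.
Proof.
have pF : p \in [pchar F] by apply: card_finPcharP cardF p_pr.
apply: (@linear_group_bound F p (p ^ k) (p ^ k) n true sl A GL_map c m i g) => //.
- rewrite [LHS]surjective_pairing -[0]/((0, 0) : F * F); congr pair.
    by rewrite (raddfMn (@fst F F)) /= pcharf0.
  by rewrite (raddfMn (@snd F F)) /= pcharf0.
- by rewrite -cardF; apply: swap_hermitian.
- move=> x y _ _; apply: umx_inj.
  rewrite umxM !umx_GL_map pairmxM invMg; congr pairmx.
  by rewrite -trmx_mul.
- move=> x y _ _ /(congr1 (@umx _ _)); rewrite !umx_GL_map => /pairmx_inj[+ _]; exact: val_inj.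
move=> y; have [M [N yE]] := pairmx_surj (umx y).
have := umxP y; rewrite yE star_pairmx pairmxM -pairmx1 => /pairmx_inj[NM _].
have [x xM] := GLval_surj NM; exists x; rewrite ?inE //.
apply: umx_inj; rewrite umx_GL_map yE xM; congr pairmx.
rewrite -[N]trmxK; congr trmx.
have gg : GLval x^-1%g *m GLval x = 1%:M by rewrite -[_ *m _]/(GLval (x^-1 * x)%g) mulVg.
have Mg : M *m GLval x^-1%g = 1%:M by apply: mulmx1C; rewrite -xM.
by rewrite -[LHS]mul1mx -NM -mulmxA Mg mulmx1.
Qed.

End SwapCase.

Lemma INR_expn (a b : nat) : INR (a ^ b)%N = pow (INR a) b.
Proof. by elim: b => [|b IHb]; rewrite ?expn0 // expnS -multE mult_INR IHb. Qed.

Lemma INR_le_leq (a b : nat) : Rle (INR a) (INR b) -> (a <= b)%N.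
Proof. by move=> /INR_le/ssrnat.leP. Qed.

Theorem theorem1p3 :
  exists h : R -> nat -> R,
    (forall (C : R) (m : nat), Rle 1 C -> Rle 1 (h C m)) /\
    forall (C : R) (m : nat), Rle 1 C ->
    forall (q : nat), (exists p k : nat, prime p /\ (0 < k)%N /\ q = (p ^ k)%N) ->
    forall (eps : bool) (F : finFieldType), #|F| = field_size eps q ->
    forall (n : nat), Rle (h C m) (INR n) ->
    forall (sl : bool),
    let G := (if sl then SLe eps n F q else GLe eps n F q) in
    forall (i : Iirr G) (g : {'GL_n[F]}), (g \in G) ->
    Rle (INR #|('C_(GLe eps n F q)[g])%g|) (Rpower (INR q) (Rmult C (INR n))) ->
    (`|'chi_i g| <= (2 ^ m)%N.-root ('chi_i 1%g))%R.
Proof.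
exists (fun C m => INR (rank_threshold (Z.to_nat (up C)) m)); split=> [C m _|].
  by apply: (le_INR 1); apply/ssrnat.leP; rewrite addn_gt0 orbT.
move=> C m C1 q [p [k [p_pr [k_gt0 ->]]]] eps F cardF n /INR_le_leq nlarge sl G i g gG Cg.
(* [up C] is an integer above C, so a centraliser of order at most q^(C n) has order at most q^(c
   n). *)
set c := Z.to_nat (up C) in nlarge; have q1 : (1 < p ^ k)%N.
  by rewrite -(exp1n k) ltn_exp2r ?prime_gt1.
have {}Cg : (#|'C_(GLe eps n F (p ^ k))[g]%g| <= (p ^ k) ^ (c * n))%N.
  have qR : Rlt 1 (INR (p ^ k)) by apply: (lt_INR 1); apply/ssrnat.ltP.
  apply: INR_le_leq; apply: Rle_trans Cg _.
  rewrite (INR_expn (p ^ k)) -Rpower_pow; last exact: Rlt_trans Rlt_0_1 qR.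
  apply: Rle_Rpower; first exact: Rlt_le.
  rewrite -multE mult_INR; apply: Rmult_le_compat_r; first exact: pos_INR.
  have [upC _] := archimed C; rewrite INR_IZR_INZ Z2Nat.id; first exact/Rlt_le.
  apply: le_IZR; apply: Rlt_le; apply: Rle_lt_trans upC.
  exact: Rle_trans Rle_0_1 C1.
suff powle : `|'chi_i g| ^+ (2 ^ m) <= 'chi_i 1%g.
  have M0 : (0 < 2 ^ m)%N by rewrite expn_gt0.
  have aM0 : 0 <= `|'chi_i g| ^+ (2 ^ m) by rewrite exprn_ge0.
  by rewrite -[X in X <= _](@exprCK _ (2 ^ m)) // ler_rootC // qualifE /= (le_trans aM0).
move: eps cardF @G i gG Cg => [] cardF G i gG Cg; first exact: (GL_bound p_pr cardF i nlarge gG Cg).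
exact: (GU_bound p_pr k_gt0 cardF i nlarge gG Cg).
Qed.
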